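(* Let $M$ be an orientable manifold of dimension $2m$ with a closed $3$-form $H$. A generalised Calabi--Yau metric on $(M,H)$ is equivalent to a generalised $SU(m)$-structure on $(M,H)$; that is, every generalised Calabi--Yau metric $(\rho_0,\rho_1)$ determines a generalised $SU(m)$-structure, and, conversely, the pair $(\rho_0,\rho_1)$ of $SU(m)\times SU(m)$-invariant spinor fields of a generalised $SU(m)$-structure is a generalised Calabi--Yau metric.
   Context: Put $n=2m$. The generalised tangent bundle $\mathbf{E}=\mathbf{E}(H)$ is the $SO(n,n)$-vector bundle obtained from $TM\oplus T^*M$, with inner product determined by $(X\oplus\xi,X\oplus\xi)=\xi(X)$, by twisting the transition functions on overlaps $U_{ab}$ with $e^{2\beta^{(ab)}}$, where $\beta^{(ab)}=B^{(a)}-B^{(b)}$ and $H|_{U_a}=dB^{(a)}$ (here $e^{2B}(X\oplus\xi)=X\oplus(\xi+X\llcorner B)$). As a smooth bundle with inner product it is isomorphic to $TM\oplus T^*M$. Its spinor bundles are $\mathbf{S}_\pm$; after choosing a nowhere vanishing $n$-vector field $\nu$ there are isomorphisms $\rho\mapsto\rho^\nu$, $\Gamma(\mathbf{S}_\pm)\cong\Omega^{ev,od}(M)$, under which the Clifford action is $(X\oplus\xi)\bullet\rho=-X\llcorner\rho+\xi\wedge\rho$. The $Spin(n,n)_+$-invariant pairing is $\langle\rho,\tau\rangle=\nu\big([\rho^\nu\wedge\widehat{\tau^\nu}]^n\big)$, with $[\cdot]^n$ the top degree part and $\widehat{\alpha}=(-1)^{p(p+1)/2}\alpha$ on $p$-forms,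 extended complex-bilinearly to $\mathbf{S}_\pm\otimes\mathbb{C}$. A generalised metric is a maximally positive definite subbundle $\mathbf{V}^+\subset\mathbf{E}$; put $\mathbf{V}^-=(\mathbf{V}^+)^\perp$; equivalently it is the endomorphism $\mathcal{G}$ of $\mathbf{E}$ equal to $\pm\mathrm{Id}$ on $\mathbf{V}^\pm$. A generalised complex structure is an isometry $\mathcal{J}\in\mathrm{End}(\mathbf{E})$ with $\mathcal{J}^2=-\mathrm{Id}$. A generalised Calabi--Yau structure is a pure spinor field $\rho\in\Gamma(\mathbf{S}_\pm\otimes\mathbb{C})$ (i.e. its annihilator $\mathbf{W}_\rho\subset\mathbf{E}\otimes\mathbb{C}$ is maximally isotropic) with $\langle\rho,\overline\rho\rangle\ne0$ everywhere; it induces the generalised complex structure $\mathcal{J}_\rho$ whose $+i$-eigenbundle is $\mathbf{W}_\rho$. All these structures are ''almost'' structures: no integrability is assumed. A generalised K\''ahler structure is a pair of generalised complex structures $(\mathcal{J}_0,\mathcal{J}_1)$ with $\mathcal{J}_0\mathcal{J}_1=\mathcal{J}_1\mathcal{J}_0$ such that $\mathcal{G}=-\mathcal{J}_0\mathcal{J}_1$ defines a generalised metric. A generalised Calabi--Yau metric on $(M,H)$ consists of $\rho_0\in\Gamma(\mathbf{S}_+\otimes\mathbb{C})$, $\rho_1\in\Gamma(\mathbf{S}_{(-1)^m}\otimes\mathbb{C})$, each inducing a generalised Calabi--Yau structure, with $c\langle\rho_0,\overline{\rho_0}\rangle=\langle\rho_1,\overline{\rho_1}\rangle$ for some constant $c$,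 and such that $(\mathcal{J}_{\rho_0},\mathcal{J}_{\rho_1})$ is a generalised K\''ahler structure. A generalised $SU(m)$-structure on $(M,H)$ is a reduction of the structure group $\mathbb{R}_{\ne0}\times Spin(2m,2m)$ (with $\mathbb{R}_{\ne0}$ acting on spinors by rescaling) of $\mathbf{E}$ to $SU(m)\times SU(m)$, where the inclusion of $SU(m)\times SU(m)$ into $Spin(2m,2m)$ lifts the inclusion $SU(m)\times SU(m)\hookrightarrow SO(2m)\times SO(2m)\subset SO(2m,2m)$ given by the standard vector representation on each factor. Its invariant spinor fields are, for a suitable choice of data, of the following form: the structure is determined by a metric $g$ (with spin structure), a $2$-form $B$, a function $\phi$ and unit pure spinor fields $\Psi_L,\Psi_R\in\Gamma(\Delta_+)$ of the Riemannian spinor bundle $\Delta$, and with $\nu=e^{2\phi}\nu_g$ ($\nu_g$ the Riemannian $n$-vector) one has $\rho_0^\nu=e^{-\phi}e^B\wedge[\mathcal{A}(\Psi_L)\otimes\Psi_R]$, $\rho_1^\nu=e^{-\phi}e^B\wedge[\Psi_L\otimes\Psi_R]$. Here $\mathcal{A}$ is the conjugate-linear $Spin(2m)$-equivariant charge conjugation on $\Delta$ with $\mathcal{A}(X\cdot\Psi)=(-1)^{m+1}X\cdot\mathcal{A}(\Psi)$, $\mathcal{A}^2=(-1)^{m(m+1)/2}\mathrm{Id}$, and $[\Psi\otimes\Phi](X_1,\ldots,X_p)=q\big(\mathcal{A}(\Psi),(X_1\wedge\ldots\wedge X_p)\cdot\Phi\big)$ for the Hermitian product $q$ on $\Delta$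 (conjugate-linear in the first slot).
   Formalization: The invariant spinor ρ0 is taken as the complex conjugate of [A(Ψ_L)⊗Ψ_R]: with the stated conventions the literal pair makes -J0J1 equal to -1 on the positive definite bundle (check m=1). Also m≥1, and the structure's pair is (ρ0, λρ1) with a constant λ>0. *)

(* Defs.v *)
(* Points of R^n are column vectors.  The generalised tangent
   space R^n (+) (R^n)^* is 'cV_(n + n): vector part on top, covector part
   below.  A form on R^n is the column of its coefficients on the basis
   e^S = e^i1 /\ .. /\ e^ip (S = {i1 < .. < ip}), numbered by enum_rank S. *)
From HB Require Import structures.
From mathcomp Require Export all_boot all_order all_algebra.
From mathcomp Require Export all_classical all_reals all_analysis.
From mathcomp Require Export complex.

Set Implicit Arguments.
Unset Strict Implicit.
Unset Printing Implicit Defensive.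

Import Order.TTheory GRing.Theory Num.Theory numFieldNormedType.Exports.
Local Open Scope classical_set_scope.
Local Open Scope ring_scope.

Notation fdim n := #|{: {set 'I_n}}|.

Section Exterior.
Variables (F : comNzRingType) (n : nat).

(* e^i /\ _ *)
Definition ext (i : 'I_n) : 'M[F]_(fdim n) :=
  \matrix_(t, s) let T : {set 'I_n} := enum_val t in let S : {set 'I_n} := enum_val s in
    if (i \notin S) && (T == i |: S)%SET
    then (-1) ^+ #|[set j in S | (j < i)%N]%SET| else 0.

(* the interior product with e_i is the transpose of e^i /\ _ *)
Definition ctr (i : 'I_n) : 'M[F]_(fdim n) := (ext i)^T.

Definition form1 : 'cV[F]_(fdim n) := delta_mx (enum_rank finset.set0) 0.

(* (X (+) xi) . rho = - X -| rho + xi /\ rho *)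
Definition cliff (v : 'cV[F]_(n + n)) : 'M[F]_(fdim n) :=
  \sum_i (dsubmx v i 0 *: ext i - usubmx v i 0 *: ctr i).

(* pullback of forms by C: e^S |-> C^* e^i1 /\ .. /\ C^* e^ip,
   where C^* e^i = \sum_j C i j e^j *)
Definition pullback (C : 'M[F]_n) : 'M[F]_(fdim n) :=
  \matrix_(t, s)
    ((\prod_(i <- enum (enum_val s : {set 'I_n})) \sum_j C i j *: ext j) *m form1) t 0.

(* sign of e^S /\ e^T relative to e^(S u T), for disjoint S and T *)
Definition wedge_sign (S T : {set 'I_n}) : F :=
  (-1) ^+ #|[set p : 'I_n * 'I_n |
             [&& p.1 \in S, p.2 \in T & (p.2 < p.1)%N]]%SET|.

(* top degree coefficient of rho /\ hat tau, where hat is the sign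
   (-1)^(p(p+1)/2) = (-1)^'C(p.+1, 2) on p-forms *)
Definition spairing (rho tau : 'cV[F]_(fdim n)) : F :=
  \sum_(S : {set 'I_n})
    wedge_sign S (finset.setC S) * (-1) ^+ 'C(#|finset.setC S|.+1, 2) *
    rho (enum_rank S) 0 * tau (enum_rank (finset.setC S)) 0.

Definition has_parity (b : bool) (rho : 'cV[F]_(fdim n)) :=
  forall S : {set 'I_n}, odd #|S| != b -> rho (enum_rank S) 0 = 0.

End Exterior.

Section NeutralForm.
Variables (F : fieldType) (n : nat).

(* polarisation of (X (+) xi, X (+) xi) = xi(X) *)
Definition gram : 'M[F]_(n + n) := 2^-1 *: block_mx 0 1%:M 1%:M 0.

Definition inner (v w : 'cV[F]_(n + n)) : F := (v^T *m gram *m w) 0 0.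

Definition isotropic (W : set 'cV[F]_(n + n)) :=
  forall v w, W v -> W w -> inner v w = 0.

Definition maximally_isotropic (W : set 'cV[F]_(n + n)) :=
  isotropic W /\
  forall U : {vspace 'cV[F]_(n + n)},
    W `<=` [set` U] -> isotropic [set` U] -> [set` U] `<=` W.

Definition annihilator (rho : 'cV[F]_(fdim n)) : set 'cV[F]_(n + n) :=
  [set v | cliff v *m rho = 0].

Definition pure (rho : 'cV[F]_(fdim n)) := maximally_isotropic (annihilator rho).

End NeutralForm.

Section RealGroups.
Variables (R : realType) (n : nat).

(* Spin(n,n) (both components), inside End(\Lambda^* (R^n)^* ) = Cl(n,n) *)
Definition Spin : set 'M[R]_(fdim n) :=
  [set s | exists vs : seq 'cV[R]_(n + n),
     [/\ ~~ odd (size vs), forall v, v \in vs -> `|inner v v| = 1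
       & s = \prod_(v <- vs) cliff v]].

(* s covers g under Spin(n,n) -> SO(n,n), i.e. s v s^-1 = g v *)
Definition covers (s : 'M[R]_(fdim n)) (g : 'M[R]_(n + n)) :=
  forall v, s *m cliff v = cliff (g *m v) *m s.

(* GL(n)_+ in SO(n,n), and its lift A |-> sqrt(det A) (A^-1)^* to Spin(n,n) *)
Definition gl_vec (A : 'M[R]_n) : 'M[R]_(n + n) := block_mx A 0 0 (invmx A)^T.
Definition gl_spin (A : 'M[R]_n) : 'M[R]_(fdim n) :=
  Num.sqrt (\det A) *: pullback (invmx A).

(* For a 2-form beta, given by beta i j = beta(e_i, e_j):
   e^(2 beta) : X (+) xi |-> X (+) (xi + X -| beta), and its lift e^beta /\ _ *)
Definition bfield_vec (beta : 'M[R]_n) : 'M[R]_(n + n) :=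
  block_mx 1%:M 0 beta^T 1%:M.
Definition bfield_spin (beta : 'M[R]_n) : 'M[R]_(fdim n) :=
  let b := \sum_(i < n) \sum_(j < n | (i < j)%N) beta i j *: (ext R i * ext R j) in
  \sum_(k < n.+1) k`!%:R^-1 *: b ^+ k.

Definition positive_definite (V : {vspace 'cV[R]_(n + n)}) :=
  forall v, v \in V -> v != 0 -> 0 < inner v v.

Definition maximally_positive_definite (V : {vspace 'cV[R]_(n + n)}) :=
  positive_definite V /\
  forall U, (V <= U)%VS -> positive_definite U -> (U <= V)%VS.

Definition generalised_metric_at (G : 'M[R]_(n + n)) :=
  exists V, [/\ maximally_positive_definite V,
    forall v, v \in V -> G *m v = v
  & forall v, (forall w, w \in V -> inner v w = 0) -> G *m v = - v].

End RealGroups.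

Notation toC := (real_complex _).

Section Model.
Variables (R : realType) (m : nat).
Local Notation C := R[i].

Definition SU : set 'M[C]_m :=
  [set A | (map_mx conjc A)^T *m A = 1%:M /\ \det A = 1].

(* C^m = R^(m + m) by z_k = x_k + i x_(m + k) *)
Definition realify (A : 'M[C]_m) : 'M[R]_(m + m) :=
  let re := map_mx (@complex.Re R) A in let im := map_mx (@complex.Im R) A in
  block_mx re (- im) im re.

(* SO(n) x SO(n) -> SO(n,n): A acts on the positive definite subspace
   {X (+) X}, B on the negative definite subspace {X (+) -X} *)
Definition so_so (n : nat) (A B : 'M[R]_n) : 'M[R]_(n + n) :=
  2^-1 *: block_mx (A + B) (A - B) (A - B) (A + B).

(* a homomorphism SU(m) x SU(m) -> Spin(2m,2m) lifting
   SU(m) x SU(m) -> SO(2m) x SO(2m) -> SO(2m,2m); there is exactly one,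
   since SU(m) is simply connected and perfect *)
Definition spin_lift (iota : 'M[C]_m -> 'M[C]_m -> 'M[R]_(fdim (m + m))) :=
  [/\ forall A B, SU A -> SU B -> Spin (iota A B),
      forall A B, SU A -> SU B ->
        covers (iota A B) (so_so (realify A) (realify B))
    & forall A A' B B', SU A -> SU A' -> SU B -> SU B' ->
        iota (A *m A') (B *m B') = iota A B *m iota A' B'].

Definition SUxSU (iota : 'M[C]_m -> 'M[C]_m -> 'M[R]_(fdim (m + m))) :
    set 'M[R]_(fdim (m + m)) :=
  [set s | exists A B, [/\ SU A, SU B & s = iota A B]].

(* The spinor module Delta of R^(m + m) is \Lambda^* C^m with its standard
   Hermitian product; the gammas are skew-Hermitian and gam i ^ 2 = -1 *)
Definition gam (i : 'I_(m + m)) : 'M[C]_(fdim m) :=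
  match fintype.split i with
  | inl k => ext C k - ctr C k
  | inr k => Complex 0 1 *: (ext C k + ctr C k)
  end.

Definition hermitian (Psi Phi : 'cV[C]_(fdim m)) : C :=
  ((map_mx conjc Psi)^T *m Phi) 0 0.

(* charge conjugation: the product of the real gammas, composed with
   conjugation; it satisfies A (gam i Psi) = (-1)^(m+1) gam i (A Psi) and
   A (A Psi) = (-1)^(m(m+1)/2) Psi *)
Definition charge (Psi : 'cV[C]_(fdim m)) : 'cV[C]_(fdim m) :=
  (\prod_(k < m) gam (lshift m k)) *m map_mx conjc Psi.

(* [Psi (x) Phi](X_1, .., X_p) = q(A Psi, (X_1 /\ .. /\ X_p) . Phi) *)
Definition fierz (Psi Phi : 'cV[C]_(fdim m)) : 'cV[C]_(fdim (m + m)) :=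
  \col_s hermitian (charge Psi)
           ((\prod_(i <- enum (enum_val s : {set 'I_(m + m)})) gam i) *m Phi).

(* The unit pure spinor fixed by SU(m): (gam k + i gam (m + k)) kills it, and
   i^m gam 0 gam m gam 1 gam (m+1) .. fixes it, so it lies in Delta_+ *)
Definition vacuum : 'cV[C]_(fdim m) := form1 C m.

(* The SU(m) x SU(m)-invariant spinors of the model.  Complex conjugation in
   model0 makes -J_0 J_1 equal to +1 (instead of -1) on the positive definite
   subspace {X (+) X}: up to scalars the pair is (e^(i omega), Omega), whereas
   [A Psi (x) Psi] is a multiple of e^(- i omega), with
   omega = g(I . , . ), I e_k = e_(m + k), Omega = dz_1 /\ .. /\ dz_m. *)
Definition model0 : 'cV[C]_(fdim (m + m)) :=
  map_mx conjc (fierz (charge vacuum) vacuum).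
Definition model1 : 'cV[C]_(fdim (m + m)) := fierz vacuum vacuum.

End Model.

Section Smooth.
Variables (R : realType) (n : nat).

Definition partial (i : 'I_n) (f : 'cV[R]_n -> R) : 'cV[R]_n -> R :=
  fun x => 'D_(delta_mx i 0 : 'cV[R]_n) f x.

(* k times continuously differentiable on the open set V *)
Fixpoint Ck (k : nat) (V : set 'cV[R]_n) (f : 'cV[R]_n -> R) : Prop :=
  (forall x, V x -> {for x, continuous f}) /\
  match k with
  | 0 => True
  | k'.+1 => forall i : 'I_n,
      (forall x, V x -> derivable f x (delta_mx i 0 : 'cV[R]_n)) /\
      Ck k' V (partial i f)
  end.

Definition smooth_on (V : set 'cV[R]_n) (f : 'cV[R]_n -> R) :=
  forall k, Ck k V f.

Definition smooth_map_on p q (V : set 'cV[R]_n) (f : 'cV[R]_n -> 'M[R]_(p, q)) :=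
  forall i j, smooth_on V (fun x => f x i j).

Definition jacobian_mx (f : 'cV[R]_n -> 'cV[R]_n) (x : 'cV[R]_n) : 'M[R]_n :=
  \matrix_(i, j) partial j (fun y => f y i 0) x.

End Smooth.

(* Smooth n-manifolds with an oriented atlas; [cochart a] inverts [chart a]. *)
Record oriented_atlas (R : realType) (n : nat) (M : topologicalType) (I : Type) :=
  OrientedAtlas {
  dom : I -> set M;
  chart : I -> M -> 'cV[R]_n;
  cochart : I -> 'cV[R]_n -> M;
  _ : forall a, open (dom a);
  _ : forall x, exists a, dom a x;
  _ : forall a, open (chart a @` dom a);
  _ : forall a x, dom a x -> cochart a (chart a x) = x;
  _ : forall a x, dom a x -> {for x, continuous (chart a)};
  _ : forall a x, dom a x -> {for chart a x, continuous (cochart a)};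
  _ : forall a b, smooth_map_on (chart b @` (dom a `&` dom b))
                    (chart a \o cochart b);
  _ : forall a b x, dom a x -> dom b x ->
        0 < \det (jacobian_mx (chart a \o cochart b) (chart b x))
}.

(* Fields on M are given by their components [f a x] in the trivialisation over
   [dom a]; only the values at [x] in [dom a] are meaningful. *)
Section Manifold.
Variables (R : realType) (n : nat) (M : topologicalType) (I : Type).
Variable At : oriented_atlas R n M I.
Local Notation dom := (dom At).
Local Notation chart := (chart At).
Local Notation cochart := (cochart At).
Local Notation N := (fdim n).
Local Notation C := R[i].

Definition smooth_in (a : I) (V : set M) (f : M -> R) :=
  smooth_on (chart a @` V) (f \o cochart a).

Definition smooth_mx_in p q (a : I) (V : set M) (f : M -> 'M[R]_(p, q)) :=
  forall i j, smooth_in a V (fun x => f x i j).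

Definition smooth_cmx_in p q (a : I) (V : set M) (f : M -> 'M[C]_(p, q)) :=
  smooth_mx_in a V (fun x => map_mx (@complex.Re R) (f x)) /\
  smooth_mx_in a V (fun x => map_mx (@complex.Im R) (f x)).

Definition pd (a : I) (i : 'I_n) (f : M -> R) (x : M) : R :=
  partial i (f \o cochart a) (chart a x).

Definition transition (a b : I) (x : M) : 'M[R]_n :=
  jacobian_mx (chart a \o cochart b) (chart b x).

Definition closed_3form (H : I -> M -> 'I_n -> 'I_n -> 'I_n -> R) :=
  [/\ forall a i j k, smooth_in a (dom a) (fun x => H a x i j k),
      forall a x i j k, dom a x ->
        H a x i j k = - H a x j i k /\ H a x i j k = - H a x i k j,
      forall a b x i j k, dom a x -> dom b x ->
        H a x i j k = \sum_p \sum_q \sum_r H b x p q r *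
          transition b a x p i * transition b a x q j * transition b a x r k
    & forall a x i j k l, dom a x ->
        pd a i (fun y => H a y j k l) x - pd a j (fun y => H a y i k l) x +
        pd a k (fun y => H a y i j l) x - pd a l (fun y => H a y i j k) x = 0].

(* local 2-forms B^(a) on [dom a] with d B^(a) = H *)
Definition local_potentials (H : I -> M -> 'I_n -> 'I_n -> 'I_n -> R)
    (B : I -> M -> 'M[R]_n) :=
  [/\ forall a, smooth_mx_in a (dom a) (B a),
      forall a x, dom a x -> (B a x)^T = - B a x
    & forall a x i j k, dom a x ->
        H a x i j k = pd a i (fun y => B a y j k) x +
                      pd a j (fun y => B a y k i) x +
                      pd a k (fun y => B a y i j) x].

Variable B : I -> M -> 'M[R]_n.

(* B^(a) - B^(b), in the coordinates of [chart a] *)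
Definition beta (a b : I) (x : M) : 'M[R]_n :=
  B a x - (transition b a x)^T *m B b x *m transition b a x.

(* transition functions of E(H), and their lift to Spin(n,n), which are those of
   the spinor bundles: v_a = E_trans a b x *m v_b, rho_a = S_trans a b x *m rho_b *)
Definition E_trans (a b : I) (x : M) : 'M[R]_(n + n) :=
  bfield_vec (beta a b x) *m gl_vec (transition a b x).
Definition S_trans (a b : I) (x : M) : 'M[R]_N :=
  bfield_spin (beta a b x) *m gl_spin (transition a b x).

(* Sections of S_+ (x) C (p = false) and S_- (x) C (p = true).  The factor
   sqrt(det) in S_trans makes the components of rho in a chart those of
   (nu_a)^(1/2) (e^B^(a) /\ rho^nu), nu = nu_a d_1 /\ .. /\ d_n, so that
   <rho, tau> is computed by [spairing] in any chart. *)
Definition spinor_field (p : bool) (rho : I -> M -> 'cV[C]_N) :=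
  [/\ forall a, smooth_cmx_in a (dom a) (rho a),
      forall a x, dom a x -> has_parity p (rho a x)
    & forall a b x, dom a x -> dom b x ->
        rho a x = map_mx toC (S_trans a b x) *m rho b x].

Definition generalised_CY (p : bool) (rho : I -> M -> 'cV[C]_N) :=
  [/\ spinor_field p rho,
      forall a x, dom a x -> pure (rho a x)
    & forall a x, dom a x ->
        spairing (rho a x) (map_mx conjc (rho a x)) != 0].

Definition E_endomorphism (J : I -> M -> 'M[R]_(n + n)) :=
  (forall a, smooth_mx_in a (dom a) (J a)) /\
  (forall a b x, dom a x -> dom b x ->
     J a x *m E_trans a b x = E_trans a b x *m J b x).

Definition generalised_complex (J : I -> M -> 'M[R]_(n + n)) :=
  [/\ E_endomorphism J,
      forall a x v w, dom a x -> inner (J a x *m v) (J a x *m w) = inner v w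
    & forall a x, dom a x -> J a x *m J a x = - 1%:M].

(* the +i-eigenbundle of J is W_rho *)
Definition induces (rho : I -> M -> 'cV[C]_N) (J : I -> M -> 'M[R]_(n + n)) :=
  forall a x, dom a x ->
    [set v | map_mx toC (J a x) *m v = Complex 0 1 *: v] = annihilator (rho a x).

Definition generalised_Kahler (J0 J1 : I -> M -> 'M[R]_(n + n)) :=
  [/\ generalised_complex J0, generalised_complex J1,
      forall a x, dom a x -> J0 a x *m J1 a x = J1 a x *m J0 a x
    & forall a x, dom a x -> generalised_metric_at (- (J0 a x *m J1 a x))].

(* Principal subbundles, with fibre the group K, of the principal
   R_{<>0} x Spin(n,n)-bundle associated with E(H): [Q a x] is the set of the
   adapted frames at x, in the trivialisation a. *)
Definition reduction (K : set 'M[R]_N) (Q : I -> M -> set (R * 'M[R]_N)) :=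
  [/\ forall a x p, dom a x -> Q a x p -> p.1 != 0 /\ Spin p.2,
      forall a b x, dom a x -> dom b x ->
        Q a x = [set (p.1, S_trans a b x *m p.2) | p in Q b x]
    & forall a x, dom a x -> exists V : set M, [/\ open V, V x, V `<=` dom a
        & exists (r : M -> R) (s : M -> 'M[R]_N),
          [/\ smooth_in a V r, smooth_mx_in a V s
            & forall y, V y -> Q a y = [set (r y, s y *m k) | k in K]]]].

(* the spinor field whose component is sigma in all the frames of Q *)
Definition invariant_spinor (Q : I -> M -> set (R * 'M[R]_N))
    (sigma : 'cV[C]_N) (rho : I -> M -> 'cV[C]_N) :=
  forall a x p, dom a x -> Q a x p ->
    rho a x = toC p.1 *: (map_mx toC p.2 *m sigma).

(* (r, s) and (-r, -s) act in the same way on spinors *)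
Definition same_action (Q Q' : I -> M -> set (R * 'M[R]_N)) :=
  forall a x, dom a x ->
    [set p.1 *: p.2 | p in Q a x] = [set p.1 *: p.2 | p in Q' a x].

End Manifold.

Section Main.
Variables (R : realType) (m : nat) (M : topologicalType) (I : Type).
Variable At : oriented_atlas R (m + m) M I.
Variable B : I -> M -> 'M[R]_(m + m).
Local Notation N := (fdim (m + m)).
Local Notation C := R[i].

Definition generalised_CY_metric (rho0 rho1 : I -> M -> 'cV[C]_N) :=
  [/\ generalised_CY At B false rho0, generalised_CY At B (odd m) rho1,
      exists c : C, forall a x, dom At a x ->
        c * spairing (rho0 a x) (map_mx conjc (rho0 a x)) =
        spairing (rho1 a x) (map_mx conjc (rho1 a x))
    & exists J0 J1, [/\ induces At rho0 J0, induces At rho1 J1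
                      & generalised_Kahler At B J0 J1]].

Definition generalised_SU_structure
    (iota : 'M[C]_m -> 'M[C]_m -> 'M[R]_N) (Q : I -> M -> set (R * 'M[R]_N)) :=
  reduction At B (SUxSU iota) Q.

Definition invariant_pair (Q : I -> M -> set (R * 'M[R]_N))
    (rho0 rho1 : I -> M -> 'cV[C]_N) :=
  invariant_spinor At Q (model0 R m) rho0 /\
  invariant_spinor At Q (model1 R m) rho1.

End Main.

(* Main.v *)
(* At a point, a pair of commuting generalised complex structures whose product
   is a generalised metric splits the tangent space into V^+ and V^-, each
   carrying a complex structure; a unitary frame of both is an isometry g that
   carries the model structures J_(-1), J_1 to J_0, J_1.  A lift s of g to the Pin
   group (products of reflections) maps the model spinors to multiples of rho_0
   and rho_1, since a pure spinor is determined by its annihilator up to a scalar,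
   and parity puts s in Spin.  The two phases are absorbed by rotations in a plane
   of V^+ and a plane of V^-, leaving rho_0 = r_0 s m_0 and rho_1 = r_1 s m_1 with
   r_0, r_1 > 0; the condition on the norms makes r_0 / r_1 constant.  All choices
   (Gram-Schmidt, reflections, square roots of phases) can be made smoothly near a
   point.  Two such s differ by the stabiliser of (m_0, m_1) in Spin, which is
   the image of SU(m) x SU(m): a unitary pair (A, B) is covered by a spin element
   acting on m_0, m_1 by square roots of (det A)^-1 (det B)^(+-1).
   Conversely the structure J induced by rho is smooth, because the inner product
   of v and J w is the imaginary part of - <v w rho, rho^*> / <rho, rho^*>. *)
Require Import Defs.
From HB Require Import structures.
From mathcomp Require Import ring zify spectral.
Import Order.TTheory GRing.Theory Num.Theory numFieldNormedType.Exports.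
Local Open Scope classical_set_scope.
Local Open Scope ring_scope.

Set Implicit Arguments.
Unset Strict Implicit.
Unset Printing Implicit Defensive.

(** * Forms and Fock spaces *)

(** A frame [(r, s)] carries one scalar for both spinors, while a generalised Calabi-Yau metric only
    fixes the ratio of their norms. This is why rho_1 is first rescaled by a constant lambda, which
    makes the two radii equal. Requiring [0 < r] then selects one of [(r, s)] and [(- r, - s)]; the
    spinor pairing determines r^4, hence r. Spin lifts are known only up to sign, so the phases by
    which lifts of U(m) x U(m) act on the model spinors are square roots without a preferred choice.
    On SU(m) x SU(m) the sign disappears without any topology: every element is a square, and [iota]
    is a homomorphism. Most of the algebra is done over a field where 2 is nonzero, with a given
    root [ii] of -1 where needed and conjugation as an abstract ring morphism, so that real matrices
    and their complexifications share the lemmas. The analysis is done with germs at a chart point,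
    since no choice persists beyond a neighbourhood; a lift of a single isometry is the case of a
    constant germ. *)

Section FormBasis.
Variables (F : comNzRingType) (n : nat).
Implicit Types (i j : 'I_n) (S T : {set 'I_n}).

Definition bas S : 'cV[F]_(fdim n) := delta_mx (enum_rank S) 0.

(** Sign of moving [e^i] from the front of [e^S] to its sorted place. *)
Definition sg i S : F := (-1) ^+ #|[set j in S | (j < i)%N]%SET|.

Lemma basE S T : bas S (enum_rank T) 0 = (T == S)%:R.
Proof. by rewrite mxE eqxx andbT (inj_eq enum_rank_inj). Qed.

Lemma form_ext p (f g : 'M[F]_(fdim n, p)) :
  (forall S q, f (enum_rank S) q = g (enum_rank S) q) -> f = g.
Proof. by move=> fg; apply/matrixP => t q; rewrite -[t]enum_valK fg. Qed.

Lemma mul_bas p (X : 'M[F]_(p, fdim n)) S q : (X *m bas S) q 0 = X q (enum_rank S).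
Proof. by rewrite -colE mxE. Qed.

Lemma bas_ext p (X Y : 'M[F]_(p, fdim n)) :
  (forall S, X *m bas S = Y *m bas S) -> X = Y.
Proof.
by move=> XY; apply/matrixP => q s; rewrite -[s]enum_valK -!mul_bas XY.
Qed.

Lemma ext_bas i S :
  ext F i *m bas S = if i \in S then 0 else sg i S *: bas (i |: S).
Proof.
apply: form_ext => T k; rewrite (ord1 k) mul_bas mxE !enum_rankK.
case: ifP => iS; rewrite /= iS /= !mxE // ?eqxx ?andbT (inj_eq enum_rank_inj).
by case: eqP; rewrite (mulr1, mulr0).
Qed.

Lemma ctr_bas i S :
  ctr F i *m bas S = if i \in S then sg i (S :\ i) *: bas (S :\ i) else 0.
Proof.
apply: form_ext => T k; rewrite (ord1 k) mul_bas !mxE !enum_rankK /=.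
have -> : (i \notin T) && (S == (i |: T)%SET) = (i \in S) && (T == S :\ i).
  apply/andP/andP => -[iT /eqP ->].
    by rewrite setU11 finset.setU1K.
  by rewrite !inE eqxx finset.setD1K.
case: (boolP (i \in S)) => iS /=; last by rewrite mxE.
rewrite [RHS]mxE basE; by case: eqP => [->|]; rewrite ?mulr1 ?mulr0.
Qed.

Lemma sgU i j S : j \notin S ->
  sg i (j |: S) = (if (j < i)%N then -1 else 1) * sg i S.
Proof.
move=> jS; rewrite /sg; case: ifP => ji; last first.
  rewrite mul1r; congr (_ ^+ #|pred_of_set _|); apply/setP => k; rewrite !inE.
  by case: eqP => [->|]; rewrite ?ji ?andbF.
rewrite -exprS; congr (_ ^+ _).
have -> : [set k in j |: S | (k < i)%N]%SET = j |: [set k in S | (k < i)%N]%SET.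
  by apply/setP => k; rewrite !inE; case: eqP => [->|]; rewrite ?ji.
by rewrite cardsU1 !inE (negbTE jS).
Qed.

Lemma sg_sqr i S : sg i S * sg i S = 1.
Proof. by rewrite /sg -expr2 sqrr_sign. Qed.

Lemma ext_sq i : ext F i * ext F i = 0.
Proof.
apply: bas_ext => S; rewrite -mulmxE -mulmxA ext_bas mul0mx.
by case: ifP; rewrite ?mulmx0 // -scalemxAr ext_bas setU11 scaler0.
Qed.

Lemma ext_anti i j : ext F i * ext F j = - (ext F j * ext F i).
Proof.
have [<-|nij] := eqVneq i j; first by rewrite ext_sq oppr0.
apply: bas_ext => S; rewrite mulNmx -!mulmxE -!mulmxA !ext_bas.
have [jS|jS] := boolP (j \in S); have [iS|iS] := boolP (i \in S);
  rewrite ?mulmx0 ?oppr0 // -!scalemxAr !ext_bas ?inE ?(iS, jS) ?orbT ?scaler0 ?oppr0 //.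
rewrite [j == i]eq_sym (negbTE nij) (negbTE iS) (negbTE jS) /= !scalerA -scaleNr finset.setUCA; congr (_ *: _).
rewrite !sgU //; case: (ltngtP i j) => [||/val_inj eij]; last by rewrite eij eqxx in nij.
  by rewrite mul1r mulN1r mulrN opprK mulrC.
by rewrite mul1r mulN1r mulrN mulrC.
Qed.

Lemma ctr_anti i j : ctr F i * ctr F j = - (ctr F j * ctr F i).
Proof. by rewrite /ctr -!mulmxE -!trmx_mul !mulmxE ext_anti linearN. Qed.

(** Canonical anticommutation relation. For [i != j] only sets with [i] inside and [j] outside
    matter, and there the two orders differ by one crossing. *)
Lemma ctr_ext i j : ctr F i * ext F j + ext F j * ctr F i = ((i == j)%:R)%:M.
Proof.
apply: bas_ext => S; rewrite mulmxDl -!mulmxE -!mulmxA ext_bas ctr_bas mul_scalar_mx.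
have [->|nij] := eqVneq i j; rewrite ?(scale1r, scale0r).
  case: ifP => jS; rewrite mulmx0 ?addr0 ?add0r -!scalemxAr ?ext_bas ?ctr_bas.
    by rewrite !inE eqxx /= scalerA sg_sqr scale1r finset.setD1K.
  by rewrite setU11 finset.setU1K ?jS // scalerA sg_sqr scale1r.
have [iS|iS] := boolP (i \in S); last first.
  rewrite mulmx0 addr0; case: ifP; rewrite ?mulmx0 // => _.
  by rewrite -scalemxAr ctr_bas !inE (negbTE nij) (negbTE iS) scaler0.
rewrite -[X in _ + X]scalemxAr ext_bas !inE [j == i]eq_sym nij /=.
have [jS|jS] := boolP (j \in S); first by rewrite mulmx0 scaler0 addr0.
rewrite -scalemxAr ctr_bas !inE (negbTE nij) iS /=.
have -> : (j |: S) :\ i = j |: (S :\ i).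
  apply/setP => k; rewrite !inE; case: (eqVneq k j) => [->|_] //=.
  by rewrite eq_sym nij.
have jSi : j \notin S :\ i by rewrite !inE (negbTE jS) andbF.
rewrite !scalerA -scalerDl sgU // -[X in sg j X](finset.setD1K iS) sgU ?inE ?eqxx //.
case: (ltngtP i j) => [||/val_inj eij]; last by rewrite eij eqxx in nij.
  by rewrite mul1r mulN1r mulNr [X in - X]mulrC addNr scale0r.
by rewrite mul1r mulN1r mulrN [X in - X]mulrC addNr scale0r.
Qed.

Lemma form1E : form1 F n = bas finset.set0. Proof. by []. Qed.

Lemma ctr_form1 i : ctr F i *m form1 F n = 0.
Proof. by rewrite form1E ctr_bas inE. Qed.

End FormBasis.

Section OrderedProduct.
Variables (A : pzRingType) (n : nat) (x : 'I_n -> A).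
Hypothesis x_anti : forall i j, i != j -> x i * x j = - (x j * x i).
Implicit Types (i j : 'I_n) (S T : {set 'I_n}).

Lemma enum_sorted : sorted (fun i j : 'I_n => (i < j)%N) (enum 'I_n).
Proof.
have := iota_ltn_sorted 0 n; rewrite -val_enum_ord sorted_map.
by apply: sub_sorted.
Qed.

Lemma prod_enumE S : \prod_(i <- enum S) x i = \prod_(i <- enum 'I_n | i \in S) x i.
Proof.
have -> : enum S = [seq i <- enum 'I_n | i \in S].
  by rewrite /enum_mem -filter_predI; apply: eq_filter => k; rewrite !inE andbT.
by rewrite big_filter.
Qed.

(** Induction along the sorted list: [x i] passes every smaller factor with a sign until it meets
    [i] itself, and sortedness guarantees that no smaller factor comes later. *)
Lemma mul_prod_sorted l i S : sorted (fun i j : 'I_n => (i < j)%N) l ->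
  i \in l -> i \notin S ->
  x i * \prod_(j <- l | j \in S) x j =
  (-1) ^+ count (fun j : 'I_n => (j \in S) && (j < i)%N) l *
  \prod_(j <- l | j \in i |: S) x j.
Proof.
move=> + + iS; elim: l => [//|h t IH] st; rewrite inE /= !big_cons !inE.
have ht j : j \in t -> (h < j)%N.
  move=> jt; have := st; rewrite /= path_sortedE => [/andP[/allP /(_ j jt) //]|].
  by move=> a b c; apply: ltn_trans.
have [eih _|nih /= it] := eqVneq i h.
  subst h => /=.
  rewrite ltnn andbF add0n (negbTE iS) (_ : count _ t = 0); last first.
    apply/eqP; rewrite -leqn0 leqNgt -has_count; apply/hasPn => j jt.
    by rewrite negb_and -leqNgt ltnW ?orbT // ht.
  rewrite mul1r; congr (_ * _); rewrite big_seq_cond [RHS]big_seq_cond.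
  apply: eq_bigl => j; rewrite !inE; case: (boolP (j \in t)) => //= jt.
  by case: eqVneq => // ejh; have := ht _ jt; rewrite ejh ltnn.
rewrite (ht _ it) andbT.
have {}IH := IH (path_sorted st) it.
case: ifP => hS; last by rewrite add0n.
rewrite mulrA (x_anti nih) mulNr -[x h * _ * _]mulrA IH exprS mulN1r mulNr; congr (- _).
by rewrite !mulrA commr_sign.
Qed.

Lemma mul_prod_enum i S : i \notin S ->
  x i * \prod_(j <- enum S) x j =
  (-1) ^+ #|[set j in S | (j < i)%N]%SET| * \prod_(j <- enum (i |: S)) x j.
Proof.
move=> iS; rewrite !prod_enumE mul_prod_sorted ?enum_sorted ?mem_enum //.
congr (_ ^+ _ * _); rewrite enumT cardE /enum_mem size_filter.
by apply: eq_count => j; rewrite !inE.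
Qed.

Lemma prod_enum_mul i S : i \notin S ->
  \prod_(j <- enum S) x j * x i = (-1) ^+ #|S| * (x i * \prod_(j <- enum S) x j).
Proof.
move=> iS; have : {in enum S, forall j, j != i}.
  by move=> j; rewrite mem_enum; apply: contraTneq => ->.
rewrite cardE; elim: (enum S) => [|h t IH] nt; first by rewrite !big_nil expr0 !mul1r mulr1.
rewrite !big_cons -mulrA IH => [|j jt]; last by rewrite nt // inE jt orbT.
have ih : i != h by rewrite eq_sym nt // inE eqxx.
rewrite /= exprS -mulrA mulN1r [x i * _ in RHS]mulrA (x_anti ih) mulNr mulrN opprK.
by rewrite -[x h * x i * _]mulrA !mulrA commr_sign.
Qed.
End OrderedProduct.

Section Fock.
Variables (F : comNzRingType) (n : nat).
Implicit Types (i j : 'I_n) (S T : {set 'I_n}).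
Local Notation N := (fdim n).

Lemma form_coord S (f : 'cV[F]_N) : f (enum_rank S) 0 = ((bas F S)^T *m f) 0 0.
Proof. by rewrite trmx_delta -rowE mxE. Qed.

Lemma ext_coord i S (f : 'cV[F]_N) : (ext F i *m f) (enum_rank S) 0 =
  if i \in S then sg F i (S :\ i) * f (enum_rank (S :\ i)) 0 else 0.
Proof.
rewrite [LHS]form_coord mulmxA -[ext F i]trmxK -trmx_mul -/(ctr F i) ctr_bas.
case: ifP => _; last by rewrite trmx0 mul0mx mxE.
by rewrite linearZ -scalemxAl mxE -form_coord.
Qed.

Lemma ctr_coord i S (f : 'cV[F]_N) : (ctr F i *m f) (enum_rank S) 0 =
  if i \in S then 0 else sg F i S * f (enum_rank (i |: S)) 0.
Proof.
rewrite [LHS]form_coord mulmxA /ctr -trmx_mul ext_bas.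
case: ifP => _; first by rewrite trmx0 mul0mx mxE.
by rewrite linearZ -scalemxAl mxE -form_coord.
Qed.

(** Every basis form is, up to sign, a word in the [ext i] applied to 1, and [D] can be moved
    through the word. [Y] is left free so that commuting and anticommuting families are both
    covered. *)
Lemma spinor_span p (D : 'M[F]_(p, N)) (Y : 'I_n -> 'M[F]_p) :
  D *m form1 F n = 0 -> (forall i, D *m ext F i = Y i *m D) -> D = 0.
Proof.
move=> D1 DE; apply: bas_ext => S; rewrite mul0mx.
have [k] := ubnP #|S|; elim: k S => // k IH S; rewrite ltnS => Sk.
have [->//|[i iS]] := set_0Vmem S.
rewrite -(finset.setD1K iS).
have -> : bas F (i |: S :\ i) = sg F i (S :\ i) *: (ext F i *m bas F (S :\ i)).
  by rewrite ext_bas !inE eqxx /= scalerA sg_sqr scale1r.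
rewrite -scalemxAr mulmxA DE -mulmxA IH ?mulmx0 ?scaler0 //.
by rewrite (leq_trans _ Sk) // (cardsD1 i S) iS.
Qed.

(** The vacuum is unique: the coefficient at a nonempty set is read off, up to sign, from the
    contraction by any of its elements. *)
Lemma ctr_kernel (f : 'cV[F]_N) :
  (forall i, ctr F i *m f = 0) -> f = f (enum_rank finset.set0) 0 *: form1 F n.
Proof.
move=> cf; apply: form_ext => S k; rewrite (ord1 k) mxE basE.
have [->|[i iS]] := set_0Vmem S; first by rewrite eqxx mulr1.
have := ctr_coord i (S :\ i) f; rewrite cf mxE !inE eqxx finset.setD1K //= => /esym E.
have nS : S != finset.set0 by apply/set0Pn; exists i.
by rewrite (negbTE nS) mulr0 -[LHS]mul1r -(sg_sqr F i (S :\ i)) -mulrA E mulr0.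
Qed.

(** Schur's lemma for the Fock space: [X] maps 1 to a vector killed by all contractions, and
    subtracting the resulting scalar leaves an operator to which [spinor_span] applies. *)
Lemma commutant_scalar (X : 'M[F]_N) :
    (forall i, X *m ext F i = ext F i *m X) ->
    (forall i, X *m ctr F i = ctr F i *m X) ->
  X = ((X *m form1 F n) (enum_rank finset.set0) 0)%:M.
Proof.
move=> XE XC; set c := _ 0; apply/eqP; rewrite -subr_eq0; apply/eqP.
apply: (spinor_span (Y := ext F (n:=n))) => [|i].
  rewrite mulmxBl mul_scalar_mx [X *m _]ctr_kernel ?subrr // => i.
  by rewrite mulmxA -XC -mulmxA ctr_form1 mulmx0.
by rewrite mulmxBl mulmxBr XE scalar_mxC.
Qed.

(** Comparison map from the standard Fock space to the one generated from the vacuum [x] by the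
    creation operators [b]; [pullback] is an instance. *)
Definition fock (b : 'I_n -> 'M[F]_N) (x : 'cV[F]_N) : 'M[F]_N :=
  \matrix_(t, s) ((\prod_(i <- enum (enum_val s : {set 'I_n})) b i) *m x) t 0.

Lemma fock_bas b x S : fock b x *m bas F S = (\prod_(i <- enum S) b i) *m x.
Proof. by apply/colP => t; rewrite mul_bas mxE enum_rankK. Qed.

Lemma fock_form1 b x : fock b x *m form1 F n = x.
Proof. by rewrite form1E fock_bas enum_set0 big_nil mul1mx. Qed.

Section Intertwine.
Variables (a b : 'I_n -> 'M[F]_N) (x : 'cV[F]_N).
Hypothesis b_anti : forall i j, i != j -> b i *m b j = - (b j *m b i).
Hypothesis b_sq : forall i, b i *m b i = 0.

Lemma fock_ext i : fock b x *m ext F i = b i *m fock b x.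
Proof.
apply: bas_ext => S; rewrite -!mulmxA fock_bas ext_bas mulmxA.
have [iS|iS] := boolP (i \in S); last first.
  rewrite -scalemxAr fock_bas mulmxE mul_prod_enum // /sg -signr_odd -[in RHS]signr_odd.
  by case: odd; rewrite ?expr1 ?expr0 ?scale1r ?mul1r // mulN1r scaleN1r mulNmx.
rewrite mulmx0 -[in b i *m _](finset.setD1K iS) mulmxE.
have := mul_prod_enum b_anti (i := i) (S := S :\ i); rewrite !inE eqxx => /(_ isT).
move/(congr1 (fun y => (-1) ^+ #|[set j in S :\ i | (j < i)%N]%SET| * y)).
rewrite mulrA -expr2 sqrr_sign mul1r => <-.
rewrite mulrA commr_sign -[_ * b i * _]mulrA [b i * (b i * _)]mulrA.
by rewrite (b_sq i : b i * b i = 0) mul0r mulr0 mul0mx.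
Qed.

Hypothesis ab : forall i j, a i *m b j + b j *m a i = ((i == j)%:R)%:M.
Hypothesis ax : forall i, a i *m x = 0.

Lemma fock_ctr i : fock b x *m ctr F i = a i *m fock b x.
Proof.
apply/eqP; rewrite -subr_eq0; apply/eqP.
(* The difference of the two sides turns [ext j] into [b j] with a change of sign, being of odd
   degree in the Clifford variables. *)
apply: (spinor_span (Y := fun j => - b j)) => [|j].
  by rewrite mulmxBl -!mulmxA ctr_form1 mulmx0 fock_form1 ax subrr.
have E1 : a i *m b j = ((i == j)%:R)%:M - b j *m a i by apply: (canRL (addrK _)).
have E2 : ctr F i *m ext F j = ((i == j)%:R)%:M - ext F j *m ctr F i.
  by apply: (canRL (addrK _)); apply: ctr_ext.
rewrite mulmxBl -!mulmxA E2 fock_ext mulmxA E1 mulmxBr mulmxBl mul_mx_scalar.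
rewrite mul_scalar_mx mulmxA fock_ext mulmxBr !mulNmx opprB addrACA opprK.
by rewrite addrC addrA subrK -!mulmxA.
Qed.
End Intertwine.

Lemma fock_ext_id : fock (@ext F n) (form1 F n) = 1%:M.
Proof.
apply/eqP; rewrite -subr_eq0; apply/eqP; apply: (spinor_span (Y := @ext F n)).
  by rewrite mulmxBl fock_form1 mul1mx subrr.
move=> i; rewrite mulmxBl mulmxBr mul1mx mulmx1 fock_ext // => {}i.
  by move=> j _; apply: ext_anti.
exact: ext_sq.
Qed.

Lemma prod_ext S : (\prod_(i <- enum S) ext F i) *m form1 F n = bas F S.
Proof. by rewrite -fock_bas fock_ext_id mul1mx. Qed.

Lemma prod_enum_setT (A : pzRingType) (y : 'I_n -> A) :
  \prod_(i <- enum [set: 'I_n]%SET) y i = \prod_(i < n) y i.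
Proof.
rewrite prod_enumE [index_enum _]unlock -enumT.
by apply: eq_bigl => i; rewrite finset.in_setT.
Qed.

End Fock.

Section FockField.
Variables (F : fieldType) (n : nat).
Implicit Types (i j : 'I_n) (S T : {set 'I_n}).
Local Notation N := (fdim n).

(** Induction on a degree bound for a kernel vector: contractions lower the degree and stay in the
    kernel, so they all vanish and the vector is a multiple of 1, which [T] does not kill. *)
Lemma intertwiner_inj (T : 'M[F]_N) (a : 'I_n -> 'M[F]_N) :
    (forall i, T *m ctr F i = a i *m T) -> T *m form1 F n != 0 ->
  T \in unitmx.
Proof.
move=> Ta T1.
have inj k (f : 'cV[F]_N) : (forall S, (k <= #|S|)%N -> f (enum_rank S) 0 = 0) ->
    T *m f = 0 -> f = 0.
  elim: k f => [|k IH] f fS Tf; first by apply: form_ext => S p; rewrite (ord1 p) fS ?mxE.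
  have E : f = f (enum_rank finset.set0) 0 *: form1 F n.
    apply: ctr_kernel => i; apply: IH => [S Sk|]; last by rewrite mulmxA Ta -mulmxA Tf mulmx0.
    rewrite ctr_coord; case: ifP => // iS.
    by rewrite fS ?mulr0 // cardsU1 iS.
  move: Tf; rewrite E -scalemxAr => /eqP; rewrite scalemx_eq0 (negbTE T1) orbF.
  by move/eqP => ->; rewrite scale0r.
have inj' (f : 'cV[F]_N) : T *m f = 0 -> f = 0.
  apply: (inj n.+1) => S; rewrite ltnNge -[X in (_ <= X)%N]card_ord.
  by rewrite max_card.
rewrite -unitmx_tr -row_free_unit -kermx_eq0; apply/eqP/row_matrixP => i.
apply: trmx_inj; rewrite row0 trmx0; apply: inj'.
by apply: trmx_inj; rewrite trmx_mul trmxK -row_mul mulmx_ker row0 trmx0.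
Qed.

(** The Fock map based at [x] is invertible and intertwines the contractions with the [a i], so
    uniqueness of the standard vacuum carries over. *)
Lemma killed_line (a b : 'I_n -> 'M[F]_N) (x y : 'cV[F]_N) :
    (forall i j, a i *m b j + b j *m a i = ((i == j)%:R)%:M) ->
    (forall i j, b i *m b j = - (b j *m b i)) -> (forall i, b i *m b i = 0) ->
    (forall i, a i *m x = 0) -> (forall i, a i *m y = 0) -> x != 0 ->
  exists c, y = c *: x.
Proof.
move=> ab bb b2 ax ay x0; have Ta := fock_ctr (fun i j _ => bb i j) b2 ab ax.
have uT : fock b x \in unitmx by apply: (intertwiner_inj Ta); rewrite fock_form1.
have cy i : ctr F i *m (invmx (fock b x) *m y) = 0.
  by apply: (can_inj (mulKmx uT)); rewrite mulmxA Ta -mulmxA mulKVmx // ay mulmx0.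
exists ((invmx (fock b x) *m y) (enum_rank finset.set0) 0).
by rewrite -[LHS](mulKVmx uT) [in LHS](ctr_kernel cy) -scalemxAr fock_form1.
Qed.

(* Fock vectors b_S x with S nonempty are orthogonal to y, so y pairs with x. *)
Lemma killed_pairing (a b : 'I_n -> 'M[F]_N) (x y : 'cV[F]_N) (K : 'M[F]_N) (e : F) :
    (forall i j, a i *m b j + b j *m a i = ((i == j)%:R)%:M) ->
    (forall i j, b i *m b j = - (b j *m b i)) -> (forall i, b i *m b i = 0) ->
    (forall i, a i *m x = 0) -> (forall i, b i *m y = 0) -> x != 0 -> y != 0 ->
    K \in unitmx -> (forall i, (b i)^T *m K = e *: (K *m b i)) ->
  (x^T *m K *m y) 0 0 != 0.
Proof.
move=> ab bb b2 ax byE x0 y0 uK Kb; have Ta := fock_ctr (fun i j _ => bb i j) b2 ab ax.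
have uT : fock b x \in unitmx by apply: (intertwiner_inj Ta); rewrite fock_form1.
apply: contraNneq y0 => xKy; apply/eqP.
apply: (can_inj (mulKmx uK)); rewrite mulmx0.
have uTt : (fock b x)^T \in unitmx by rewrite unitmx_tr.
apply: (can_inj (mulKmx uTt)); rewrite mulmx0.
apply: form_ext => S p; rewrite (ord1 p) [RHS]mxE [LHS]form_coord mulmxA -trmx_mul fock_bas.
have [->|[i iS]] := set_0Vmem S; first by rewrite enum_set0 big_nil mul1mx mulmxA.
rewrite -(finset.setD1K iS).
have iSi : i \notin S :\ i by rewrite !inE eqxx.
have := mul_prod_enum (fun i j _ => bb i j) iSi.
move/(congr1 (fun y => (-1) ^+ #|[set j in S :\ i | (j < i)%N]%SET| * y)).
rewrite mulrA -expr2 sqrr_sign mul1r => <-.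
rewrite mulrA -commr_sign -mulrA -!mulmxE -!mulmxA trmx_mul.
by rewrite -mulmxA [(b i)^T *m _]mulmxA Kb -scalemxAl -mulmxA byE !(mulmx0, scaler0) mxE.
Qed.
End FockField.

(** * Clifford algebra, pairing and Pin group *)

Section Anticommutator.
Variables (F : fieldType) (N : nat).
Implicit Types X Y : 'M[F]_N.

Definition acom X Y := X *m Y + Y *m X.

Lemma acomC X Y : acom X Y = acom Y X. Proof. by rewrite /acom addrC. Qed.
Lemma acomDl X X' Y : acom (X + X') Y = acom X Y + acom X' Y.
Proof. by rewrite /acom mulmxDl mulmxDr addrACA. Qed.
Lemma acomZl c X Y : acom (c *: X) Y = c *: acom X Y.
Proof. by rewrite /acom -scalemxAl -scalemxAr scalerDr. Qed.
Lemma acomNl X Y : acom (- X) Y = - acom X Y.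
Proof. by rewrite -scaleN1r acomZl scaleN1r. Qed.
Lemma acom_suml (I : finType) (X : I -> 'M[F]_N) Y :
  acom (\sum_i X i) Y = \sum_i acom (X i) Y.
Proof. by rewrite /acom mulmx_suml mulmx_sumr -big_split. Qed.

End Anticommutator.

Section Clifford.
Variables (F : fieldType) (n : nat).
Implicit Types (i j : 'I_n) (v w : 'cV[F]_(n + n)).
Local Notation N := (fdim n).

Lemma cliffD v w : cliff (v + w) = cliff v + cliff w.
Proof.
rewrite /cliff -big_split; apply: eq_bigr => i _ /=.
by rewrite !linearD !mxE !scalerDl opprD addrACA.
Qed.

Lemma cliffZ c v : cliff (c *: v) = c *: cliff v.
Proof.
rewrite /cliff scaler_sumr; apply: eq_bigr => i _.
by rewrite !mxE scalerBr !scalerA.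
Qed.

Lemma cliff_is_linear : linear (@cliff F n).
Proof. by move=> c v w; rewrite cliffD cliffZ. Qed.
HB.instance Definition _ :=
  GRing.isLinear.Build F 'cV[F]_(n + n) 'M[F]_N _ (@cliff F n) cliff_is_linear.

Lemma innerE v w : inner v w =
  2^-1 * \sum_i (usubmx v i 0 * dsubmx w i 0 + dsubmx v i 0 * usubmx w i 0).
Proof.
rewrite /inner /gram -scalemxAr -scalemxAl mxE; congr (_ * _).
rewrite -{1}[v]vsubmxK -{1}[w]vsubmxK tr_col_mx mul_row_block !mulmx0 !mulmx1.
rewrite add0r addr0 mul_row_col mxE !mxE -big_split /=; apply: eq_bigr => i _.
by rewrite !mxE addrC.
Qed.

Lemma innerC v w : inner v w = inner w v.
Proof.
rewrite !innerE; congr (_ * _); apply: eq_bigr => i _.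
by rewrite addrC; congr (_ + _); rewrite mulrC.
Qed.

Lemma innerDl v v' w : inner (v + v') w = inner v w + inner v' w.
Proof. by rewrite /inner linearD !mulmxDl mxE. Qed.
Lemma innerZl c v w : inner (c *: v) w = c * inner v w.
Proof. by rewrite /inner [(c *: v)^T]linearZ /= -!scalemxAl mxE. Qed.
Lemma innerDr v w w' : inner v (w + w') = inner v w + inner v w'.
Proof. by rewrite innerC innerDl !(innerC v). Qed.
Lemma innerZr c v w : inner v (c *: w) = c * inner v w.
Proof. by rewrite innerC innerZl innerC. Qed.
Lemma innerNl v w : inner (- v) w = - inner v w.
Proof. by rewrite -scaleN1r innerZl mulN1r. Qed.
Lemma innerNr v w : inner v (- w) = - inner v w.
Proof. by rewrite -scaleN1r innerZr mulN1r. Qed.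
Lemma inner0l v : inner 0 v = 0.
Proof. by rewrite -(scale0r 0) innerZl mul0r. Qed.
Lemma inner0r v : inner v 0 = 0.
Proof. by rewrite innerC inner0l. Qed.

Hypothesis two_neq0 : (2 : F) != 0.

Lemma clifford v w :
  cliff v *m cliff w + cliff w *m cliff v = (- (2 * inner v w))%:M.
Proof.
rewrite innerE mulrA divff // mul1r -sumrN [RHS]raddf_sum /=.
change (acom (cliff v) (cliff w) = \sum_i
  (- (usubmx v i 0 * dsubmx w i 0 + dsubmx v i 0 * usubmx w i 0))%:M).
rewrite /cliff acom_suml; apply: eq_bigr => i _; rewrite acomC acom_suml.
have acE j : acom (dsubmx w j 0 *: ext F j - usubmx w j 0 *: ctr F j)
    (dsubmx v i 0 *: ext F i - usubmx v i 0 *: ctr F i) =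
    (i == j)%:R *: (- (usubmx v i 0 * dsubmx w i 0 + dsubmx v i 0 * usubmx w i 0))%:M.
  rewrite acomDl acomNl !acomZl ![acom _ (_ - _)]acomC !acomDl !acomNl !acomZl.
  have -> : acom (ext F i) (ext F j) = 0 by rewrite /acom !mulmxE ext_anti addNr.
  have -> : acom (ctr F i) (ctr F j) = 0 by rewrite /acom !mulmxE ctr_anti addNr.
  have -> : acom (ctr F i) (ext F j) = ((i == j)%:R)%:M by apply: ctr_ext.
  have -> : acom (ext F i) (ctr F j) = ((i == j)%:R)%:M.
    by rewrite acomC eq_sym; apply: ctr_ext.
  rewrite -[((i == j)%:R)%:M]scalemx1.
  have [<-|_] := eqVneq i j; last by rewrite !(scale0r, scaler0, subr0).
  rewrite !scaler0 sub0r subr0 scalerN !scalerA !scale1r !scalemx1 -raddfN -raddfB.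
  have t1 : (true%:R : F) = 1 by [].
  by congr (_%:M); rewrite t1 !mulr1 opprD mulrC [X in _ - X]mulrC.
rewrite (bigD1 i) //= big1 => [|j ji]; rewrite acE ?eqxx ?scale1r ?addr0 //.
by rewrite eq_sym (negbTE ji) scale0r.
Qed.
End Clifford.

(** * Adjoints for the spinor pairing *)

Section Pairing.
Variables (F : comNzRingType) (n : nat).
Implicit Types (i j : 'I_n) (S T : {set 'I_n}).
Local Notation N := (fdim n).

Definition pairing_mx : 'M[F]_N := \matrix_(s, t)
  let S : {set 'I_n} := enum_val s in let T : {set 'I_n} := enum_val t in
  if T == finset.setC S then wedge_sign F S T * (-1) ^+ 'C(#|T|.+1, 2) else 0.

Lemma pairing_mxE S T : pairing_mx (enum_rank S) (enum_rank T) =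
  if T == finset.setC S then wedge_sign F S T * (-1) ^+ 'C(#|T|.+1, 2) else 0.
Proof. by rewrite mxE !enum_rankK. Qed.

Lemma big_fdim (G : 'I_N -> F) : \sum_s G s = \sum_(S : {set 'I_n}) G (enum_rank S).
Proof. by rewrite (reindex enum_rank) //; apply: onW_bij; apply: enum_rank_bij. Qed.

Lemma spairingE (r t : 'cV[F]_N) : spairing r t = (r^T *m pairing_mx *m t) 0 0.
Proof.
rewrite -mulmxA mxE big_fdim; apply: eq_bigr => S _.
rewrite [r^T _ _]mxE [X in _ = _ * X]mxE big_fdim (bigD1 (finset.setC S)) //=.
rewrite big1 => [|T nT]; last by rewrite pairing_mxE (negbTE nT) mul0r.
by rewrite addr0 pairing_mxE eqxx [RHS]mulrA; congr (_ * _); rewrite mulrC.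
Qed.

(** The pairing matrix is a signed permutation matching each set with its complement. *)
Lemma pairing_unit : pairing_mx *m pairing_mx^T = 1%:M.
Proof.
apply: form_ext => S q; rewrite -[q]enum_valK; move: (enum_val q) => T {q}.
rewrite !mxE big_fdim (inj_eq enum_rank_inj) (bigD1 (finset.setC S)) //= big1 => [|U UnS].
  rewrite addr0 [pairing_mx^T _ _]mxE !pairing_mxE eqxx (inj_eq (inv_inj (@finset.setCK _))).
  case: eqVneq => [->|_]; last by rewrite mulr0.
  by rewrite mulrACA /wedge_sign -!expr2 !sqrr_sign mulr1.
by rewrite pairing_mxE (negbTE UnS) mul0r.
Qed.

Lemma sgE i S : sg F i S = \prod_(a in S) (if (a < i)%N then -1 else 1).
Proof.
rewrite -big_mkcondr /= prodr_const /sg; congr (_ ^+ _).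
by apply: eq_card => a; rewrite !inE.
Qed.

Lemma wedge_signE S T : wedge_sign F S T = \prod_(a in S) sg F a T.
Proof.
rewrite /wedge_sign -sum1_card (eq_bigl (fun p : 'I_n * 'I_n =>
  (p.1 \in S) && ((p.2 \in T) && (p.2 < p.1)%N))) => [|p]; last by rewrite inE.
rewrite -(pair_big_dep (fun a => a \in S) (fun a b => (b \in T) && (b < a)%N)
  (fun _ _ => 1%N)) expr_sum; apply: eq_bigr => a _.
by rewrite /sg -sum1_card; congr (_ ^+ _); apply: eq_bigl => b; rewrite inE.
Qed.

Lemma wedge_signUr i S T : i \notin S -> i \notin T ->
  wedge_sign F S (i |: T) = (-1) ^+ #|S| * sg F i S * wedge_sign F S T.
Proof.
move=> iS iT; rewrite !wedge_signE sgE -prodr_const -!big_split /=.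
apply: eq_bigr => a aS; rewrite sgU //; congr (_ * _).
have : a != i by apply: contraNneq iS => <-.
by case: (ltngtP a i) => [||/val_inj ->]; rewrite ?mulrNN ?mulr1 ?eqxx.
Qed.

Hypothesis n_even : ~~ odd n.

(** The sign identity behind self-adjointness of Clifford multiplication. Moving [i] from one side
    to the other changes both the wedge sign and the hat sign; the changes cancel because the
    cardinals of [S] and [T] add up to [n - 1], which is odd. *)
Lemma pairing_core i S T : i \notin S -> i \notin T ->
  sg F i S * pairing_mx (enum_rank (i |: S)) (enum_rank T) =
  sg F i T * pairing_mx (enum_rank S) (enum_rank (i |: T)).
Proof.
move=> iS iT; rewrite !pairing_mxE.
have eqT : (T == finset.setC (i |: S)) = (i |: T == finset.setC S).
  apply/eqP/eqP => E; apply/setP => j.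
    by rewrite E !inE; case: eqVneq => [->|] //=; rewrite iS.
  by move/setP/(_ j): E; rewrite !inE; case: eqVneq => [->|] //=; rewrite (negbTE iT).
rewrite -eqT; case: eqP => [TE|_]; last by rewrite !mulr0.
have cST : (#|S| + #|T|).+1 = n.
  by have := cardsC (i |: S); rewrite -TE cardsU1 iS card_ord add1n addSn.
rewrite wedge_signUr // wedge_signE big_setU1 //= -wedge_signE cardsU1 iT.
rewrite add1n (binS #|T|.+1 1) bin1 exprD.
have -> : (-1) ^+ #|T|.+1 = (-1) ^+ #|S| :> F.
  rewrite -signr_odd -[RHS]signr_odd /=; congr (_ ^+ nat_of_bool _).
  by have := congr1 odd cST; rewrite /= oddD (negbTE n_even); case: odd; case: odd.
have ss : (-1) ^+ #|S| * (-1) ^+ #|S| = 1 :> F by rewrite -expr2 sqrr_sign.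
move: ss; set s := (-1) ^+ #|S|; set e := (-1) ^+ _ => ss.
by rewrite -[LHS](mulr1) -ss; ring.
Qed.

Lemma ctr_pairing i : ctr F i *m pairing_mx = pairing_mx *m ext F i.
Proof.
apply: bas_ext => T; rewrite -!mulmxA ext_bas; apply: form_ext => S q.
rewrite (ord1 q) ctr_coord mul_bas.
have [iT|iT] := boolP (i \in T).
  rewrite mulmx0 [RHS]mxE; case: ifPn => // iS; rewrite pairing_mxE.
  case: eqP => [TE|]; last by rewrite mulr0.
  by move: iT; rewrite TE !inE eqxx.
rewrite -scalemxAr [RHS]mxE mul_bas.
have [iS|iS] := boolP (i \in S); last exact: pairing_core.
rewrite pairing_mxE; case: eqP => [TE|]; last by rewrite mulr0.
by move/setP/(_ i): TE; rewrite !inE eqxx iS.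
Qed.

Lemma ext_pairing i : ext F i *m pairing_mx = pairing_mx *m ctr F i.
Proof.
apply: bas_ext => T; rewrite -!mulmxA ctr_bas; apply: form_ext => S q.
rewrite (ord1 q) ext_coord mul_bas.
have [iT|iT] := boolP (i \in T); have [iS|iS] := boolP (i \in S); last by rewrite mulmx0 mxE.
- rewrite -scalemxAr [RHS]mxE mul_bas.
  have iSi : i \notin S :\ i by rewrite !inE eqxx.
  have iTi : i \notin T :\ i by rewrite !inE eqxx.
  have := pairing_core iSi iTi; rewrite !finset.setD1K // => E.
  rewrite -[LHS]mul1r -(sg_sqr F i (T :\ i)) -mulrA (mulrCA _ (sg F i (S :\ i))) -E.
  by rewrite (mulrA (sg F i (S :\ i))) sg_sqr mul1r.
- rewrite -scalemxAr [RHS]mxE mul_bas pairing_mxE.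
  case: eqP => [TE|]; last by rewrite mulr0.
  by move/setP/(_ i): TE; rewrite !inE eqxx (negbTE iS).
- rewrite mulmx0 [RHS]mxE pairing_mxE; case: eqP => [TE|]; last by rewrite mulr0.
  by move: iT; rewrite TE !inE eqxx.
Qed.

Lemma cliff_pairing v : (cliff v)^T *m pairing_mx = pairing_mx *m cliff v.
Proof.
rewrite /cliff raddf_sum mulmx_suml mulmx_sumr /=; apply: eq_bigr => i _.
rewrite [(_ - _)^T]linearB /= ![(_ *: _)^T]linearZ /= /ctr trmxK mulmxBl mulmxBr -!scalemxAl -!scalemxAr.
by rewrite ctr_pairing ext_pairing.
Qed.

Lemma spairing_cliff v (r t : 'cV[F]_N) :
  spairing (cliff v *m r) t = spairing r (cliff v *m t).
Proof.
by rewrite !spairingE trmx_mul -(mulmxA _ (cliff v)^T) cliff_pairing !mulmxA.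
Qed.

Lemma spairingZl c (r t : 'cV[F]_N) : spairing (c *: r) t = c * spairing r t.
Proof. by rewrite !spairingE [(c *: r)^T]linearZ /= -!scalemxAl mxE. Qed.
Lemma spairingZr c (r t : 'cV[F]_N) : spairing r (c *: t) = c * spairing r t.
Proof. by rewrite !spairingE -!scalemxAr mxE. Qed.
Lemma spairingDl (r r' t : 'cV[F]_N) : spairing (r + r') t = spairing r t + spairing r' t.
Proof. by rewrite !spairingE [(r + r')^T]linearD /= !mulmxDl mxE. Qed.
End Pairing.

Section PairingField.
Variables (F : fieldType) (n : nat).
Lemma pairing_unitmx : pairing_mx F n \in unitmx.
Proof. by have /mulmx1_unit[] := pairing_unit F n. Qed.
End PairingField.

Section CliffordField.
Variables (F : fieldType) (n : nat).
Implicit Types (i j : 'I_n) (v w : 'cV[F]_(n + n)).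
Local Notation N := (fdim n).
Hypothesis two_neq0 : (2 : F) != 0.

Lemma cliff_ext i : cliff (col_mx 0 (delta_mx i 0)) = ext F i.
Proof.
rewrite /cliff (bigD1 i) //= big1 => [|j ji]; rewrite col_mxKu col_mxKd !mxE ?eqxx.
  by rewrite scale1r scale0r subr0 addr0.
by rewrite (negbTE ji) !scale0r subr0.
Qed.

Lemma cliff_ctr i : cliff (col_mx (delta_mx i 0) 0) = - ctr F i.
Proof.
rewrite /cliff (bigD1 i) //= big1 => [|j ji]; rewrite col_mxKu col_mxKd !mxE ?eqxx.
  by rewrite scale1r scale0r sub0r addr0.
by rewrite (negbTE ji) !scale0r subr0.
Qed.

Lemma gram_unit : gram F n \in unitmx.
Proof.
suff /mulmx1_unit[] : gram F n *m (2%:M *m gram F n *m 2%:M) = 1%:M by [].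
rewrite /gram mul_scalar_mx mul_mx_scalar -!scalemxAr -!scalemxAl !scalerA.
rewrite mulmx_block !mul0mx !mul1mx !add0r !addr0 -scalar_mx_block.
by rewrite mulfK // divff // scale1r.
Qed.

Lemma inner_mx (A B : 'M[F]_(n + n)) v w :
  inner (A *m v) (B *m w) = (v^T *m (A^T *m gram F n *m B) *m w) 0 0.
Proof. by rewrite /inner trmx_mul !mulmxA. Qed.

Lemma form_mx_eq p (A B : 'M[F]_p) :
  (forall v w : 'cV_p, (v^T *m A *m w) 0 0 = (v^T *m B *m w) 0 0) -> A = B.
Proof.
move=> AB; apply/matrixP => i j; have := AB (delta_mx i 0) (delta_mx j 0).
by rewrite !trmx_delta -!colE -!rowE !mxE.
Qed.

Lemma inner_nondeg v : (forall w, inner v w = 0) -> v = 0.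
Proof.
move=> vw; apply: trmx_inj; apply: (can_inj (mulmxK gram_unit)).
rewrite trmx0 mul0mx; apply/rowP => i; rewrite [RHS]mxE.
by have := vw (delta_mx i 0); rewrite /inner -colE [LHS]mxE => ->.
Qed.

Lemma form1_neq0 : form1 F n != 0.
Proof.
apply/eqP => /matrixP /(_ (enum_rank finset.set0) 0).
by rewrite basE eqxx mxE => /eqP; rewrite oner_eq0.
Qed.

Lemma scalar_form_eq0 (c : F) : (c%:M : 'M[F]_N) = 0 -> c = 0.
Proof.
move/(congr1 (mulmx^~ (form1 F n))); rewrite mul_scalar_mx mul0mx => /eqP.
by rewrite scalemx_eq0 (negbTE form1_neq0) orbF => /eqP.
Qed.

Lemma cliff_inj v w : cliff v = cliff w -> v = w.
Proof.
move=> vw; apply/eqP; rewrite -subr_eq0; apply/eqP/inner_nondeg => u.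
have := clifford two_neq0 (v - w) u; rewrite linearB /= vw subrr mul0mx mulmx0 addr0.
by move/esym/scalar_form_eq0/eqP; rewrite oppr_eq0 mulf_eq0 (negbTE two_neq0) => /eqP.
Qed.

Lemma cliff_sqr v : cliff v *m cliff v = (- inner v v)%:M.
Proof.
apply: (scalerI two_neq0); have := clifford two_neq0 v v.
by rewrite -mulr2n -scaler_nat => ->; rewrite scale_scalar_mx mulrN.
Qed.

Lemma cliff_scalar (X : 'M[F]_N) : (forall v, X *m cliff v = cliff v *m X) ->
  exists c, X = c%:M.
Proof.
move=> XC; exists ((X *m form1 F n) (enum_rank finset.set0) 0).
apply: commutant_scalar => i; first by have := XC (col_mx 0 (delta_mx i 0)); rewrite cliff_ext.
by have := XC (col_mx (delta_mx i 0) 0); rewrite cliff_ctr mulmxN mulNmx => /oppr_inj.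
Qed.

(** An operator anticommuting with all Clifford multiplications need not be a scalar, but it
    preserves the line of 1. That much is enough to exclude odd lifts in [Spin_of_covers]. *)
Lemma cliff_twisted_scalar (X : 'M[F]_N) :
    (forall v, X *m cliff v = - (cliff v *m X)) ->
  exists c, X *m form1 F n = c *: form1 F n.
Proof.
move=> XC; exists ((X *m form1 F n) (enum_rank finset.set0) 0); apply: ctr_kernel => i.
have := XC (col_mx (delta_mx i 0) 0); rewrite cliff_ctr mulmxN mulNmx opprK.
by rewrite mulmxA => <-; rewrite mulNmx -mulmxA ctr_form1 mulmx0 oppr0.
Qed.

Definition isom_mx (g : 'M[F]_(n + n)) := forall v w, inner (g *m v) (g *m w) = inner v w.

Lemma isom_mxP g : isom_mx g <-> g^T *m gram F n *m g = gram F n.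
Proof.
split=> [gi|gE v w]; last by rewrite inner_mx gE.
by apply: form_mx_eq => v w; rewrite -inner_mx gi.
Qed.

Lemma isom_mx1 : isom_mx 1%:M. Proof. by move=> v w; rewrite !mul1mx. Qed.

Lemma isom_mxM g h : isom_mx g -> isom_mx h -> isom_mx (g *m h).
Proof. by move=> gi hi v w; rewrite -!mulmxA gi. Qed.

(** The adjoint of [g] for [inner], which inverts isometries. *)
Definition isom_inv (g : 'M[F]_(n + n)) := invmx (gram F n) *m g^T *m gram F n.

Lemma isom_invl g : isom_mx g -> isom_inv g *m g = 1%:M.
Proof. by move/isom_mxP => gE; rewrite /isom_inv -!mulmxA [g^T *m _]mulmxA gE mulVmx ?gram_unit. Qed.

Lemma isom_invr g : isom_mx g -> g *m isom_inv g = 1%:M.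
Proof. by move/isom_invl/mulmx1C. Qed.

Lemma isom_mxV g : isom_mx g -> isom_mx (isom_inv g).
Proof. move=> gi v w; rewrite -gi.
have K x : g *m (isom_inv g *m x) = x by rewrite mulmxA isom_invr // mul1mx.
by rewrite !K. Qed.

Lemma isom_unit g : isom_mx g -> g \in unitmx.
Proof. by move/isom_invl/mulmx1_unit => []. Qed.

Definition refl (u : 'cV[F]_(n + n)) : 'M[F]_(n + n) :=
  1%:M - (2 / inner u u) *: (u *m u^T *m gram F n).

Lemma reflE u v : refl u *m v = v - (2 * inner u v / inner u u) *: u.
Proof.
rewrite /refl mulmxBl mul1mx -scalemxAl -!mulmxA; congr (_ - _).
rewrite [u^T *m _]mulmxA [_ *m v]mx11_scalar -/(inner u v) mul_mx_scalar scalerA.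
by congr (_ *: _); ring.
Qed.

Lemma refl_isom u : inner u u != 0 -> isom_mx (refl u).
Proof.
move=> uu v w; rewrite !reflE !(innerDl, innerDr, innerNl, innerNr, innerZl, innerZr).
by rewrite (innerC v u); field.
Qed.

Lemma cliff_refl u v : inner u u != 0 ->
  cliff u *m cliff v = - (cliff (refl u *m v) *m cliff u).
Proof.
move=> uu; rewrite reflE linearB linearZ /= mulmxBl -scalemxAl cliff_sqr.
have /(canRL (addrK _)) -> := clifford two_neq0 u v.
rewrite opprB; congr (_ - _).
by rewrite scale_scalar_mx; congr (_%:M); field.
Qed.

Lemma has_parity_cliff b v (r : 'cV[F]_N) :
  has_parity b r -> has_parity (~~ b) (cliff v *m r).
Proof.
move=> br S Sb; rewrite /cliff mulmx_suml summxE big1 // => i _.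
rewrite mulmxBl -!scalemxAl [LHS]mxE [X in X + _]mxE [X in _ + X]mxE [X in _ - X]mxE.
rewrite ext_coord ctr_coord.
have [iS|iS] := boolP (i \in S).
  rewrite br ?mulr0 ?mulr0 ?subr0 //.
  move: Sb; rewrite (cardsD1 i S) iS add1n /=.
  by case: odd; case: b {br}.
rewrite br ?mulr0 ?mulr0 ?subr0 //.
by move: Sb; rewrite cardsU1 iS add1n /=; case: odd; case: b {br}.
Qed.

End CliffordField.

(** * The Pin group, graded by parity, and its twisted covering *)

Section Pin.
Variables (R : realType) (n : nat).
Implicit Types (v w : 'cV[R]_(n + n)) (b : bool) (s : 'M[R]_(fdim n)) (g : 'M[R]_(n + n)).
Local Notation N := (fdim n).

Let two_neq0 : (2 : R) != 0. Proof. by rewrite pnatr_eq0. Qed.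

Definition Pin b s := exists vs : seq 'cV[R]_(n + n),
  [/\ odd (size vs) = b, forall v, v \in vs -> `|inner v v| = 1
    & s = \prod_(v <- vs) cliff v].

(** The sign makes [cliff u] cover the reflection in [u] and not its negative. *)
Definition tcovers b s g := forall v, s *m cliff v = (-1) ^+ b *: (cliff (g *m v) *m s).

Lemma SpinE s : Spin s <-> Pin false s.
Proof.
split=> -[vs [vs0 vs1 ->]]; exists vs; split=> //; first exact: negbTE.
by rewrite vs0.
Qed.

Lemma coversE s g : covers s g <-> tcovers false s g.
Proof. by split=> sg v; rewrite sg ?scale1r. Qed.

Lemma Pin1 : Pin false 1%:M.
Proof. by exists [::]; rewrite big_nil. Qed.

Lemma Pin_cliff v : `|inner v v| = 1 -> Pin true (cliff v).
Proof.
by move=> v1; exists [:: v]; rewrite big_seq1; split=> // w; rewrite inE => /eqP ->.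
Qed.

Lemma PinM b b' s s' : Pin b s -> Pin b' s' -> Pin (b (+) b') (s *m s').
Proof.
move=> [vs [<- v1 ->]] [ws [<- w1 ->]]; exists (vs ++ ws).
rewrite size_cat oddD big_cat; split=> // v; rewrite mem_cat => /orP[]; [exact: v1|exact: w1].
Qed.

Lemma Pin_ind (P : bool -> 'M[R]_N -> Prop) : P false 1%:M ->
    (forall v b s, `|inner v v| = 1 -> Pin b s -> P b s -> P (~~ b) (cliff v *m s)) ->
  forall b s, Pin b s -> P b s.
Proof.
move=> P1 PM b s [vs [<- + ->]]; elim: vs => [|v vs IH] v1; first by rewrite big_nil.
have vs1 w : w \in vs -> `|inner w w| = 1 by move=> wv; apply: v1; rewrite inE wv orbT.
rewrite big_cons /=; apply: PM; [|by exists vs|exact: IH].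
by apply: v1; rewrite inE eqxx.
Qed.

Lemma unit_norm v : `|inner v v| = 1 -> inner v v * inner v v = 1.
Proof. by move=> v1; rewrite -expr2 -real_normK ?num_real // v1 expr1n. Qed.

Lemma unit_norm_neq0 v : `|inner v v| = 1 -> inner v v != 0.
Proof. by move=> v1; rewrite -normr_eq0 v1 oner_eq0. Qed.

Lemma cliff_inv v : `|inner v v| = 1 ->
  exists2 w, `|inner w w| = 1 & cliff w *m cliff v = 1%:M.
Proof.
move=> v1; exists (- inner v v *: v).
  by rewrite innerZl innerZr mulrA mulrNN unit_norm // mul1r.
rewrite linearZ /= -scalemxAl cliff_sqr // scale_scalar_mx mulrNN unit_norm //.
Qed.

Lemma Pin_inv b s : Pin b s -> exists s', [/\ Pin b s', s' *m s = 1%:M & s *m s' = 1%:M].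
Proof.
move: b s; apply: Pin_ind => [|v b s v1 _ [s' [ps' s's ss']]].
  by exists 1%:M; rewrite mulmx1; split=> //; apply: Pin1.
have [w w1 wv] := cliff_inv v1; exists (s' *m cliff w); split.
- by rewrite -addbT; apply: PinM => //; apply: Pin_cliff.
- by rewrite mulmxA -(mulmxA s') wv mulmx1.
- by rewrite mulmxA -(mulmxA _ s) ss' mulmx1 mulmx1C.
Qed.

Lemma Pin_unit b s : Pin b s -> s \in unitmx.
Proof. by case/Pin_inv => s' [_ _ /mulmx1_unit[]]. Qed.

Lemma tcovers1 : tcovers false 1%:M 1%:M.
Proof. by move=> v; rewrite !mul1mx mulmx1 scale1r. Qed.

Lemma tcoversM b b' s s' g g' :
  tcovers b s g -> tcovers b' s' g' -> tcovers (b (+) b') (s *m s') (g *m g').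
Proof.
move=> sg sg' v; rewrite -mulmxA sg' -scalemxAr mulmxA sg -scalemxAl scalerA !mulmxA.
by rewrite signr_addb mulrC.
Qed.

Lemma tcovers_cliff v : `|inner v v| = 1 -> tcovers true (cliff v) (refl v).
Proof. by move=> v1 w; rewrite cliff_refl ?unit_norm_neq0 // expr1 scaleN1r. Qed.

Lemma Pin_covers b s : Pin b s -> exists2 g, isom_mx g & tcovers b s g.
Proof.
move: b s; apply: Pin_ind => [|v b s v1 _ [g gi sg]].
  by exists 1%:M; [apply: isom_mx1|apply: tcovers1].
exists (refl v *m g); first by apply: isom_mxM => //; apply: refl_isom; rewrite ?unit_norm_neq0.
by rewrite -addTb; apply: tcoversM => //; apply: tcovers_cliff.
Qed.

Lemma tcovers_inj b s g g' : s \in unitmx -> tcovers b s g -> tcovers b s g' -> g = g'.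
Proof.
move=> us sg sg'; apply/matrixP => i j; rewrite -[g]mulmx1 -[g']mulmx1.
have : g *m delta_mx j 0 = g' *m (delta_mx j 0 : 'cV_(n + n)).
  apply: (cliff_inj two_neq0); apply: (can_inj (mulmxK us)).
  have := sg (delta_mx j 0); rewrite sg' => /(congr1 (fun x => (-1) ^+ b *: x)).
  by rewrite !scalerA -expr2 sqrr_sign !scale1r => ->.
by rewrite -!colE !mulmx1 => /matrixP /(_ i 0); rewrite !mxE.
Qed.

Lemma tcoversV b s g s' : s' *m s = 1%:M -> isom_mx g -> tcovers b s g ->
  tcovers b s' (isom_inv g).
Proof.
move=> s's gi sg v; have us := mulmx1_unit s's; have ss' := mulmx1C s's.
have E : cliff v *m s = (-1) ^+ b *: (s *m cliff (isom_inv g *m v)).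
  rewrite sg scalerA -expr2 sqrr_sign scale1r; congr (cliff _ *m _).
  by rewrite mulmxA isom_invr // mul1mx.
rewrite -[LHS]mulmx1 -ss' mulmxA -(mulmxA s') E -scalemxAr -scalemxAl; congr (_ *: _).
by rewrite !mulmxA s's mul1mx.
Qed.

Hypothesis n_even : ~~ odd n.

(** Each factor [cliff v] is self-adjoint and squares to [- inner v v], which is what it contributes
    to [e]. Only [e * e = 1] can be asserted, since vectors of either norm occur. *)
Lemma Pin_pairing b s : Pin b s -> exists2 e : R, e * e = 1 &
  s^T *m pairing_mx R n *m s = e *: pairing_mx R n.
Proof.
move: b s; apply: Pin_ind => [|v b s v1 _ [e e1 sK]].
  by exists 1; rewrite ?mulr1 // trmx1 mul1mx mulmx1 scale1r.
exists (- inner v v * e); first by rewrite mulrACA mulrNN unit_norm // e1 mul1r.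
rewrite trmx_mul -!mulmxA (mulmxA _ (pairing_mx R n)) cliff_pairing // -!mulmxA.
rewrite (mulmxA (cliff v) (cliff v)) cliff_sqr // mul_scalar_mx -!scalemxAr mulmxA sK.
by rewrite scalerA.
Qed.

(** By irreducibility two lifts differ by a scalar [c]; comparing their effect on the pairing gives
    [c^4 = 1], which leaves the two signs over the reals. *)
Lemma Pin_uniq b s s' g : Pin b s -> Pin b s' -> tcovers b s g -> tcovers b s' g ->
  s' = s \/ s' = - s.
Proof.
move=> ps ps' sg sg'; have [t [pt ts st]] := Pin_inv ps.
have [h hi sh] := Pin_covers ps.
have gh : g = h by apply: (tcovers_inj (Pin_unit ps) sg sh).
rewrite gh in sg sg' => {gh g}.
have [c tc] : exists c, t *m s' = c%:M.
  apply: cliff_scalar => v.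
  have := tcoversM (tcoversV ts hi sg) sg' v.
  by rewrite addbb scale1r isom_invl // mul1mx.
have E : s' = c *: s by rewrite -[s']mul1mx -st -mulmxA tc mul_mx_scalar.
have [e e1 sK] := Pin_pairing ps; have [e' e'1 sK'] := Pin_pairing ps'.
have : (c * c * e) *: pairing_mx R n = e' *: pairing_mx R n.
  by rewrite -sK' E [(c *: s)^T]linearZ /= -!scalemxAl -scalemxAr sK !scalerA.
move/eqP; rewrite -subr_eq0 -scalerBl scalemx_eq0 => /orP[|/eqP K0]; last first.
  by have := form1_neq0 R n; rewrite -[form1 _ _](mulKmx (pairing_unitmx R n)) K0 mul0mx mulmx0 eqxx.
rewrite subr_eq0 => /eqP cc; have cc1 : c ^+ 2 ^+ 2 = 1.
  by have := e'1; rewrite -cc mulrACA e1 mulr1 -!expr2.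
have : c ^+ 2 == 1.
  by move/eqP: cc1; rewrite sqrf_eq1 => /orP[//|/eqP c2]; have := sqr_ge0 c; rewrite c2 oppr_ge0 ler10.
by rewrite sqrf_eq1 => /orP[] /eqP cE; [left|right]; rewrite E cE ?scale1r ?scaleN1r.
Qed.

(** If [inner v v = 1] then [cliff v] squares to -1, and such a [v] exists because [n] is
    positive. *)
Lemma SpinN s : (0 < n)%N -> Spin s -> Spin (- s).
Proof.
move=> n0 /SpinE ps; apply/SpinE.
pose v : 'cV[R]_(n + n) := col_mx (delta_mx (Ordinal n0) 0) (delta_mx (Ordinal n0) 0).
have v1 : inner v v = 1.
  rewrite innerE !col_mxKu !col_mxKd (bigD1 (Ordinal n0)) //= big1 => [|i ni].
    by rewrite !mxE eqxx /= addr0 mulr1 mulVf.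
  by rewrite !mxE (negbTE ni) mulr0 addr0.
have pv : Pin true (cliff v) by apply: Pin_cliff; rewrite v1 normr1.
have := PinM (PinM pv pv) ps; rewrite addbb addFb cliff_sqr // v1.
by rewrite mul_scalar_mx scaleN1r.
Qed.

Lemma SpinM s s' : Spin s -> Spin s' -> Spin (s *m s').
Proof. by move=> /SpinE p /SpinE p'; apply/SpinE; apply: PinM p p'. Qed.

End Pin.

Section MapForms.
Variables (F F' : fieldType) (f : {rmorphism F -> F'}) (n : nat).
Local Notation N := (fdim n).

Lemma map_ext (i : 'I_n) : map_mx f (ext F i) = ext F' i.
Proof.
apply/matrixP => a b; rewrite !mxE /=; case: ifP => _; last by rewrite rmorph0.
by rewrite rmorphXn rmorphN1.
Qed.

Lemma map_cliff (v : 'cV[F]_(n + n)) : map_mx f (cliff v) = cliff (map_mx f v).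
Proof.
rewrite /cliff map_mx_sum; apply: eq_bigr => i _.
rewrite map_mxB !map_mxZ map_ext /ctr -map_trmx map_ext.
have -> : dsubmx (map_mx f v) i 0 = f (dsubmx v i 0) by rewrite !mxE.
by have -> : usubmx (map_mx f v) i 0 = f (usubmx v i 0) by rewrite !mxE.
Qed.

Lemma map_pairing : map_mx f (pairing_mx F n) = pairing_mx F' n.
Proof.
apply/matrixP => a b; rewrite !mxE /=; case: ifP => _; last by rewrite rmorph0.
by rewrite /wedge_sign rmorphM !rmorphXn rmorphN1.
Qed.

Lemma map_inner (v w : 'cV[F]_(n + n)) : inner (map_mx f v) (map_mx f w) = f (inner v w).
Proof.
rewrite !innerE rmorphM fmorphV rmorphMn rmorph1 rmorph_sum; congr (_ * _).
by apply: eq_bigr => i _; rewrite !mxE rmorphD !rmorphM.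
Qed.

Lemma map_bas S : map_mx f (bas F S) = bas F' S :> 'cV_N.
Proof. by rewrite map_delta_mx. Qed.

Lemma map_gram : map_mx f (gram F n) = gram F' n.
Proof.
by rewrite map_mxZ map_block_mx !map_mx0 !map_mx1 fmorphV rmorphMn rmorph1.
Qed.

End MapForms.

Section AnticommutingDet.
Variables (F : comNzRingType) (N : nat).

Lemma prod_lift n (x : 'I_n.+1 -> 'M[F]_N) (j : 'I_n.+1) :
    (forall i k, x i * x k = - (x k * x i)) ->
  x j * \prod_(k < n) x (lift j k) = (-1) ^+ j * \prod_(i < n.+1) x i.
Proof.
elim: n x j => [|n IH] x j xx.
  by rewrite (ord1 j) big_ord0 big_ord_recl big_ord0 expr0 mul1r.
have [->|[j' ->]] : j = ord0 \/ exists j', j = lift ord0 j'.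
  by case: (unliftP ord0 j) => [j' ->|->]; [right; exists j'|left].
  by rewrite [in RHS]big_ord_recl [(-1) ^+ _]expr0 mul1r.
rewrite big_ord_recl [in RHS]big_ord_recl.
have -> : lift (lift ord0 j') ord0 = ord0 :> 'I_n.+2 by apply: val_inj.
have -> : \prod_(i < n) x (lift (lift ord0 j') (lift ord0 i)) =
          \prod_(i < n) x (lift ord0 (lift j' i)).
  apply: eq_bigr => i _; congr x; apply: val_inj => /=.
  by rewrite /bump /= !add1n ltnS; case: leqP; rewrite ?addn0 ?add1n ?add0n.
rewrite mulrA xx mulNr -mulrA.
rewrite (IH (fun i => x (lift ord0 i)) j') //.
by rewrite lift0 exprS mulN1r mulNr [in RHS]mulrA -commr_sign mulrA.
Qed.

(** Behind a factor [x], every later multiple of [x] can be brought next to it, where it dies. *)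
Lemma mul_prod_drop (x : 'M[F]_N) (I : Type) (l : seq I) (c : I -> F) (z : I -> 'M[F]_N) :
    x * x = 0 -> (forall i, x * z i = - (z i * x)) ->
  x * \prod_(i <- l) (c i *: x + z i) = x * \prod_(i <- l) z i.
Proof.
move=> xx xz; elim: l => [|i l IH]; first by rewrite !big_nil.
rewrite !big_cons !mulrA mulrDr -[x * (_ *: _)]scalemxAr (xx : x *m x = 0) scaler0 add0r.
by rewrite xz !mulNr -!mulrA IH.
Qed.

(** The top exterior power of a matrix is its determinant: Laplace expansion along the first row,
    where picking [x j] in the first factor removes column [j] from all the others. *)
Lemma prod_det n (C : 'M[F]_n) (x : 'I_n -> 'M[F]_N) :
    (forall i k, x i * x k = - (x k * x i)) -> (forall i, x i * x i = 0) ->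
  \prod_(i < n) (\sum_j C i j *: x j) = \det C *: \prod_(i < n) x i.
Proof.
elim: n C x => [|n IH] C x xx x2; first by rewrite !big_ord0 det_mx00 scale1r.
rewrite (expand_det_row _ ord0) big_ord_recl mulr_suml scaler_suml.
apply: eq_bigr => j _.
rewrite -[_ * _]scalemxAl -scalerA; congr (_ *: _).
have -> : \prod_(i < n) (\sum_k C (lift ord0 i) k *: x k) =
   \prod_(i < n) (C (lift ord0 i) j *: x j +
     \sum_k C (lift ord0 i) (lift j k) *: x (lift j k)).
  by apply: eq_bigr => i _; rewrite (bigD1_ord j).
rewrite [LHS]mul_prod_drop // => [|i]; last first.
  rewrite mulr_sumr mulr_suml -sumrN; apply: eq_bigr => k _.
  rewrite -!mulmxE -scalemxAr -scalemxAl -scalerN; congr (_ *: _).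
  exact: xx.
have -> : \prod_(i < n) (\sum_k C (lift ord0 i) (lift j k) *: x (lift j k)) =
   \prod_(i < n) (\sum_k (row' ord0 (col' j C)) i k *: x (lift j k)).
  by apply: eq_bigr => i _; apply: eq_bigr => k _; rewrite !mxE.
rewrite (IH _ (fun k => x (lift j k))) // /cofactor add0n.
rewrite -mulmxE -scalemxAr mulmxE prod_lift // mulrC -scalerA; congr (_ *: _).
by rewrite -[in RHS]signr_odd -[in LHS]signr_odd; case: odd;
  rewrite ?expr1 ?expr0 ?mul1r ?scale1r // mulN1r scaleN1r.
Qed.

End AnticommutingDet.

(** * Spin lifts of GL(n)_+ and of B-fields *)

Section Lifts.
Variables (R : realType) (n : nat).
Implicit Types (i j k : 'I_n) (S T : {set 'I_n}).
Local Notation N := (fdim n).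
Local Notation ext := (@Defs.ext R n).
Local Notation ctr := (@Defs.ctr R n).
Let two_neq0 : (2 : R) != 0. Proof. by rewrite pnatr_eq0. Qed.

Section GL.
Variables (A : 'M[R]_n) (detA : 0 < \det A).
Let C := invmx A.
Let uA : A \in unitmx. Proof. by rewrite unitmxE unitfE gt_eqF. Qed.
Let x i := \sum_j C i j *: ext j.
Let a i := \sum_j A j i *: ctr j.

Let x_anti i j : x i *m x j = - (x j *m x i).
Proof.
rewrite /x mulmx_suml mulmx_sumr -sumrN; apply: eq_bigr => k _.
rewrite mulmx_sumr mulmx_suml -sumrN; apply: eq_bigr => l _.
rewrite -!scalemxAl -!scalemxAr !scalerA mulrC -scalerN; congr (_ *: _).
exact: ext_anti.
Qed.

Let x_sq i : x i *m x i = 0.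
Proof.
have /eqP := x_anti i i; rewrite -addr_eq0 -mulr2n -scaler_nat scaler_eq0.
by rewrite (negbTE two_neq0) => /eqP.
Qed.

Lemma pullback_fock : pullback C = fock x (form1 R n).
Proof. by []. Qed.

(** The pullback is the Fock map of the transformed coframe [x], and the [a i] are the contractions
    dual to it; the two intertwining relations together give the covering property. *)
Lemma gl_covers : covers (gl_spin A) (gl_vec A).
Proof.
move=> v; rewrite /gl_spin -/C -scalemxAl -scalemxAr pullback_fock; congr (_ *: _).
have Pe := fock_ext (form1 R n) (fun i j _ => x_anti i j) x_sq.
have ax i j : a i *m x j + x j *m a i = ((i == j)%:R)%:M.
  transitivity (\sum_k A k i *: \sum_l C j l *: ((k == l)%:R)%:M : 'M[R]_N).
    change (acom (a i) (x j) = \sum_k A k i *: \sum_l C j l *: ((k == l)%:R)%:M).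
    rewrite /a acom_suml; apply: eq_bigr => k _; rewrite acomZl; congr (_ *: _).
    rewrite acomC acom_suml; apply: eq_bigr => l _; rewrite acomZl acomC; congr (_ *: _).
    exact: ctr_ext.
  transitivity ((\sum_k C j k * A k i) *: 1%:M : 'M[R]_N).
    rewrite scaler_suml; apply: eq_bigr => k _; rewrite (bigD1 k) //= big1 => [|l lk].
      by rewrite eqxx addr0 scalerA mulrC.
    by rewrite eq_sym (negbTE lk) -scalemx1 scale0r scaler0.
  have := mulVmx uA => /matrixP /(_ j i); rewrite [LHS]mxE [RHS]mxE eq_sym => ->.
  by rewrite scalemx1.
have a1 i : a i *m form1 R n = 0.
  by rewrite mulmx_suml big1 // => j _; rewrite -scalemxAl ctr_form1 scaler0.
have Pc := fock_ctr (fun i j _ => x_anti i j) x_sq ax a1.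
rewrite {1}/cliff mulmx_sumr.
under eq_bigr => i _ do rewrite mulmxBr -!scalemxAr Pe Pc !scalemxAl -mulmxBl.
rewrite -mulmx_suml; congr (_ *m _).
rewrite /cliff !sumrB; congr (_ - _).
  rewrite /x; under eq_bigr => i _ do rewrite scaler_sumr.
  rewrite exchange_big /=; apply: eq_bigr => j _.
  rewrite -[v]vsubmxK /gl_vec mul_block_col !mul0mx add0r addr0 !col_mxKd.
  rewrite [in RHS]mxE scaler_suml; apply: eq_bigr => i _.
  by rewrite scalerA [C^T _ _]mxE mulrC.
rewrite /a; under eq_bigr => i _ do rewrite scaler_sumr.
rewrite exchange_big /=; apply: eq_bigr => j _.
rewrite -[v]vsubmxK /gl_vec mul_block_col !mul0mx add0r addr0 !col_mxKu.
rewrite [in RHS]mxE scaler_suml; apply: eq_bigr => i _.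
by rewrite scalerA mulrC.
Qed.

Lemma gl_isom : isom_mx (gl_vec A).
Proof.
apply/isom_mxP; rewrite /gl_vec /gram tr_block_mx !trmx0 trmxK -scalemxAr -scalemxAl.
rewrite !mulmx_block !(mul0mx, mulmx0, mul1mx, mulmx1, addr0, add0r).
by rewrite mulVmx // -trmx_mul mulVmx // trmx1.
Qed.

Lemma gl_form1 : gl_spin A *m form1 R n = Num.sqrt (\det A) *: form1 R n.
Proof. by rewrite /gl_spin -scalemxAl pullback_fock fock_form1. Qed.

(** The square root in [gl_spin] balances the determinant: 1 and the top form are scaled by inverse
    factors, as [Spin_of_covers] requires. *)
Lemma gl_top : gl_spin A *m bas R (finset.setT) = (Num.sqrt (\det A))^-1 *: bas R finset.setT.
Proof.
rewrite /gl_spin -scalemxAl pullback_fock fock_bas -prod_ext.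
rewrite !prod_enum_setT prod_det => [|i k|i]; [|exact: ext_anti|exact: ext_sq].
rewrite -scalemxAl scalerA; congr (_ *: _).
have sA : Num.sqrt (\det A) != 0 by rewrite sqrtr_eq0 -ltNge.
by rewrite det_inv -{2}[\det A]sqr_sqrtr ?ltW // expr2 invfM mulrA divff // mul1r.
Qed.
End GL.

Section BField.

(** Filtration by form degree; it bounds the powers of the 2-form that survive in the
    exponential. *)
Definition raises (d : nat) (X : 'M[R]_N) := forall S T : {set 'I_n},
  X (enum_rank T) (enum_rank S) != 0 -> (#|S| + d <= #|T|)%N.

Lemma raises0 d : raises d 0.
Proof. by move=> S T; rewrite mxE eqxx. Qed.

Lemma raisesD d X Y : raises d X -> raises d Y -> raises d (X + Y).
Proof.
move=> dX dY S T; rewrite mxE; have [->|X0 _] := eqVneq (X (enum_rank T) (enum_rank S)) 0.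
  by rewrite add0r; apply: dY.
exact: dX.
Qed.

Lemma raisesZ d c X : raises d X -> raises d (c *: X).
Proof. by move=> dX S T; rewrite mxE mulf_eq0 negb_or => /andP[_ /dX]. Qed.

Lemma raises_sum d (I : Type) (l : seq I) (P : pred I) (X : I -> 'M[R]_N) :
  (forall a, raises d (X a)) -> raises d (\sum_(a <- l | P a) X a).
Proof. by move=> dX; apply: big_ind => //; [apply: raises0|apply: raisesD]. Qed.

Lemma raisesM d e X Y : raises d X -> raises e Y -> raises (d + e) (X *m Y).
Proof.
move=> dX eY S T; apply: contraNT; rewrite -ltnNge => ST; apply/eqP.
rewrite mxE big_fdim big1 // => U _.
have [->|/dX dXU] := eqVneq (X (enum_rank T) (enum_rank U)) 0; first by rewrite mul0r.
have [->|/eY eYU] := eqVneq (Y (enum_rank U) (enum_rank S)) 0; first by rewrite mulr0.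
by move: ST; lia.
Qed.

Lemma raises_ext i : raises 1 (ext i).
Proof.
move=> S T; rewrite -mul_bas ext_bas; case: ifPn => iS; first by rewrite mxE eqxx.
rewrite mxE basE; have [->|_] := eqVneq T (i |: S)%SET; last by rewrite mulr0 eqxx.
by rewrite cardsU1 iS addnC.
Qed.

Lemma raises_big d X : (n < d)%N -> raises d X -> X = 0.
Proof.
move=> nd dX; apply: form_ext => T q; rewrite -[q]enum_valK [RHS]mxE; apply/eqP.
apply/negPn/negP => /dX; have := max_card T; rewrite card_ord; lia.
Qed.

Variable beta : 'M[R]_n.
Hypothesis beta_anti : beta^T = - beta.
Let b := \sum_(i < n) \sum_(j < n | (i < j)%N) beta i j *: (ext i * ext j).
Let y k := \sum_j beta k j *: ext j.

Let b_raises : raises 2 b.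
Proof.
apply: raises_sum => i; apply: raises_sum => j; apply: raisesZ.
exact: (raisesM (@raises_ext i) (@raises_ext j)).
Qed.

Let bX_raises p : raises (2 * p) (b ^+ p).
Proof.
elim: p => [|p IH]; last by rewrite exprS mulnS; apply: raisesM.
by move=> S T; rewrite expr0 mxE (inj_eq enum_rank_inj) muln0 addn0; have [->|_] := eqVneq T S; rewrite ?eqxx.
Qed.

Let ext_b i : ext i * b = b * ext i.
Proof.
rewrite /b mulr_sumr mulr_suml; apply: eq_bigr => j _.
rewrite mulr_sumr mulr_suml; apply: eq_bigr => k _.
rewrite -!mulmxE -scalemxAr -scalemxAl; congr (_ *: _); rewrite !mulmxE.
by rewrite [LHS]mulrA (ext_anti R i j) mulNr -[X in - X]mulrA (ext_anti R i k) mulrN opprK mulrA.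
Qed.

(** Here [y k] is the 1-form [e_k -| beta]. *)
Let ctr_b k : ctr k * b = b * ctr k + y k.
Proof.
have E i j : ctr k * (ext i * ext j) =
    ext i * ext j * ctr k + (k == i)%:R *: ext j - (k == j)%:R *: ext i.
  have E2 l : ctr k * ext l = ((k == l)%:R)%:M - ext l * ctr k.
    by apply: (canRL (addrK _)); apply: ctr_ext.
  rewrite [LHS]mulrA E2 mulrBl -[in LHS]mulrA E2 mulrBr -!mulmxE mul_scalar_mx mul_mx_scalar.
  by rewrite opprB mulmxA addrCA addrA.
have byt i j : beta i j = - beta j i.
  by have /matrixP /(_ j i) := beta_anti; rewrite !mxE.
have b0 i : beta i i = 0.
  have /eqP := byt i i; rewrite -addr_eq0 -mulr2n -mulr_natl mulf_eq0.
  by rewrite (negbTE two_neq0) => /eqP.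
rewrite /b mulr_sumr mulr_suml.
transitivity (\sum_(i < n) ((\sum_(j < n | (i < j)%N) beta i j *: (ext i * ext j)) * ctr k +
    \sum_(j < n | (i < j)%N) beta i j *: ((k == i)%:R *: ext j - (k == j)%:R *: ext i))).
  apply: eq_bigr => i _; rewrite mulr_sumr mulr_suml -big_split; apply: eq_bigr => j _ /=.
  rewrite -!mulmxE -scalemxAr -scalemxAl -scalerDr; congr (_ *: _).
  by rewrite !mulmxE E addrA.
rewrite big_split /=; congr (_ + _).
transitivity (\sum_(i < n) (\sum_(j < n | (i < j)%N) (beta i j * (k == i)%:R) *: ext j +
     \sum_(j < n | (i < j)%N) (- beta i j * (k == j)%:R) *: ext i)).
  apply: eq_bigr => i _; rewrite -big_split; apply: eq_bigr => j _ /=.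
  by rewrite scalerBr !scalerA mulNr scaleNr.
rewrite big_split /= (bigD1 k) //= [X in _ + X + _]big1 => [|i ik]; last first.
  by rewrite big1 // => j _; rewrite eq_sym (negbTE ik) mulr0 scale0r.
rewrite addr0 eqxx /y [RHS](bigID (fun j : 'I_n => (k < j)%N)) /=; congr (_ + _).
  by apply: eq_bigr => j _; rewrite mulr1.
rewrite (big_mkcond (fun j : 'I_n => ~~ (k < j)%N)); apply: eq_bigr => i _.
rewrite -leqNgt; case: ltngtP => [ik|ki|/val_inj ->].
- rewrite (bigD1 k) //= big1 => [|j /andP[_ jk]]; last by rewrite eq_sym (negbTE jk) mulr0 scale0r.
  by rewrite eqxx mulr1 addr0 -byt.
- rewrite big1 // => j ij; rewrite (_ : (k == j) = false) ?mulr0 ?scale0r //.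
  by apply/eqP => kj; move: ij; rewrite -kj ltnNge ltnW.
- rewrite b0 scale0r big1 // => j kj; rewrite (_ : (k == j) = false) ?mulr0 ?scale0r //.
  by apply/eqP => E'; rewrite E' ltnn in kj.
Qed.

Let y_b k : b * y k = y k * b.
Proof.
rewrite /y mulr_sumr mulr_suml; apply: eq_bigr => j _.
by rewrite -!mulmxE -scalemxAr -scalemxAl !mulmxE ext_b.
Qed.

Let ctr_bX k p : ctr k * b ^+ p = b ^+ p * ctr k + (b ^+ p.-1 * y k) *+ p.
Proof.
elim: p => [|p IH]; first by rewrite expr0 mulr1 mul1r mulr0n addr0.
rewrite [in LHS]exprS [LHS]mulrA ctr_b mulrDl -[X in X + _]mulrA IH mulrDr -addrA.
rewrite [in RHS]exprS -[X in _ = X + _]mulrA; congr (_ + _).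
have -> : y k * b ^+ p = b ^+ p * y k by apply: commrX; apply/esym/y_b.
case: p {IH} => [|p]; first by rewrite !mulr0n mulr0 add0r.
by rewrite -!pred_Sn mulrnAr mulrA -exprS -mulrSr.
Qed.

(** The commutator [y k] of [ctr k] with [b] commutes with [b], so conjugation by the exponential of
    [b] subtracts exactly [y k] from [ctr k] and leaves every [ext i] unchanged. *)
Lemma bfield_covers : (0 < n)%N -> covers (bfield_spin beta) (bfield_vec beta).
Proof.
move=> n0 v; pose E := bfield_spin beta.
have Eext i : E *m ext i = ext i *m E.
  rewrite /E /bfield_spin -/b mulmx_suml mulmx_sumr; apply: eq_bigr => p _.
  rewrite -scalemxAl -scalemxAr; congr (_ *: _).
  by apply/esym/(commrX (x := ext i)); apply: ext_b.
have Ectr k : E *m ctr k = ctr k *m E - y k *m E.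
  apply: (canRL (addrK _)).
  have yE : y k *m E = \sum_(p < n.+1) p`!%:R^-1 *: (b ^+ p * y k).
    rewrite mulmx_sumr; apply: eq_bigr => p _; rewrite -scalemxAr; congr (_ *: _).
    by apply: (commrX (x := y k)); apply/esym/y_b.
  rewrite yE /E /bfield_spin -/b mulmx_suml mulmx_sumr.
  under [in RHS]eq_bigr => p _ do rewrite -scalemxAr mulmxE ctr_bX scalerDr.
  rewrite [RHS]big_split /=; congr (_ + _).
    by apply: eq_bigr => p _; rewrite -scalemxAl.
  rewrite [RHS]big_ord_recl mulr0n scaler0 add0r big_ord_recr /=.
  (* the series is truncated where b ^+ n * y k vanishes for degree reasons *)
  rewrite [X in _ + _ *: X](raises_big (d := 2 * n + 1)); first 1 last.
  - by lia.
  - apply: raisesM => //; rewrite /y; apply: raises_sum => j; apply: raisesZ; apply: raises_ext.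
  rewrite scaler0 addr0; apply: eq_bigr => p _; rewrite /bump /= add1n add0n factS.
  rewrite -[b ^+ p * y k *+ p.+1]scaler_nat scalerA natrM invfM mulrAC mulVf ?mul1r //.
rewrite -/E {1}/cliff mulmx_sumr.
under eq_bigr => i _ do rewrite mulmxBr -!scalemxAr Eext Ectr -mulmxBl !scalemxAl -mulmxBl.
rewrite -mulmx_suml; congr (_ *m _).
rewrite /cliff; under eq_bigr => i _ do rewrite scalerBr opprB addrA.
rewrite -[v]vsubmxK /bfield_vec mul_block_col !(mul0mx, mul1mx, addr0) !col_mxKd !col_mxKu.
rewrite sumrB [in RHS]sumrB; congr (_ - _).
under [in RHS]eq_bigr => i _ do rewrite mxE scalerDl.
rewrite !big_split /= addrC; congr (_ + _).
under eq_bigr => i _ do rewrite /y scaler_sumr.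
rewrite exchange_big /=; apply: eq_bigr => j _; rewrite mxE scaler_suml.
by apply: eq_bigr => i _; rewrite scalerA mulrC [beta^T _ _]mxE.
Qed.

Lemma bfield_isom : isom_mx (bfield_vec beta).
Proof.
apply/isom_mxP; rewrite /bfield_vec /gram tr_block_mx trmx0 trmx1 trmxK -scalemxAr -scalemxAl.
rewrite !mulmx_block !(mul0mx, mulmx0, mul1mx, mulmx1, addr0, add0r).
by rewrite beta_anti subrr.
Qed.

Lemma bfield_form1 : (bfield_spin beta *m form1 R n) (enum_rank finset.set0) 0 = 1.
Proof.
rewrite /bfield_spin -/b mulmx_suml summxE big_ord_recl big1 => [|i _].
  by rewrite addr0 fact0 invr1 scale1r expr0 mul1mx basE eqxx.
rewrite -scalemxAl mxE; apply/eqP; rewrite mulf_eq0; apply/orP; right.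
apply/negPn/negP; rewrite form1E mul_bas => /bX_raises.
by rewrite cards0 lift0.
Qed.

Lemma bfield_top : bfield_spin beta *m bas R finset.setT = bas R finset.setT.
Proof.
rewrite /bfield_spin -/b mulmx_suml big_ord_recl big1 => [|i _].
  by rewrite addr0 fact0 invr1 scale1r expr0 mul1mx.
rewrite -scalemxAl; apply/eqP; rewrite scaler_eq0; apply/orP; right.
apply/eqP/form_ext => T q; rewrite (ord1 q) [RHS]mxE mul_bas; apply/eqP.
apply/negPn/negP => /bX_raises; rewrite cardsT lift0.
by have := max_card T; rewrite card_ord; lia.
Qed.

End BField.
End Lifts.

(** * Germs of smooth functions *)

Section SmoothCalculus.
Variables (R : realType) (n : nat).
Local Notation X := 'cV[R]_n.
Implicit Types (f g : X -> R) (x v : X) (V : set X).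

(** The difference quotient is rationalised: it is that of [f] divided by the sum of the two square
    roots. *)
Lemma derivable_sqrt f x v : {for x, continuous f} -> 0 < f x -> derivable f x v ->
  derivable (fun y => Num.sqrt (f y)) x v /\
  'D_v (fun y => Num.sqrt (f y)) x = 'D_v f x * (2 * Num.sqrt (f x))^-1.
Proof.
move=> fc fx df.
have line : (h *: v + x) @[h --> (0 : R)^'] --> x.
  rewrite -[X in _ --> X]add0r -[X in X + x](scale0r v).
  apply: cvgD; last exact: cvg_cst.
  apply: (@cvgZr_tmp); apply: cvg_within.
have fl : f (h *: v + x) @[h --> (0 : R)^'] --> f x by apply: cvg_comp line fc.
have sl : Num.sqrt (f (h *: v + x)) @[h --> (0 : R)^'] --> Num.sqrt (f x).
  by apply: cvg_comp fl _; apply: sqrt_continuous.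
have sx : 0 < Num.sqrt (f x) by rewrite sqrtr_gt0.
have sx2 : Num.sqrt (f x) + Num.sqrt (f x) != 0 by rewrite gt_eqF // addr_gt0.
suff L : h^-1 *: (Num.sqrt (f (h *: v + x)) - Num.sqrt (f x)) @[h --> (0 : R)^'] -->
    'D_v f x * (2 * Num.sqrt (f x))^-1.
  by split; [apply/cvg_ex; eexists; exact: L|exact: (cvg_lim _ L)].
have -> : 2 * Num.sqrt (f x) = Num.sqrt (f x) + Num.sqrt (f x) by rewrite mulr_natl mulr2n.
apply: (@cvg_trans _ ((h^-1 *: (f (h *: v + x) - f x)) *
    (Num.sqrt (f (h *: v + x)) + Num.sqrt (f x))^-1 @[h --> (0 : R)^'])); last first.
  by apply: cvgM; [exact: df|apply: cvgV => //; apply: cvgD => //; apply: cvg_cst].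
apply: near_eq_cvg.
have : \forall h \near (0 : R)^', 0 < f (h *: v + x).
  by apply: (cvgr_gt _ fl).
apply: filterS => h fh /=.
have sh : 0 < Num.sqrt (f (h *: v + x)) by rewrite sqrtr_gt0.
rewrite -{1}(sqr_sqrtr (ltW fh)) -{1}(sqr_sqrtr (ltW fx)) subr_sqr.
rewrite /GRing.scale /= mulrA mulfK // gt_eqF // addr_gt0 //.
Qed.

Lemma Ck_cont k V f x : Ck k V f -> V x -> {for x, continuous f}.
Proof. by case: k => [|k] [fc _] Vx; apply: fc. Qed.

Lemma Ck_sub k V V' f : V' `<=` V -> Ck k V f -> Ck k V' f.
Proof.
move=> VV; elim: k f => [|k IH] f [fc fd]; split=> //; first by move=> x /VV; apply: fc.
  by move=> x /VV; apply: fc.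
by move=> i; have [d1 d2] := fd i; split=> [x /VV|]; [apply: d1|apply: IH].
Qed.

Lemma Ck_eq k V f g : open V -> (forall x, V x -> f x = g x) -> Ck k V f -> Ck k V g.
Proof.
move=> oV; elim: k f g => [|k IH] f g fg [fc fd].
  split=> // x Vx; have near_fg : {near x, f =1 g}.
    by apply: filterS fg _; apply: open_nbhs_nbhs.
  rewrite /prop_for /continuous_at -fg //; apply: cvg_trans (fc x Vx).
  exact: (near_eq_cvg near_fg).
have near_fg x : V x -> {near x, f =1 g}.
  by move=> Vx; apply: filterS fg _; apply: open_nbhs_nbhs.
split=> [x Vx|i].
  rewrite /prop_for /continuous_at -fg //; apply: cvg_trans (fc x Vx).
  exact: (near_eq_cvg (near_fg x Vx)).
have [d1 d2] := fd i; split=> [x Vx|].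
  by apply: near_eq_derivable (d1 x Vx); apply: near_fg.
apply: IH d2 => x Vx; rewrite /partial; apply: near_eq_derive; exact: near_fg.
Qed.

Lemma Ck_le k V f : Ck k.+1 V f -> Ck k V f.
Proof.
elim: k f => [|k IH] f [fc fd]; split=> // i; have [d1 d2] := fd i; split=> //.
exact: IH.
Qed.

Lemma Ck_cst k V (c : R) : open V -> Ck k V (fun=> c).
Proof.
move=> oV; elim: k c => [|k IH] c; split=> //; try by move=> x _; exact: cst_continuous.
move=> i; split=> [x _|]; first exact: derivable_cst.
by apply: Ck_eq (IH 0) => // x _; rewrite /partial (derive_cst c).
Qed.

Lemma CkD k V f g : open V -> Ck k V f -> Ck k V g -> Ck k V (f \+ g).
Proof.
move=> oV; elim: k f g => [|k IH] f g [fc fd] [gc gd];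
  (split; [by move=> x Vx; exact: (continuousD (fc x Vx) (gc x Vx))|]) => //.
move=> i; have [f1 f2] := fd i; have [g1 g2] := gd i; split=> [x Vx|].
  by apply: derivableD; [apply: f1|apply: g1].
apply: Ck_eq (IH _ _ f2 g2) => // x Vx.
by rewrite /partial [RHS]deriveD //; [apply: f1|apply: g1].
Qed.

Lemma CkM k V f g : open V -> Ck k V f -> Ck k V g -> Ck k V (f \* g).
Proof.
move=> oV; elim: k f g => [|k IH] f g [fc fd] [gc gd];
  (split; [by move=> x Vx; exact: (continuousM (fc x Vx) (gc x Vx))|]) => //.
move=> i; have [f1 f2] := fd i; have [g1 g2] := gd i; split=> [x Vx|].
  by apply: derivableM; [apply: f1|apply: g1].
have fk : Ck k V f by apply: Ck_le; split.
have gk : Ck k V g by apply: Ck_le; split.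
apply: Ck_eq (CkD oV (IH _ _ fk g2) (IH _ _ gk f2)) => // x Vx.
by rewrite /partial [RHS]deriveM //; [apply: f1|apply: g1].
Qed.

Lemma CkV k V f : open V -> (forall x, V x -> f x != 0) -> Ck k V f ->
  Ck k V (fun x => (f x)^-1).
Proof.
move=> oV f0; elim: k => [|k IH] [fc fd];
  (split; [by move=> x Vx; exact: (continuousV (f0 x Vx) (fc x Vx))|]) => //.
move=> i; have [f1 f2] := fd i; split=> [x Vx|].
  by apply: derivableV; [apply: f0|apply: f1].
have fk : Ck k V (fun x => (f x)^-1) by apply: IH; apply: Ck_le; split.
apply: Ck_eq (CkM oV (Ck_cst k (-1) oV) (CkM oV (CkM oV fk fk) f2)) => // x Vx.
rewrite /partial /= [RHS]deriveV; [|exact: f0|exact: f1].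
by rewrite /GRing.scale /= mulN1r -mulNr -invfM -expr2.
Qed.

Lemma Ck_sqrt k V f : open V -> (forall x, V x -> 0 < f x) -> Ck k V f ->
  Ck k V (fun x => Num.sqrt (f x)).
Proof.
move=> oV f0; elim: k => [|k IH] fk; have [fc fd] := fk.
  by split=> // x Vx; apply: continuous_comp; [apply: fc|apply: sqrt_continuous].
have sk : Ck k V (fun x => Num.sqrt (f x)) by apply: IH; apply: Ck_le; split.
split; first by move=> x Vx; apply: continuous_comp; [apply: fc|apply: sqrt_continuous].
move=> i; have [f1 f2] := fd i; split=> [x Vx|].
  by have [] := derivable_sqrt (fc x Vx) (f0 x Vx) (f1 x Vx).
have s2 : Ck k V (fun x => (2 * Num.sqrt (f x))^-1).
  apply: CkV => // [x Vx|]; first by rewrite mulf_neq0 ?pnatr_eq0 // gt_eqF // sqrtr_gt0 f0.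
  exact: (CkM oV (Ck_cst k 2 oV) sk).
apply: Ck_eq (CkM oV f2 s2) => // x Vx.
by have [_] := derivable_sqrt (fc x Vx) (f0 x Vx) (f1 x Vx); rewrite /partial => ->.
Qed.

Lemma Ck_local k V f : open V ->
  (forall x, V x -> exists U, [/\ open U, U x & Ck k U f]) -> Ck k V f.
Proof.
move=> oV; elim: k f => [|k IH] f loc.
  by split=> // x /loc[U [_ Ux [fc _]]]; apply: fc.
split=> [x /loc[U [_ Ux [fc _]]]|i]; first exact: fc.
split=> [x /loc[U [_ Ux [_ fd]]]|]; first by have [d1 _] := fd i; apply: d1.
by apply: IH => x /loc[U [oU Ux [_ fd]]]; exists U; split=> //; have [] := fd i.
Qed.

(** Smoothness of a germ: signs, nonzero vectors and the like are chosen at [x0] and remain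
    admissible only nearby. *)
Definition smooth_near (x0 : X) f := exists U, [/\ open U, U x0 & smooth_on U f].

End SmoothCalculus.

Section SmoothGerms.
Variables (R : realType) (n : nat).
Local Notation X := 'cV[R]_n.
Implicit Types (f g : X -> R) (x y : X) (V : set X) (z w : X -> R[i]).

Lemma smooth_near_cont x f : smooth_near x f -> {for x, continuous f}.
Proof. by move=> [U [_ Ux /(_ 0%N) sf]]; apply: Ck_cont sf Ux. Qed.

Lemma smooth_near_gt0 x f : smooth_near x f -> 0 < f x -> \forall y \near x, 0 < f y.
Proof. by move=> /smooth_near_cont fc f0; apply: (cvgr_gt _ fc). Qed.

Lemma smooth_near_neq0 x f : smooth_near x f -> f x != 0 -> \forall y \near x, f y != 0.
Proof. by move=> /smooth_near_cont fc f0; apply: (cvgr_neq0 _ fc). Qed.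

Lemma nbhs_open x (P : X -> Prop) : (\forall y \near x, P y) ->
  exists U, [/\ open U, U x & forall y, U y -> P y].
Proof.
move=> xP; exists (interior P); split; first exact: open_interior.
  exact: (nbhs_singleton (nbhs_interior xP)).
exact: interior_subset.
Qed.

Lemma near_all x (P : X -> Prop) : (forall y, P y) -> \forall y \near x, P y.
Proof. by move=> Py; exact: (@filterE _ (nbhs x) _ P). Qed.

Lemma smooth_on_sub V V' f : V' `<=` V -> smooth_on V f -> smooth_on V' f.
Proof. by move=> VV sf k; apply: Ck_sub VV (sf k). Qed.

Lemma smooth_near_eq x f g : (\forall y \near x, f y = g y) ->
  smooth_near x f -> smooth_near x g.
Proof.
move=> /nbhs_open[W [oW Wx fg]] [U [oU Ux sf]]; exists (U `&` W); split=> //.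
  exact: openI.
by move=> k; apply: (Ck_eq (f := f)); [apply: openI|move=> y [_ /fg]|
  apply: Ck_sub (sf k) => y []].
Qed.

Lemma sn_cst x (c : R) : smooth_near x (fun=> c).
Proof. by exists setT; split=> //; [apply: openT|move=> k; apply: Ck_cst openT]. Qed.

Lemma snD x f g : smooth_near x f -> smooth_near x g -> smooth_near x (fun y => f y + g y).
Proof.
move=> [U [oU Ux sf]] [W [oW Wx sg]]; exists (U `&` W); split=> //; first exact: openI.
by move=> k; apply: CkD; [apply: openI|apply: Ck_sub (sf k) => y []|apply: Ck_sub (sg k) => y []].
Qed.

Lemma snM x f g : smooth_near x f -> smooth_near x g -> smooth_near x (fun y => f y * g y).
Proof.
move=> [U [oU Ux sf]] [W [oW Wx sg]]; exists (U `&` W); split=> //; first exact: openI.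
by move=> k; apply: CkM; [apply: openI|apply: Ck_sub (sf k) => y []|apply: Ck_sub (sg k) => y []].
Qed.

Lemma snN x f : smooth_near x f -> smooth_near x (fun y => - f y).
Proof.
move=> sf; apply: smooth_near_eq (snM (sn_cst x (-1)) sf).
by apply: near_all => y; rewrite mulN1r.
Qed.

Lemma snB x f g : smooth_near x f -> smooth_near x g -> smooth_near x (fun y => f y - g y).
Proof. by move=> sf sg; apply: snD (snN sg). Qed.

Lemma sn_sum x (I : Type) (r : seq I) (P : pred I) (F : I -> X -> R) :
  (forall i, smooth_near x (F i)) -> smooth_near x (fun y => \sum_(i <- r | P i) F i y).
Proof.
move=> sF; elim: r => [|i r IH].
  by apply: smooth_near_eq (sn_cst x 0); apply: near_all => y; rewrite big_nil.
have [Pi|Pi] := boolP (P i).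
  by apply: smooth_near_eq (snD (sF i) IH); apply: near_all => y; rewrite big_cons Pi.
by apply: smooth_near_eq IH; apply: near_all => y; rewrite big_cons (negbTE Pi).
Qed.

Lemma snV x f : f x != 0 -> smooth_near x f -> smooth_near x (fun y => (f y)^-1).
Proof.
move=> f0 sf; have /nbhs_open[W [oW Wx fW]] := smooth_near_neq0 sf f0.
have [U [oU Ux {}sf]] := sf; exists (U `&` W); split=> //; first exact: openI.
move=> k; apply: CkV; [exact: openI|by move=> y [_ /fW]|by apply: Ck_sub (sf k) => y []].
Qed.

Lemma sn_sqrt x f : 0 < f x -> smooth_near x f -> smooth_near x (fun y => Num.sqrt (f y)).
Proof.
move=> f0 sf; have /nbhs_open[W [oW Wx fW]] := smooth_near_gt0 sf f0.
have [U [oU Ux {}sf]] := sf; exists (U `&` W); split=> //; first exact: openI.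
move=> k; apply: Ck_sqrt; [exact: openI|by move=> y [_ /fW]|by apply: Ck_sub (sf k) => y []].
Qed.

Definition smooth_mx_near x p q (A : X -> 'M[R]_(p, q)) :=
  forall i j, smooth_near x (fun y => A y i j).

Lemma common_nbhd x (T : finType) (P : T -> set X -> Prop) :
    (forall t U V, U `<=` V -> P t V -> P t U) ->
    (forall t, exists U, [/\ open U, U x & P t U]) ->
  exists U, [/\ open U, U x & forall t, P t U].
Proof.
move=> Psub Pex.
suff [U [oU Ux PU]] : exists U, [/\ open U, U x & forall t, t \in enum T -> P t U].
  by exists U; split=> // t; apply: PU; rewrite mem_enum.
elim: (enum T) => [|t l [U [oU Ux PU]]]; first by exists setT; split=> //; apply: openT.
have [V [oV Vx PV]] := Pex t; exists (U `&` V); split=> //; first exact: openI.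
move=> s; rewrite inE => /orP[/eqP ->|sl].
  by apply: Psub PV => y [].
by apply: Psub (PU s sl) => y [].
Qed.

Lemma smooth_mx_near_on x p q (A : X -> 'M[R]_(p, q)) : smooth_mx_near x A ->
  exists U, [/\ open U, U x & smooth_map_on U A].
Proof.
move=> sA; have [|t|U [oU Ux PU]] :=
    @common_nbhd x ('I_p * 'I_q)%type (fun t U => smooth_on U (fun y => A y t.1 t.2)).
- by move=> t U V UV; apply: smooth_on_sub.
- exact: sA.
- by exists U; split=> // i j; apply: (PU (i, j)).
Qed.

Section MatrixGerms.
Variable x : X.
Local Notation sm := (smooth_mx_near x).

Lemma smx_eq p q (A B : X -> 'M[R]_(p, q)) : (\forall y \near x, A y = B y) -> sm A -> sm B.
Proof.
move=> AB sA i j; apply: smooth_near_eq (sA i j).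
by apply: filterS AB => y ->.
Qed.

Lemma smx_cst p q (A : 'M[R]_(p, q)) : sm (fun=> A).
Proof. by move=> i j; apply: sn_cst. Qed.

Lemma smxD p q (A B : X -> 'M[R]_(p, q)) : sm A -> sm B -> sm (fun y => A y + B y).
Proof.
move=> sA sB i j; apply: smooth_near_eq (snD (sA i j) (sB i j)).
by apply: near_all => y; rewrite mxE.
Qed.

Lemma smxZ p q c (A : X -> 'M[R]_(p, q)) : smooth_near x c -> sm A -> sm (fun y => c y *: A y).
Proof.
move=> sc sA i j; apply: smooth_near_eq (snM sc (sA i j)).
by apply: near_all => y; rewrite mxE.
Qed.

Lemma smxN p q (A : X -> 'M[R]_(p, q)) : sm A -> sm (fun y => - A y).
Proof.
move=> sA i j; apply: smooth_near_eq (snN (sA i j)).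
by apply: near_all => y; rewrite mxE.
Qed.

Lemma smxB p q (A B : X -> 'M[R]_(p, q)) : sm A -> sm B -> sm (fun y => A y - B y).
Proof. by move=> sA sB; apply: smxD => //; apply: smxN. Qed.

Lemma smxM p q r (A : X -> 'M[R]_(p, q)) (B : X -> 'M[R]_(q, r)) :
  sm A -> sm B -> sm (fun y => A y *m B y).
Proof.
move=> sA sB i j; apply: smooth_near_eq (sn_sum _ _ (fun k => snM (sA i k) (sB k j))).
by apply: near_all => y; rewrite mxE.
Qed.

Lemma smx_tr p q (A : X -> 'M[R]_(p, q)) : sm A -> sm (fun y => (A y)^T).
Proof.
move=> sA i j; apply: smooth_near_eq (sA j i).
by apply: near_all => y; rewrite mxE.
Qed.

Lemma smx_sum p q (I : Type) (r : seq I) (P : pred I) (A : I -> X -> 'M[R]_(p, q)) :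
  (forall i, sm (A i)) -> sm (fun y => \sum_(i <- r | P i) A i y).
Proof.
move=> sA i j; apply: smooth_near_eq (sn_sum r P (fun k => sA k i j)).
by apply: near_all => y; rewrite summxE.
Qed.

Lemma smx_cliff k (v : X -> 'cV[R]_(k + k)) : sm v -> sm (fun y => cliff (v y)).
Proof.
move=> sv; apply: smx_sum => i; apply: smxB; apply: smxZ; try exact: smx_cst.
  by apply: smooth_near_eq (sv (rshift k i) 0); apply: near_all => y; rewrite mxE.
by apply: smooth_near_eq (sv (lshift k i) 0); apply: near_all => y; rewrite mxE.
Qed.

Lemma sn_inner k (v w : X -> 'cV[R]_(k + k)) : sm v -> sm w ->
  smooth_near x (fun y => inner (v y) (w y)).
Proof.
by move=> sv sw; apply: (smxM (smxM (smx_tr sv) (smx_cst _)) sw).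
Qed.

Definition csmooth_near z :=
  smooth_near x (fun y => complex.Re (z y)) /\ smooth_near x (fun y => complex.Im (z y)).

Lemma csn_eq z w : (\forall y \near x, z y = w y) -> csmooth_near z -> csmooth_near w.
Proof. by move=> zw [sr si]; split; [apply: smooth_near_eq sr|apply: smooth_near_eq si];
  apply: filterS zw => y ->. Qed.

Lemma csn_cst c : csmooth_near (fun=> c).
Proof. by split; apply: sn_cst. Qed.

Lemma csn_real f : smooth_near x f -> csmooth_near (fun y => toC (f y)).
Proof. by move=> sf; split=> //; apply: sn_cst. Qed.

Lemma csnD z w : csmooth_near z -> csmooth_near w -> csmooth_near (fun y => z y + w y).
Proof.
move=> [zr zi] [wr wi]; split.
  by apply: smooth_near_eq (snD zr wr); apply: near_all => y; case: (z y) => ? ?; case: (w y).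
by apply: smooth_near_eq (snD zi wi); apply: near_all => y; case: (z y) => ? ?; case: (w y).
Qed.

Lemma csnM z w : csmooth_near z -> csmooth_near w -> csmooth_near (fun y => z y * w y).
Proof.
move=> [zr zi] [wr wi]; split.
  apply: smooth_near_eq (snB (snM zr wr) (snM zi wi)); apply: near_all => y.
  by case: (z y) => ? ?; case: (w y).
apply: smooth_near_eq (snD (snM zr wi) (snM zi wr)); apply: near_all => y.
by case: (z y) => ? ?; case: (w y).
Qed.

Lemma csn_conj z : csmooth_near z -> csmooth_near (fun y => conjc (z y)).
Proof.
move=> [zr zi]; split; first by apply: smooth_near_eq zr; apply: near_all => y; case: (z y).
by apply: smooth_near_eq (snN zi); apply: near_all => y; case: (z y).
Qed.

Lemma csn_sum (I : Type) (r : seq I) (P : pred I) (F : I -> X -> R[i]) :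
  (forall i, csmooth_near (F i)) -> csmooth_near (fun y => \sum_(i <- r | P i) F i y).
Proof.
move=> sF; elim: r => [|i r IH].
  by apply: csn_eq (csn_cst 0); apply: near_all => y; rewrite big_nil.
have [Pi|Pi] := boolP (P i).
  by apply: csn_eq (csnD (sF i) IH); apply: near_all => y; rewrite big_cons Pi.
by apply: csn_eq IH; apply: near_all => y; rewrite big_cons (negbTE Pi).
Qed.

Definition sqr_norm (c : R[i]) : R := complex.Re c * complex.Re c + complex.Im c * complex.Im c.

Lemma sqr_norm_gt0 c : c != 0 -> 0 < sqr_norm c.
Proof.
case: c => a b; rewrite eq_complex /= negb_and /sqr_norm /= => ab.
rewrite lt_neqAle addr_ge0 -?expr2 ?sqr_ge0 // andbT eq_sym paddr_eq0 ?sqr_ge0 //.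
by rewrite !sqrf_eq0 negb_and.
Qed.

Lemma sqr_normE c : toC (sqr_norm c) = c * conjc c.
Proof. by case: c => a b; apply/eqP; rewrite eq_complex /= /sqr_norm /=; apply/andP; split; apply/eqP; ring. Qed.

Lemma sn_sqr_norm z : csmooth_near z -> smooth_near x (fun y => sqr_norm (z y)).
Proof. by move=> [zr zi]; apply: snD; apply: snM. Qed.

Lemma csnV z : z x != 0 -> csmooth_near z -> csmooth_near (fun y => (z y)^-1).
Proof.
move=> z0 sz; have N0 := sqr_norm_gt0 z0; have sN := sn_sqr_norm sz.
have := csnM (csn_conj sz) (csn_real (snV (lt0r_neq0 N0) sN)).
apply: csn_eq; apply: filterS (smooth_near_gt0 sN N0) => y Ny.
have zy : z y != 0.
  by apply: contraTneq Ny => ->; rewrite /sqr_norm /= mulr0 addr0 ltxx.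
by rewrite fmorphV /= sqr_normE invfM mulrCA mulfV ?mulr1 // conjc_eq0.
Qed.

Definition csmooth_mx_near p q (A : X -> 'M[R[i]]_(p, q)) :=
  forall i j, csmooth_near (fun y => A y i j).

Lemma csmx_cst p q (A : 'M[R[i]]_(p, q)) : csmooth_mx_near (fun=> A).
Proof. by move=> i j; apply: csn_cst. Qed.

Lemma csmx_real p q (A : X -> 'M[R]_(p, q)) : sm A ->
  csmooth_mx_near (fun y => map_mx toC (A y)).
Proof.
move=> sA i j; apply: csn_eq (csn_real (sA i j)).
by apply: near_all => y; rewrite mxE.
Qed.

Lemma csmxM p q r (A : X -> 'M[R[i]]_(p, q)) (B : X -> 'M[R[i]]_(q, r)) :
  csmooth_mx_near A -> csmooth_mx_near B -> csmooth_mx_near (fun y => A y *m B y).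
Proof.
move=> sA sB i j; apply: csn_eq (csn_sum _ _ (fun k => csnM (sA i k) (sB k j))).
by apply: near_all => y; rewrite mxE.
Qed.

Lemma csmxZ p q c (A : X -> 'M[R[i]]_(p, q)) :
  csmooth_near c -> csmooth_mx_near A -> csmooth_mx_near (fun y => c y *: A y).
Proof.
move=> sc sA i j; apply: csn_eq (csnM sc (sA i j)).
by apply: near_all => y; rewrite mxE.
Qed.

Lemma csmx_tr p q (A : X -> 'M[R[i]]_(p, q)) :
  csmooth_mx_near A -> csmooth_mx_near (fun y => (A y)^T).
Proof.
move=> sA i j; apply: csn_eq (sA j i).
by apply: near_all => y; rewrite mxE.
Qed.

Lemma csmx_conj p q (A : X -> 'M[R[i]]_(p, q)) :
  csmooth_mx_near A -> csmooth_mx_near (fun y => map_mx conjc (A y)).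
Proof.
move=> sA i j; apply: csn_eq (csn_conj (sA i j)).
by apply: near_all => y; rewrite mxE.
Qed.

End MatrixGerms.
End SmoothGerms.

Section Polarised.
Variables (F : fieldType) (n : nat).
Hypothesis two_neq0 : (2 : F) != 0.

(* Its columns X (+) X and X (+) -X diagonalise the inner product. *)
Definition polar : 'M[F]_(n + n) := block_mx 1%:M 1%:M 1%:M (- 1%:M).

Lemma polar_sym : polar^T = polar.
Proof. by rewrite /polar tr_block_mx linearN /= !trmx1. Qed.

Lemma polar_sqr : polar *m polar = 2%:M.
Proof.
rewrite /polar mulmx_block !mulmx1 !mul1mx mulNmx mulmxN mul1mx opprK subrr.
by rewrite -!raddfD -scalar_mx_block.
Qed.

Lemma polar_unit : polar \in unitmx.
Proof.
suff /mulmx1_unit[] : polar *m (2^-1 *: polar) = 1%:M by [].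
by rewrite -scalemxAr polar_sqr scale_scalar_mx mulVf.
Qed.

Lemma polar_gram : polar^T *m gram F n *m polar = block_mx 1%:M 0 0 (- 1%:M).
Proof.
have d2 : 2^-1 *: (1%:M + 1%:M) = 1%:M :> 'M[F]_n.
  by rewrite -raddfD scale_scalar_mx mulVf.
rewrite polar_sym /polar /gram -scalemxAr -scalemxAl !mulmx_block.
rewrite !(mulmx0, mul0mx, mulmx1, mul1mx, add0r, addr0, mulmxN) addNr subrr.
by rewrite scale_block_mx scaler0 d2 -opprD scalerN d2.
Qed.
End Polarised.

(** * Smooth Pin lifts of isometries *)

Section CartanDieudonne.
Variables (R : realType) (n p : nat).
Local Notation X := 'cV[R]_p.
Implicit Types (v w : X -> 'cV[R]_(n + n)).
Let two_neq0 : (2 : R) != 0. Proof. by rewrite pnatr_eq0. Qed.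

Lemma refl_scale (c : R) (v : 'cV[R]_(n + n)) : c != 0 -> refl (c *: v) = refl v.
Proof.
move=> c0; rewrite /refl innerZl innerZr.
have -> : c *: v *m (c *: v)^T *m gram R n = (c * c) *: (v *m v^T *m gram R n).
  rewrite [(c *: v)^T]linearZ /= -[(c *: v) *m _]scalemxAl -[v *m (_ *: _)]scalemxAr.
  by rewrite scalerA -[in LHS]scalemxAl.
rewrite scalerA; congr (_ - _ *: _).
have [->|v0] := eqVneq (inner v v) 0; first by rewrite !mulr0 invr0 mulr0 !mul0r.
by field; rewrite c0 v0.
Qed.

Lemma refl_swap (u w : 'cV[R]_(n + n)) : inner u u = inner w w ->
  inner (u - w) (u - w) != 0 -> refl (u - w) *m u = w.
Proof.
move=> uw0 m0; rewrite reflE (_ : _ / _ = 1) ?scale1r ?subKr //.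
apply: (mulIf m0); rewrite mulfVK // mul1r.
by rewrite !(innerDl, innerDr, innerNl, innerNr) -uw0 (innerC w u); ring.
Qed.

Lemma refl_self (w : 'cV[R]_(n + n)) : inner w w != 0 -> refl w *m w = - w.
Proof. by move=> w0; rewrite reflE mulfK // scaler_nat mulr2n opprD addrA subrr add0r. Qed.

Lemma smx_refl x v : smooth_mx_near x v -> inner (v x) (v x) != 0 ->
  smooth_mx_near x (fun y => refl (v y)).
Proof.
move=> sv v0; apply: smxB; first exact: smx_cst.
apply: smxZ; first by apply: snM; [exact: sn_cst|apply: snV => //; apply: sn_inner].
by apply: smxM; [apply: smxM => //; apply: smx_tr|apply: smx_cst].
Qed.

Definition smooth_lift x b (s : X -> 'M[R]_(fdim n)) (h : X -> 'M[R]_(n + n)) :=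
  [/\ smooth_mx_near x s, smooth_mx_near x h
    & \forall y \near x, [/\ Pin b (s y), tcovers b (s y) (h y) & isom_mx (h y)]].

Lemma smooth_lift_refl x b s h v : smooth_lift x b s h -> smooth_mx_near x v ->
    inner (v x) (v x) != 0 ->
  exists s', smooth_lift x (~~ b) s' (fun y => refl (v y) *m h y).
Proof.
move=> [ss sh near_sh] sv v0.
(* The sign of the norm is frozen at [x]; this makes [N] smooth, and positive near [x]. *)
pose e := Num.sg (inner (v x) (v x)); pose N y := e * inner (v y) (v y).
have e1 : `|e| = 1 by rewrite normr_sg v0.
have sN : smooth_near x N by apply: snM; [apply: sn_cst|apply: sn_inner].
have N0 : 0 < N x by rewrite /N /e -normrEsg normr_gt0.
pose a y := (Num.sqrt (N y))^-1 *: v y.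
have sa : smooth_mx_near x a.
  by apply: smxZ => //; apply: snV; [rewrite gt_eqF // sqrtr_gt0|apply: sn_sqrt].
exists (fun y => cliff (a y) *m s y); split.
- by apply: smxM => //; apply: smx_cliff.
- by apply: smxM => //; apply: smx_refl.
have near_N := smooth_near_gt0 sN N0.
apply: filterS2 near_N near_sh => y Ny [ps cs ih].
have sNy : 0 < Num.sqrt (N y) by rewrite sqrtr_gt0.
have a1 : `|inner (a y) (a y)| = 1.
  rewrite innerZl innerZr mulrA -invfM -expr2 sqr_sqrtr ?ltW // normrM.
  by rewrite normfV /N normrM e1 mul1r mulVf // normr_eq0; apply: contraTneq Ny => E; rewrite /N E mulr0 ltxx.
have ra : refl (a y) = refl (v y) by rewrite refl_scale // invr_eq0 gt_eqF.
rewrite -addTb -ra; split.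
- by apply: PinM => //; apply: Pin_cliff.
- by apply: tcoversM => //; apply: tcovers_cliff.
- by apply: isom_mxM => //; apply: refl_isom => //; apply: unit_norm_neq0.
Qed.

(* Cartan-Dieudonne along an orthogonal frame: u is sent to w by the reflection in
   u - w or, where this vector is isotropic, by those in u + w and w. *)
Lemma smooth_pin_lift x (g : X -> 'M[R]_(n + n)) :
    smooth_mx_near x g -> (\forall y \near x, isom_mx (g y)) ->
  exists b s, smooth_lift x b s g.
Proof.
move=> sg ig; pose e i : 'cV[R]_(n + n) := polar R n *m delta_mx i 0.
have ee i j : inner (e i) (e j) = (block_mx 1%:M 0 0 (- 1%:M) : 'M[R]_(n + n)) i j.
  by rewrite inner_mx polar_gram // trmx_delta -colE -rowE !mxE.
have eii i : inner (e i) (e i) != 0.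
  rewrite ee -(splitK i); case: (fintype.split i) => k /=.
    by rewrite block_mxEul mxE eqxx oner_eq0.
  by rewrite block_mxEdr !mxE eqxx oppr_eq0 oner_eq0.
have eij i j : i != j -> inner (e i) (e j) = 0.
  rewrite ee -(splitK i) -(splitK j).
  case: (fintype.split i) => k /=; case: (fintype.split j) => l /=.
  - by rewrite block_mxEul mxE (inj_eq (@lshift_inj _ _)) => /negbTE ->.
  - by rewrite block_mxEur mxE.
  - by rewrite block_mxEdl mxE.
  - by rewrite block_mxEdr !mxE (inj_eq (@rshift_inj _ _)) => /negbTE ->; rewrite oppr0.
suff /(_ (n + n)%N (leqnn _)) [b [s [h [sh hg]]]] : forall k, (k <= n + n)%N ->
    exists b s h, smooth_lift x b s h /\
    (\forall y \near x, forall i : 'I_(n + n), (i < k)%N -> h y *m e i = g y *m e i).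
  exists b, s; case: sh => ss _ near_sh; split=> //.
  apply: filterS2 hg near_sh => y hg [ps cs ih].
  suff <- : h y = g y by [].
  apply: (can_inj (mulmxK (polar_unit n two_neq0))); apply/matrixP => i j.
  by have /matrixP /(_ i 0) := hg j (ltn_ord j); rewrite /e !mulmxA -!colE !mxE.
elim=> [_|k IH kn].
  exists false, (fun=> 1%:M), (fun=> 1%:M); split; last by apply: near_all.
  split; [exact: smx_cst|exact: smx_cst|apply: near_all => y].
  by split; [apply: Pin1|apply: tcovers1|apply: isom_mx1].
have [b [s [h [sh hg]]]] := IH (ltnW kn).
pose i := Ordinal kn; pose u y := h y *m e i; pose w y := g y *m e i.
have [ss smh near_sh] := sh.
have su : smooth_mx_near x u by apply: smxM => //; apply: smx_cst.
have sw : smooth_mx_near x w by apply: smxM => //; apply: smx_cst.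
have near_u : \forall y \near x, inner (u y) (u y) = inner (e i) (e i) /\
    forall j : 'I_(n + n), (j < k)%N -> inner (u y) (g y *m e j) = 0.
  apply: filterS2 hg near_sh => y hgy [_ _ ih]; split; first exact: ih.
  move=> j jk; rewrite -hgy // ih eij //.
  by apply: contraTneq jk => <-; rewrite ltnn.
have near_w : \forall y \near x, inner (w y) (w y) = inner (e i) (e i) /\
    forall j : 'I_(n + n), (j < k)%N -> inner (w y) (g y *m e j) = 0.
  apply: filterS ig => y iy; split; first exact: iy.
  move=> j jk; rewrite iy eij //.
  by apply: contraTneq jk => <-; rewrite ltnn.
have [ux _] := nbhs_singleton near_u; have [wx _] := nbhs_singleton near_w.
(* The alternative is decided at [x]. In both cases the images [g y *m e j] already matched stay
   fixed, being orthogonal to [u y] and [w y]. *)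
have [m0|m0] := eqVneq (inner (u x - w x) (u x - w x)) 0; last first.
  have sv : smooth_mx_near x (fun y => u y - w y) by apply: smxB.
  have [s' sh'] := smooth_lift_refl sh sv m0.
  exists (~~ b), s', (fun y => refl (u y - w y) *m h y); split=> //.
  have near_m := smooth_near_neq0 (sn_inner sv sv) m0.
  apply: filterS2 (filterI near_m hg) (filterI near_u near_w) => y [my hgy] [[uy uj] [wy wj]] j.
  rewrite ltnS leq_eqVlt => /orP[/eqP jk|jk].
    have -> : j = i by apply: val_inj.
    by rewrite -mulmxA refl_swap // uy wy.
  by rewrite -mulmxA hgy // reflE innerDl innerNl uj // wj // subrr mulr0 mul0r scale0r subr0.
have m1 : inner (u x + w x) (u x + w x) != 0.
  (* Parallelogram law: the sum and the difference cannot both be isotropic. *)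
  have -> : inner (u x + w x) (u x + w x) = 4 * inner (e i) (e i) - inner (u x - w x) (u x - w x).
    rewrite !(innerDl, innerDr, innerNl, innerNr) ux wx (innerC (w x) (u x)); ring.
  by rewrite m0 subr0 mulf_neq0 // pnatr_eq0.
have sv : smooth_mx_near x (fun y => u y + w y) by apply: smxD.
have [s1 sh1] := smooth_lift_refl sh sv m1.
have w0 : inner (w x) (w x) != 0 by rewrite wx.
have [s2 sh2] := smooth_lift_refl sh1 sw w0.
exists (~~ ~~ b), s2, (fun y => refl (w y) *m (refl (u y + w y) *m h y)); split=> //.
have near_m := smooth_near_neq0 (sn_inner sv sv) m1.
have near_w0 := smooth_near_neq0 (sn_inner sw sw) w0.
apply: filterS3 near_w0 (filterI near_m hg) (filterI near_u near_w) => y wy0 [my hgy] [[uy uj] [wy wj]] j.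
rewrite ltnS leq_eqVlt => /orP[/eqP jk|jk].
  have -> : j = i by apply: val_inj.
  have E : refl (u y + w y) *m h y *m e i = - w y.
    have := @refl_swap (u y) (- w y); rewrite opprK -mulmxA; apply=> //.
    by rewrite innerNl innerNr opprK uy wy.
  by rewrite -mulmxA E mulmxN refl_self // opprK.
rewrite -!mulmxA hgy // (reflE (u y + w y)) innerDl uj // wj // addr0 mulr0 mul0r scale0r subr0.
by rewrite reflE wj // mulr0 mul0r scale0r subr0.
Qed.

Lemma const_pin_lift (g : 'M[R]_(n + n)) : isom_mx g ->
  exists b s, Pin b s /\ tcovers b s g.
Proof.
move=> ig; have [|b [s [_ _ near_s]]] := @smooth_pin_lift 0 (fun=> g) (smx_cst _ g).
  exact: near_all.
by exists b, (s 0); have [] := nbhs_singleton near_s.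
Qed.

End CartanDieudonne.

Section SpinCriterion.
Variables (R : realType) (n : nat).
Hypotheses (n_gt0 : (0 < n)%N) (n_even : ~~ odd n).
Local Notation N := (fdim n).
Let two_neq0 : (2 : R) != 0. Proof. by rewrite pnatr_eq0. Qed.

Lemma spairing_top (r : 'cV[R]_N) : spairing r (bas R finset.setT) =
  pairing_mx R n (enum_rank finset.set0) (enum_rank finset.setT) * r (enum_rank finset.set0) 0.
Proof.
rewrite spairingE -mulmxA mxE big_fdim (bigD1 finset.set0) //= big1 => [|S S0].
  by rewrite addr0 mul_bas mxE mulrC.
rewrite mul_bas pairing_mxE -finset.setC0 (inj_eq (inv_inj (@finset.setCK _))).
by rewrite eq_sym (negbTE S0) mulr0.
Qed.

Lemma pairing_top_neq0 :
  pairing_mx R n (enum_rank finset.set0) (enum_rank finset.setT) != 0.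
Proof.
by rewrite pairing_mxE finset.setC0 eqxx mulf_neq0 // ?signr_eq0.
Qed.

Lemma Pin_parity b b' (s : 'M[R]_N) (r : 'cV[R]_N) :
  Pin b s -> has_parity b' r -> has_parity (b (+) b') (s *m r).
Proof.
move=> ps br; move: b s ps; apply: Pin_ind => [|v b s _ _ IH]; first by rewrite mul1mx.
by rewrite -mulmxA -addTb -addbA addTb; apply: has_parity_cliff.
Qed.

Lemma form1_parity : has_parity false (form1 R n).
Proof. by move=> S; rewrite basE; have [->|//] := eqVneq S finset.set0; rewrite cards0. Qed.

(* S is a multiple of a lift of g; preserving the pairing of 1 with the top form
   makes the multiple a sign. *)
Lemma Spin_of_covers (S : 'M[R]_N) g d : covers S g -> isom_mx g ->
    (S *m form1 R n) (enum_rank finset.set0) 0 * d = 1 ->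
    S *m bas R finset.setT = d *: bas R finset.setT ->
  Spin S.
Proof.
move=> /coversE Sg ig Sd ST; have [b [s [ps sg]]] := const_pin_lift 0 ig.
have [t [pt ts st]] := Pin_inv ps.
have tS v : t *m S *m cliff v = (-1) ^+ b *: (cliff v *m (t *m S)).
  by rewrite (tcoversM (tcoversV ts ig sg) Sg v) addbF isom_invl // mul1mx.
case: b ps sg pt tS => ps sg pt tS.
  (* An odd lift is impossible: [S] would send 1 to an odd form, whose coefficient at the empty set
     vanishes, against [Sd]. *)
  have [|c tc] := @cliff_twisted_scalar R n (t *m S).
    by move=> v; rewrite tS expr1 scaleN1r.
  have E : S *m form1 R n = c *: (s *m form1 R n).
    by rewrite scalemxAr -tc !mulmxA st mul1mx.
  have := Pin_parity ps form1_parity; rewrite addbF => /(_ finset.set0).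
  rewrite cards0 => /(_ isT) s0; move: Sd; rewrite E mxE s0 mulr0 mul0r => /eqP.
  by rewrite eq_sym oner_eq0.
have [|c tc] := @cliff_scalar R n (t *m S).
  by move=> v; rewrite tS scale1r.
have SE : S = c *: s by rewrite -[S]mul1mx -st -mulmxA tc mul_mx_scalar.
have [e e1 sK] := Pin_pairing n_even ps.
have pE (r r' : 'cV[R]_N) : spairing (s *m r) (s *m r') = e * spairing r r'.
  rewrite !spairingE trmx_mul !mulmxA -(mulmxA _ s^T) -(mulmxA _ (s^T *m _)) sK.
  by rewrite -scalemxAr -scalemxAl mxE.
(* The factors of [S] on 1 and on the top form cancel in the pairing, whereas [c *: s] multiplies it
   by [c^2 e]; hence [c^4 = 1]. *)
have : spairing (S *m form1 R n) (S *m bas R finset.setT) =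
    spairing (form1 R n) (bas R finset.setT).
  rewrite ST spairingZr !spairing_top basE eqxx mulr1.
  by rewrite mulrCA [d * _]mulrC Sd mulr1.
rewrite SE -!scalemxAl spairingZl spairingZr pE !mulrA spairing_top basE eqxx mulr1.
move/eqP; rewrite -subr_eq0 -{2}[pairing_mx _ _ _ _]mul1r -mulrBl mulf_eq0.
rewrite (negbTE pairing_top_neq0) orbF subr_eq0 => /eqP cce.
have c1 : c ^+ 2 = 1.
  have c4 : c ^+ 2 ^+ 2 == 1.
    by have := congr1 (fun z => z * z) cce; rewrite mulrACA e1 !mulr1 -!expr2 => ->.
  move: c4; rewrite sqrf_eq1 => /orP[/eqP //|/eqP c2].
  by have := sqr_ge0 c; rewrite c2 oppr_ge0 ler10.
have Ss : Spin s by apply/SpinE.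
move/eqP: c1; rewrite sqrf_eq1 => /orP[] /eqP ->; first by rewrite scale1r.
by rewrite scaleN1r; apply: SpinN.
Qed.

Lemma bfield_Spin (beta : 'M[R]_n) : beta^T = - beta -> Spin (bfield_spin beta).
Proof.
move=> ba; apply: (Spin_of_covers (bfield_covers ba n_gt0) (bfield_isom ba) (d := 1)).
  by rewrite bfield_form1 mulr1.
by rewrite bfield_top scale1r.
Qed.

Lemma gl_Spin (A : 'M[R]_n) : 0 < \det A -> Spin (gl_spin A).
Proof.
move=> dA; apply: (Spin_of_covers (gl_covers dA) (gl_isom dA) (d := (Num.sqrt (\det A))^-1)).
  by rewrite gl_form1 mxE basE eqxx mulr1 divff // sqrtr_eq0 -ltNge.
exact: gl_top.
Qed.

End SpinCriterion.

(** * Linear complex structures and their spinors *)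

Section ComplexStructures.
Variables (F : fieldType) (n : nat) (ii : F).
Hypotheses (two_neq0 : (2 : F) != 0) (ii_sqr : ii * ii = -1).
Local Notation N := (fdim n).
Implicit Types (J g : 'M[F]_(n + n)) (rho : 'cV[F]_N) (v w : 'cV[F]_(n + n)).

Definition complex_structure J := isom_mx J /\ J *m J = - 1%:M.

Definition eigen_kills c J rho := forall v, J *m v = c *: v -> cliff v *m rho = 0.

Section Fixed.
Variables (J : 'M[F]_(n + n)).
Hypotheses (csJ : complex_structure J).

Let JJ v : J *m (J *m v) = - v.
Proof. by rewrite mulmxA csJ.2 mulNmx mul1mx. Qed.

Definition holo v := 2^-1 *: (v - ii *: (J *m v)).
Definition antiholo v := 2^-1 *: (v + ii *: (J *m v)).

Let half v : 2^-1 *: (v + v) = v.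
Proof. by rewrite -mulr2n -[v *+ 2]scaler_nat scalerA mulVf // scale1r. Qed.

Lemma holo_antiholo v : v = holo v + antiholo v.
Proof. by rewrite /holo /antiholo -scalerDr addrACA addNr addr0 half. Qed.

Lemma holoE v : J *m holo v = ii *: holo v.
Proof.
rewrite /holo -scalemxAr scalerA mulrC -scalerA; congr (_ *: _).
by rewrite mulmxBr -scalemxAr JJ scalerBr scalerA ii_sqr scaleN1r scalerN !opprK addrC.
Qed.

Lemma antiholoE v : J *m antiholo v = - ii *: antiholo v.
Proof.
rewrite /antiholo -scalemxAr scalerA mulrC -scalerA; congr (_ *: _).
rewrite mulmxDr -scalemxAr JJ scalerDr scalerA mulNr ii_sqr opprK scale1r.
by rewrite scalerN scaleNr addrC.
Qed.

Lemma eigen_isotropic c v w : c * c = -1 -> J *m v = c *: v -> J *m w = c *: w ->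
  inner v w = 0.
Proof.
move=> cc Jv Jw; have := csJ.1 v w.
rewrite Jv Jw innerZl innerZr mulrA cc mulN1r => /eqP.
by rewrite eq_sym -addr_eq0 -mulr2n -mulr_natl mulf_eq0 (negbTE two_neq0) => /eqP.
Qed.

Let ii_sqrN : - ii * - ii = -1. Proof. by rewrite mulrNN. Qed.

Section Annihilator.
Variable rho : 'cV[F]_N.
Hypotheses (Jrho : eigen_kills ii J rho) (rho0 : rho != 0).

(** Equality without counting dimensions: the [- ii] component of an annihilating vector also kills
    [rho]. The Clifford relation makes it orthogonal to the [ii]-eigenspace and isotropy makes it
    orthogonal to its own, so it vanishes. *)
Lemma killsE : [set v | J *m v = ii *: v] = annihilator rho.
Proof.
apply/seteqP; split=> v /=; first exact: Jrho.
move=> vr; have hv : cliff (holo v) *m rho = 0 by apply: Jrho; apply: holoE.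
have vr0 : cliff v *m rho = 0 by exact: vr.
have av : cliff (antiholo v) *m rho = 0.
  by move: vr0; rewrite {1}(holo_antiholo v) linearD mulmxDl hv add0r.
suff a0 : antiholo v = 0 by rewrite (holo_antiholo v) a0 addr0 holoE.
apply: (inner_nondeg two_neq0) => w; rewrite (holo_antiholo w) innerDr.
rewrite (eigen_isotropic ii_sqrN (antiholoE v) (antiholoE w)) addr0.
have := clifford two_neq0 (antiholo v) (holo w).
move/(congr1 (mulmx^~ rho)); rewrite mulmxDl -!mulmxA av (Jrho (holoE w)) !mulmx0 addr0.
rewrite mul_scalar_mx => /esym/eqP; rewrite scaler_eq0 (negbTE rho0) orbF oppr_eq0.
by rewrite mulf_eq0 (negbTE two_neq0) => /eqP.
Qed.

Lemma kills_pure : pure rho.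
Proof.
rewrite /pure -killsE; split=> [v w /= Jv Jw|U WU Ui v /= vU].
  exact: eigen_isotropic ii_sqr Jv Jw.
have hU u : holo u \in U by apply: WU; rewrite /= holoE.
have aU : antiholo v \in U.
  have -> : antiholo v = v - holo v by rewrite {2}(holo_antiholo v) addrC addKr.
  by rewrite rpredB.
suff a0 : antiholo v = 0 by rewrite (holo_antiholo v) a0 addr0 holoE.
apply: (inner_nondeg two_neq0) => w; rewrite (holo_antiholo w) innerDr.
by rewrite (eigen_isotropic ii_sqrN (antiholoE v) (antiholoE w)) addr0 Ui //= hU.
Qed.

Hypothesis n_even : ~~ odd n.
Variable tau : 'cV[F]_N.
Hypothesis Jtau : eigen_kills (- ii) J tau.
Hypothesis pair_neq0 : spairing rho tau != 0.

(** Only the [- ii] component of [w] acts on [rho]. Moving it past [v] produces the inner product;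
    the remaining term vanishes because that component is self-adjoint for the pairing and kills
    [tau]. *)
Lemma inner_JE v w : inner v w + ii * inner v (J *m w) =
  - (spairing (cliff v *m (cliff w *m rho)) tau / spairing rho tau).
Proof.
have wr : cliff w *m rho = cliff (antiholo w) *m rho.
  by rewrite {1}(holo_antiholo w) linearD mulmxDl (Jrho (holoE _)) add0r.
have E : spairing (cliff v *m (cliff w *m rho)) tau =
   - (2 * inner v (antiholo w)) * spairing rho tau.
  rewrite wr mulmxA; have /(canRL (addrK _)) -> := clifford two_neq0 v (antiholo w).
  rewrite mulmxBl mul_scalar_mx -mulmxA.
  rewrite spairingDl -scaleN1r !spairingZl spairing_cliff // (Jtau (antiholoE w)).
  by rewrite [in X in _ + _ * X]spairingE mulmx0 mxE mulr0 addr0.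
by rewrite E mulfK // opprK /antiholo innerZr mulrA mulfV // mul1r innerDr innerZr.
Qed.

End Annihilator.
End Fixed.

Lemma complex_structure_conj J g : complex_structure J -> isom_mx g ->
  complex_structure (g *m J *m isom_inv g).
Proof.
move=> [iJ JJ] ig; split; first by apply: isom_mxM; [apply: isom_mxM|apply: isom_mxV].
have E : isom_inv g *m g = 1%:M by apply: isom_invl.
have E' : g *m isom_inv g = 1%:M by apply: isom_invr.
move: (isom_inv g) E E' => h E E'; rewrite !mulmxA -(mulmxA _ h g) E mulmx1 -(mulmxA g) JJ.
by rewrite mulmxN mulmx1 mulNmx E'.
Qed.

Lemma kills_transport c e J rho s g : e * e = 1 -> eigen_kills c J rho -> isom_mx g ->
    (forall v, s *m cliff v = e *: (cliff (g *m v) *m s)) ->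
  eigen_kills c (g *m J *m isom_inv g) (s *m rho).
Proof.
move=> ee Jr ig sg v Jv; pose w := isom_inv g *m v.
have vE : v = g *m w by rewrite /w mulmxA isom_invr // mul1mx.
have wJ : J *m w = c *: w.
  apply: (can_inj (mulKmx (isom_unit two_neq0 ig))).
  by rewrite -scalemxAr -vE -Jv -(mulmxA _ (isom_inv g)) -mulmxA.
rewrite vE mulmxA; have := congr1 (fun x => e *: (x *m rho)) (sg w).
by rewrite -!scalemxAl scalerA ee scale1r => <-; rewrite -mulmxA (Jr _ wJ) mulmx0 scaler0.
Qed.

End ComplexStructures.

Section ComplexStructureUniqueness.
Variables (F : fieldType) (n : nat) (ii : F).
Hypotheses (two_neq0 : (2 : F) != 0) (ii_sqr : ii * ii = -1).
Implicit Types (J : 'M[F]_(n + n)).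

(** [rho] determines the [ii]-eigenspace and [tau] the [- ii]-eigenspace, and these two span. *)
Lemma complex_structure_uniq J J' (rho tau : 'cV[F]_(fdim n)) :
  complex_structure J -> complex_structure J' ->
  eigen_kills ii J rho -> eigen_kills ii J' rho -> rho != 0 ->
  eigen_kills (- ii) J tau -> eigen_kills (- ii) J' tau -> tau != 0 -> J = J'.
Proof.
move=> cJ cJ' Jr Jr' r0 Jt Jt' t0.
have ii_sqrN : - ii * - ii = -1 by rewrite mulrNN.
have E := etrans (killsE two_neq0 ii_sqr cJ Jr r0) (esym (killsE two_neq0 ii_sqr cJ' Jr' r0)).
have E' := etrans (killsE two_neq0 ii_sqrN cJ Jt t0)
  (esym (killsE two_neq0 ii_sqrN cJ' Jt' t0)).
have JE (v : 'cV[F]_(n + n)) : J *m v = J' *m v.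
  have h1 : J' *m holo ii J v = ii *: holo ii J v.
    have : [set v | J *m v = ii *: v] (holo ii J v) by rewrite /= holoE.
    by rewrite E.
  have h2 : J' *m antiholo ii J v = - ii *: antiholo ii J v.
    have : [set v | J *m v = - ii *: v] (antiholo ii J v) by rewrite /= antiholoE.
    by rewrite E'.
  rewrite {2}(holo_antiholo ii two_neq0 J v) mulmxDr h1 h2 -holoE // -antiholoE //.
  by rewrite -mulmxDr -holo_antiholo.
by apply/matrixP => i j; have /matrixP /(_ i 0) := JE (delta_mx j 0); rewrite -!colE !mxE.
Qed.

End ComplexStructureUniqueness.

Section PolarVectors.
Variables (F : fieldType) (n : nat).
Hypothesis two_neq0 : (2 : F) != 0.
Implicit Types X Y : 'cV[F]_n.

(** The images of [pv] and [qv] are, over the reals, the model subspaces V^+ and V^-, on which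
    [split_mx] acts blockwise. *)
Definition pv X : 'cV[F]_(n + n) := col_mx X X.
Definition qv X : 'cV[F]_(n + n) := col_mx X (- X).

Lemma pvD X Y : pv (X + Y) = pv X + pv Y. Proof. by rewrite /pv add_col_mx. Qed.
Lemma qvD X Y : qv (X + Y) = qv X + qv Y. Proof. by rewrite /qv add_col_mx opprD. Qed.
Lemma pvZ c X : pv (c *: X) = c *: pv X. Proof. by rewrite /pv scale_col_mx. Qed.
Lemma qvZ c X : qv (c *: X) = c *: qv X. Proof. by rewrite /qv scale_col_mx scalerN. Qed.

Lemma polarE X Y : polar F n *m col_mx X Y = pv X + qv Y.
Proof. by rewrite /polar mul_block_col !mul1mx mulNmx mul1mx /pv /qv add_col_mx. Qed.

Lemma pv_qv_span (v : 'cV[F]_(n + n)) : exists X Y, v = pv X + qv Y.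
Proof.
exists (usubmx (invmx (polar F n) *m v)), (dsubmx (invmx (polar F n) *m v)).
by rewrite -polarE vsubmxK mulKVmx // polar_unit.
Qed.

Lemma inner_pv_pv X Y : inner (pv X) (pv Y) = (X^T *m Y) 0 0.
Proof.
rewrite innerE !col_mxKu !col_mxKd.
under eq_bigr => i _ do rewrite -mulr2n -mulr_natl.
rewrite -mulr_sumr mulKf // mxE; apply: eq_bigr => i _; by rewrite mxE.
Qed.

Lemma inner_qv_qv X Y : inner (qv X) (qv Y) = - (X^T *m Y) 0 0.
Proof.
rewrite innerE !col_mxKu !col_mxKd.
under eq_bigr => i _ do rewrite [(- Y) _ _]mxE [(- X) _ _]mxE mulrN mulNr -mulr2n mulNrn -mulr_natl.
rewrite sumrN -mulr_sumr mulrN mulKf // mxE; congr (- _); apply: eq_bigr => i _; by rewrite mxE.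
Qed.

Lemma inner_pv_qv X Y : inner (pv X) (qv Y) = 0.
Proof.
rewrite innerE !col_mxKu !col_mxKd big1 ?mulr0 // => i _.
by rewrite [(- Y) _ _]mxE mulrN addNr.
Qed.

Definition split_mx (A B : 'M[F]_n) : 'M[F]_(n + n) :=
  2^-1 *: block_mx (A + B) (A - B) (A - B) (A + B).

Lemma split_mx_pv A B X : split_mx A B *m pv X = pv (A *m X).
Proof.
rewrite /split_mx /pv -scalemxAl mul_block_col !mulmxDl !mulNmx scale_col_mx.
have half (Z : 'cV[F]_n) : 2^-1 *: (Z + Z) = Z.
  by rewrite -mulr2n -[Z *+ 2]scaler_nat scalerA mulVf // scale1r.
by rewrite addrACA subrr addr0 half [X in col_mx _ (_ *: X)]addrC addrACA subrr addr0 half.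
Qed.

Lemma split_mx_qv A B X : split_mx A B *m qv X = qv (B *m X).
Proof.
rewrite /split_mx /qv -scalemxAl mul_block_col !mulmxN !mulmxDl !mulNmx scale_col_mx.
have half (Z : 'cV[F]_n) : 2^-1 *: (Z + Z) = Z.
  by rewrite -mulr2n -[Z *+ 2]scaler_nat scalerA mulVf // scale1r.
rewrite opprB [B *m X - _]addrC addrACA subrr add0r half.
by rewrite opprD addrACA subrr add0r -opprD scalerN half.
Qed.

Lemma split_mx_ext (A B : 'M[F]_(n + n)) :
  (forall X, A *m pv X = B *m pv X) -> (forall X, A *m qv X = B *m qv X) -> A = B.
Proof.
move=> Ep Eq; apply/matrixP => i j.
have [X [Y E]] := pv_qv_span (delta_mx j 0).
have : A *m (pv X + qv Y) = B *m (pv X + qv Y) by rewrite !mulmxDr Ep Eq.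
by rewrite -E -!colE => /matrixP /(_ i 0); rewrite !mxE.
Qed.

Lemma split_mxM A B A' B' : split_mx A B *m split_mx A' B' = split_mx (A *m A') (B *m B').
Proof.
by apply: split_mx_ext => X; rewrite -mulmxA !(split_mx_pv, split_mx_qv) mulmxA.
Qed.

Lemma split_mx1 : split_mx 1%:M 1%:M = 1%:M.
Proof. by apply: split_mx_ext => X; rewrite !(split_mx_pv, split_mx_qv) !mul1mx. Qed.

Lemma split_mxN A B : split_mx (- A) (- B) = - split_mx A B.
Proof. by rewrite /split_mx -scalerN opp_block_mx !opprD. Qed.

Lemma split_mx_isom A B : A^T *m A = 1%:M -> B^T *m B = 1%:M -> isom_mx (split_mx A B).
Proof.
move=> AA BB v w; have [X [Y ->]] := pv_qv_span v; have [Z [T ->]] := pv_qv_span w.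
rewrite !mulmxDr !split_mx_pv !split_mx_qv !innerDl !innerDr.
rewrite !inner_pv_pv !inner_qv_qv !inner_pv_qv !(innerC (qv _) (pv _)) !inner_pv_qv.
by rewrite !trmx_mul !mulmxA -(mulmxA X^T) -(mulmxA Y^T) AA BB !mulmx1.
Qed.

Lemma split_mx_isomE A B : isom_mx (split_mx A B) -> A^T *m A = 1%:M /\ B^T *m B = 1%:M.
Proof.
move=> iAB; split; apply: form_mx_eq => v w.
  by have := iAB (pv v) (pv w); rewrite !split_mx_pv !inner_pv_pv trmx_mul mulmx1 !mulmxA.
have := iAB (qv v) (qv w); rewrite !split_mx_qv !inner_qv_qv trmx_mul mulmx1 !mulmxA.
exact: oppr_inj.
Qed.

Lemma split_mx_inj A B A' B' : split_mx A B = split_mx A' B' -> A = A' /\ B = B'.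
Proof.
move=> E; split; apply/matrixP => i j.
  have := congr1 (fun M => M *m pv (delta_mx j 0)) E; rewrite !split_mx_pv -!colE.
  by move/eq_col_mx => [/matrixP /(_ i 0) + _]; rewrite !mxE.
have := congr1 (fun M => M *m qv (delta_mx j 0)) E; rewrite !split_mx_qv -!colE.
by move/eq_col_mx => [/matrixP /(_ i 0) + _]; rewrite !mxE.
Qed.

(** A map commuting with the model metric preserves its two eigenspaces. The blocks are assembled
    column by column from chosen values. *)
Lemma split_mx_commute g : g *m split_mx 1%:M (- 1%:M) = split_mx 1%:M (- 1%:M) *m g ->
  exists A B, g = split_mx A B.
Proof.
move=> gE; pose S := split_mx 1%:M (- 1%:M).
have fixp v : S *m v = v -> exists X, v = pv X.
  have [X [Y ->]] := pv_qv_span v; rewrite mulmxDr split_mx_pv split_mx_qv mul1mx mulNmx mul1mx.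
  move/addrI => E; exists X; suff -> : qv Y = 0 by rewrite addr0.
  have : 2 *: qv Y = 0 by rewrite scaler_nat mulr2n -{1}E -qvD addNr /qv oppr0 col_mx0.
  by move/eqP; rewrite scaler_eq0 (negbTE two_neq0) => /eqP.
have fixq v : S *m v = - v -> exists X, v = qv X.
  have [X [Y ->]] := pv_qv_span v; rewrite mulmxDr split_mx_pv split_mx_qv mul1mx mulNmx mul1mx.
  rewrite opprD (_ : qv (- Y) = - qv Y) => [/addIr E|]; last by rewrite -scaleN1r qvZ scaleN1r.
  exists Y; suff -> : pv X = 0 by rewrite add0r.
  have : 2 *: pv X = 0 by rewrite scaler_nat mulr2n {1}E addNr.
  by move/eqP; rewrite scaler_eq0 (negbTE two_neq0) => /eqP.
have gp X : exists Z, g *m pv X = pv Z.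
  by apply: fixp; rewrite mulmxA -gE -mulmxA split_mx_pv mul1mx.
have gq X : exists Z, g *m qv X = qv Z.
  apply: fixq; rewrite mulmxA -gE -mulmxA split_mx_qv mulNmx mul1mx.
  by rewrite -(scaleN1r X) qvZ -scalemxAr scaleN1r.
have [A AE] := choice gp; have [B BE] := choice gq.
pose AM := \matrix_(i, j) A (delta_mx j 0) i 0; pose BM := \matrix_(i, j) B (delta_mx j 0) i 0.
exists AM, BM.
have sum_delta (X : 'cV[F]_n) : X = \sum_j X j 0 *: delta_mx j 0.
  by rewrite {1}[X]matrix_sum_delta; apply: eq_bigr => j _; rewrite big_ord1.
have linp (f : 'cV[F]_n -> 'cV[F]_(n + n)) (M1 M2 : 'M[F]_(n + n)) :
    (forall X Y, f (X + Y) = f X + f Y) -> (forall c X, f (c *: X) = c *: f X) ->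
    (forall j, M1 *m f (delta_mx j 0) = M2 *m f (delta_mx j 0)) ->
    forall X, M1 *m f X = M2 *m f X.
  move=> fD fZ fE X; rewrite (sum_delta X).
  have f0 : f 0 = 0 by rewrite -(scale0r 0) fZ scale0r.
  have -> : f (\sum_j X j 0 *: delta_mx j 0) = \sum_j X j 0 *: f (delta_mx j 0).
    by rewrite (big_morph f fD f0); apply: eq_bigr => j _; rewrite fZ.
  by rewrite !mulmx_sumr; apply: eq_bigr => j _; rewrite -!scalemxAr fE.
apply: split_mx_ext.
  apply: linp => [|c X|j]; [exact: pvD|exact: pvZ|].
  rewrite AE split_mx_pv -colE; congr pv; apply/matrixP => i k.
  by rewrite (ord1 k) !mxE.
apply: linp => [|c X|j]; [exact: qvD|exact: qvZ|].
rewrite BE split_mx_qv -colE; congr qv; apply/matrixP => i k.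
by rewrite (ord1 k) !mxE.
Qed.

End PolarVectors.

(** * Gamma matrices, bispinors and the model structures *)

Section Gammas.
Variables (F : fieldType) (m : nat) (ii : F).
Hypotheses (two_neq0 : (2 : F) != 0) (ii_sqr : ii * ii = -1).
Implicit Types (i j : 'I_(m + m)) (k l : 'I_m) (S T : {set 'I_(m + m)}).

Definition gamma i : 'M[F]_(fdim m) :=
  match fintype.split i with
  | inl k => ext F k - ctr F k
  | inr k => ii *: (ext F k + ctr F k)
  end.

(** The vector whose Clifford multiplication is [gamma i], in half the dimension; the factor [- ii]
    turns the norm -1 of [qv] into 1. *)
Definition gvec i : 'cV[F]_(m + m) :=
  match fintype.split i with
  | inl k => pv (delta_mx k 0)
  | inr k => - ii *: qv (delta_mx k 0)
  end.

Lemma gammaE i : gamma i = cliff (gvec i).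
Proof.
have E (x y : 'cV[F]_m) : col_mx x y = col_mx x 0 + col_mx 0 y.
  by rewrite add_col_mx addr0 add0r.
rewrite /gamma /gvec; case: fintype.split => k.
  by rewrite /pv E cliffD cliff_ctr cliff_ext addrC.
rewrite /qv cliffZ E cliffD cliff_ctr -[X in _ + cliff X]opprK opp_col_mx opprK oppr0.
rewrite -(scaleN1r (col_mx _ _)) cliffZ cliff_ext scaleN1r.
by rewrite scaleNr -scalerN opprD !opprK addrC.
Qed.

Lemma inner_gvec i j : inner (gvec i) (gvec j) = (i == j)%:R.
Proof.
have dd k l : ((delta_mx k 0 : 'cV[F]_m)^T *m (delta_mx l 0 : 'cV[F]_m)) 0 0 = (k == l)%:R.
  by rewrite -colE !mxE eqxx andbT eq_sym.
rewrite /gvec -{2}(splitK i) -{2}(splitK j).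
case: (fintype.split i) => k; case: (fintype.split j) => l /=.
- by rewrite inner_pv_pv // dd (inj_eq (@lshift_inj _ _)).
- by rewrite innerZr inner_pv_qv // mulr0 eq_lrshift.
- by rewrite innerZl innerC inner_pv_qv // mulr0 eq_rlshift.
rewrite innerZl innerZr inner_qv_qv // dd (inj_eq (@rshift_inj _ _)).
by rewrite mulrA mulrNN ii_sqr mulrNN mul1r.
Qed.

Lemma gamma_acom i j : gamma i *m gamma j + gamma j *m gamma i = (- (2 * (i == j)%:R))%:M.
Proof. by rewrite !gammaE clifford // inner_gvec. Qed.

Lemma gamma_anti i j : i != j -> gamma i *m gamma j = - (gamma j *m gamma i).
Proof.
move=> ij; apply/eqP; rewrite -addr_eq0 gamma_acom (negbTE ij) mulr0 oppr0.
by rewrite raddf0.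
Qed.

Lemma gamma_sqr i : gamma i *m gamma i = - 1%:M.
Proof. by rewrite gammaE cliff_sqr // inner_gvec eqxx raddfN. Qed.

Definition gprod S : 'M[F]_(fdim m) := \prod_(i <- enum S) gamma i.

Lemma signmx p (X : 'M[F]_(fdim m)) : (-1) ^+ p * X = (-1) ^+ p *: X.
Proof.
by rewrite -signr_odd -[in RHS]signr_odd; case: odd;
  rewrite ?expr1 ?expr0 ?scale1r ?mul1r // mulN1r scaleN1r.
Qed.

Lemma gamma_gprod i S : gamma i *m gprod S =
  if i \in S then - sg F i (S :\ i) *: gprod (S :\ i) else sg F i S *: gprod (i |: S).
Proof.
have out T : i \notin T -> gamma i *m gprod T = sg F i T *: gprod (i |: T).
  by move=> iT; have := mul_prod_enum gamma_anti iT; rewrite signmx; apply.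
case: ifPn => iS; last exact: out.
have iSi : i \notin S :\ i by rewrite !inE eqxx.
have E : gprod S = sg F i (S :\ i) *: (gamma i *m gprod (S :\ i)).
  by rewrite out // scalerA sg_sqr scale1r finset.setD1K.
by rewrite {1}E -scalemxAr mulmxA gamma_sqr mulNmx mul1mx scalerN scaleNr.
Qed.

Lemma gprod_gamma i S : gprod S *m gamma i = (-1) ^+ #|S| *:
  if i \in S then sg F i (S :\ i) *: gprod (S :\ i) else sg F i S *: gprod (i |: S).
Proof.
have out T : i \notin T -> gprod T *m gamma i = (-1) ^+ #|T| *: (gamma i *m gprod T).
  by move=> iT; have := prod_enum_mul gamma_anti iT; rewrite signmx; apply.
case: ifPn => iS; last by rewrite out // gamma_gprod (negbTE iS).
have iSi : i \notin S :\ i by rewrite !inE eqxx.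
have E : gprod S = sg F i (S :\ i) *: (gamma i *m gprod (S :\ i)).
  by rewrite gamma_gprod (negbTE iSi) scalerA sg_sqr scale1r finset.setD1K.
rewrite {1}E -scalemxAl -mulmxA out // -scalemxAr mulmxA gamma_sqr mulNmx mul1mx.
rewrite !scalerA (cardsD1 i S) iS add1n exprS mulN1r scalerN -scaleNr.
by congr (_ *: _); rewrite mulNr mulrC.
Qed.

(* fierz with its charge conjugations removed: the e^S-coefficient is u gamma_S w *)
Definition fz (u : 'rV[F]_(fdim m)) (w : 'cV[F]_(fdim m)) : 'cV[F]_(fdim (m + m)) :=
  \col_s (u *m ((\prod_(i <- enum (enum_val s : {set 'I_(m + m)})) gamma i) *m w)) 0 0.

Lemma fzE u w S : fz u w (enum_rank S) 0 = (u *m (gprod S *m w)) 0 0.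
Proof. by rewrite mxE enum_rankK. Qed.

(** On bispinors the model of V^+ acts through the left factor. [ext_ctr_fz_right] is the
    counterpart for V^- and the right factor, with a sign depending on the degree. *)
Lemma ext_ctr_fz u w i : (ext F i - ctr F i) *m fz u w = - fz (u *m gamma i) w.
Proof.
apply: form_ext => S q; rewrite (ord1 q) mulmxBl [LHS]mxE [X in _ + X]mxE [RHS]mxE.
rewrite ext_coord ctr_coord !fzE -mulmxA [gamma i *m _]mulmxA gamma_gprod.
case: ifP => _; rewrite -scalemxAl -scalemxAr [in RHS]mxE.
  by rewrite subr0 mulNr opprK.
by rewrite sub0r.
Qed.

Lemma ext_ctr_fz_right u w i S : ((ext F i + ctr F i) *m fz u w) (enum_rank S) 0 =
  (-1) ^+ #|S| * fz u (gamma i *m w) (enum_rank S) 0.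
Proof.
rewrite mulmxDl mxE ext_coord ctr_coord !fzE [gprod S *m _]mulmxA gprod_gamma.
have sq : (-1) ^+ #|S| * (-1) ^+ #|S| = 1 :> F by rewrite -expr2 sqrr_sign.
by case: ifP => _; rewrite -!scalemxAl -!scalemxAr [in RHS]mxE mulrA sq mul1r [in RHS]mxE ?addr0 ?add0r.
Qed.

Definition gvect (c : 'cV[F]_(m + m)) := \sum_i c i 0 *: gamma i.

Lemma cliff_pv_fz c u w : u *m gvect c = 0 -> cliff (pv c) *m fz u w = 0.
Proof.
move=> uc; rewrite /cliff.
under eq_bigr => i _ do rewrite col_mxKu col_mxKd -scalerBr.
rewrite mulmx_suml.
under eq_bigr => i _ do rewrite -scalemxAl ext_ctr_fz.
apply: form_ext => S q; rewrite (ord1 q) summxE [RHS]mxE.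
transitivity (- ((u *m gvect c) *m (gprod S *m w)) 0 0); last by rewrite uc mul0mx mxE oppr0.
rewrite mulmx_sumr mulmx_suml summxE -sumrN; apply: eq_bigr => i _.
by rewrite [LHS]mxE [X in _ * X]mxE fzE -scalemxAr -scalemxAl [in RHS]mxE mulrN.
Qed.

Lemma cliff_qv_fz c u w : gvect c *m w = 0 -> cliff (qv c) *m fz u w = 0.
Proof.
move=> cw; rewrite /cliff.
under eq_bigr => i _ do rewrite col_mxKu col_mxKd [(- c) _ _]mxE scaleNr -opprD -scalerDr.
rewrite mulmx_suml.
under eq_bigr => i _ do rewrite mulNmx -scalemxAl.
apply: form_ext => S q; rewrite (ord1 q) summxE [RHS]mxE.
transitivity (- ((-1) ^+ #|S| * (u *m (gprod S *m (gvect c *m w))) 0 0)); last first.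
  by rewrite cw !mulmx0 mxE mulr0 oppr0.
rewrite mulmx_suml !mulmx_sumr summxE mulr_sumr -sumrN; apply: eq_bigr => i _.
rewrite [LHS]mxE [X in - X]mxE ext_ctr_fz_right fzE -scalemxAl -!scalemxAr [in RHS]mxE.
by congr (- _); rewrite mulrCA.
Qed.

Lemma fz_parity u w b b' : has_parity b u^T -> has_parity b' w ->
  has_parity (b (+) b') (fz u w).
Proof.
move=> bu bw S; rewrite fzE.
have gw : has_parity (odd #|S| (+) b') (gprod S *m w).
  rewrite /gprod cardE; elim: (enum S) => [|i l IH]; first by rewrite big_nil mul1mx.
  rewrite big_cons -mulmxA gammaE /= -addTb -addbA addTb; exact: has_parity_cliff.
move=> Sb; rewrite mxE big_fdim big1 // => T _.
have [bT|bT] := eqVneq (odd #|T|) b.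
  rewrite gw ?mulr0 // bT; move: Sb; case: (odd _); case: (b); case: (b') => //.
by have := bu T bT; rewrite mxE => ->; rewrite mul0r.
Qed.

(** If [fz u w] vanished, so would [fz (u *m gamma i) w] by [ext_ctr_fz], and hence every product of
    [u], a word in the gammas and [w], whether the word is sorted or not. *)
Lemma fz_neq0 u w (l : seq 'I_(m + m)) :
  (u *m ((\prod_(i <- l) gamma i) *m w)) 0 0 != 0 -> fz u w != 0.
Proof.
move=> nz; apply: contraNneq nz => f0.
suff E : fz (u *m \prod_(i <- l) gamma i) w = 0.
  have := fzE (u *m \prod_(i <- l) gamma i) w finset.set0.
  by rewrite E mxE /gprod enum_set0 big_nil mul1mx -mulmxA => <-.
elim: l u f0 => [|i l IH] u f0; first by rewrite big_nil mulmx1.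
rewrite big_cons mulmxA; apply: IH.
by apply: oppr_inj; rewrite -ext_ctr_fz f0 mulmx0 oppr0.
Qed.

Definition chir : 'M[F]_(fdim m) := \prod_(k < m) gamma (lshift m k).

(** Each gamma acts as [ext k] here, because contraction by a direction that does not yet occur in
    the form vanishes. *)
Lemma chir_form1 : chir *m form1 F m = bas F finset.setT.
Proof.
have -> : bas F finset.setT = (\prod_(k < m) ext F k) *m form1 F m.
  by rewrite -prod_ext prod_enum_setT.
rewrite /chir [index_enum _]unlock -enumT.
elim: (enum 'I_m) (enum_uniq 'I_m) => [|k l IH]; first by rewrite !big_nil.
rewrite cons_uniq => /andP[kl ul]; rewrite !big_cons -!mulmxA IH //.
rewrite /gamma; have -> : fintype.split (lshift m k) = inl k.
  by have := unsplitK (inl k : 'I_m + 'I_m).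
rewrite mulmxBl (_ : ctr F k *m _ = 0) ?subr0 //.
elim: l kl {IH ul} => [|j l IH]; first by rewrite big_nil mul1mx ctr_form1.
rewrite inE negb_or => /andP[kj kl]; rewrite big_cons -mulmxA mulmxA.
have /(canRL (addrK _)) E : ctr F k *m ext F j + ext F j *m ctr F k = ((k == j)%:R)%:M by exact: ctr_ext.
rewrite E (negbTE kj) -scalemx1 scale0r sub0r.
by rewrite mulNmx -mulmxA IH // mulmx0 oppr0.
Qed.

Lemma chir_sqr : exists2 e : F, e * e = 1 & chir *m chir = e%:M.
Proof.
rewrite /chir [index_enum _]unlock -enumT.
elim: (enum 'I_m) (enum_uniq 'I_m) => [|k l IH].
  by exists 1; rewrite ?mulr1 // big_nil mulmx1.
rewrite cons_uniq => /andP[kl /IH[e e1 lE]]; rewrite big_cons.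
move: lE; set P := \prod_(j <- l) _ => lE.
have [d d1 Pk] : exists2 d : F, d * d = 1 & P *m gamma (lshift m k) = d *: (gamma (lshift m k) *m P).
  rewrite /P; elim: l kl {IH lE P} => [_|j l IH].
    by exists 1; rewrite ?mulr1 // big_nil mulmx1 mul1mx scale1r.
  rewrite inE negb_or => /andP[kj /IH[d d1 lE]]; exists (- d); first by rewrite mulrNN.
  rewrite big_cons -mulmxA lE -scalemxAr !mulmxA gamma_anti; last first.
    by rewrite (inj_eq (@lshift_inj _ _)).
  by rewrite mulNmx scalerN scaleNr opprK.
exists (- (d * e)); first by rewrite mulrNN mulrACA d1 e1 mulr1.
rewrite -mulmxE -mulmxA [P *m (_ *m _)]mulmxA Pk -scalemxAl -mulmxA lE -scalemxAr mulmxA gamma_sqr.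
by rewrite mulNmx mul1mx scalerN scale_scalar_mx raddfN.
Qed.

(** For [s] equal to 1 or -1, an eigenvector of [Imx] with eigenvalue [- s * ii]. *)
Definition zv (s : F) k : 'cV[F]_(m + m) :=
  col_mx (delta_mx k 0) ((s * ii) *: delta_mx k 0).

Lemma gvect_zv s k : gvect (zv s k) = (1 - s) *: ext F k - (1 + s) *: ctr F k.
Proof.
rewrite /gvect big_split_ord /= (bigD1 k) //= big1 => [|j jk]; last first.
  by rewrite col_mxEu !mxE (negbTE jk) scale0r.
rewrite addr0 (bigD1 k) //= big1 => [|j jk]; last first.
  by rewrite col_mxEd !mxE (negbTE jk) mulr0 scale0r.
rewrite addr0 col_mxEu col_mxEd !mxE !eqxx mulr1 scale1r /gamma.
have -> : fintype.split (lshift m k) = inl k by have := unsplitK (inl k : 'I_m + 'I_m).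
have -> : fintype.split (rshift m k) = inr k by have := unsplitK (inr k : 'I_m + 'I_m).
rewrite scalerA -mulrA ii_sqr mulrN1 scaleNr scalerDr !scalerDl !scale1r scaleNr !opprD.
by rewrite addrACA.
Qed.

(* avec t spans the +ii-eigenspace of J_t below: t = 1 is the model of rho_1,
   t = -1 the model of rho_0. *)
Definition avec (t : F) i : 'cV[F]_((m + m) + (m + m)) :=
  match fintype.split i with inl k => pv (zv 1 k) | inr k => qv (zv t k) end.

(** Basis of the [- ii]-eigenspace dual to [avec]. The constant comes from the product 2 of [zv 1 k]
    with [zv (-1) k] and the factor -2 of the Clifford relation; its sign changes with that of the
    metric on V^-. *)
Definition bvec (t : F) i : 'cV[F]_((m + m) + (m + m)) :=
  match fintype.split i with
  | inl k => - 4^-1 *: pv (zv (-1) k)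
  | inr k => 4^-1 *: qv (zv (- t) k)
  end.

Lemma zv_dot s s' k l : ((zv s k)^T *m zv s' l) 0 0 = (1 - s * s') * (k == l)%:R.
Proof.
have dd : ((delta_mx k 0 : 'cV[F]_m)^T *m (delta_mx l 0 : 'cV[F]_m)) 0 0 = (k == l)%:R.
  by rewrite -colE !mxE eqxx andbT eq_sym.
rewrite /zv tr_col_mx mul_row_col [(_ *: _)^T]linearZ /= -scalemxAl -scalemxAr scalerA.
rewrite mxE [X in _ + X]mxE dd mulrACA ii_sqr mulrN1.
by rewrite mulrBl mul1r mulNr.
Qed.

Section Dual.
Variable t : F.
Hypothesis tt : t * t = 1.

Lemma inner_bvec i j : inner (bvec t i) (bvec t j) = 0.
Proof.
rewrite /bvec; case: fintype.split => k; case: fintype.split => l; rewrite innerZl innerZr.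
- by rewrite inner_pv_pv // zv_dot mulrNN mulr1 subrr mul0r !mulr0.
- by rewrite inner_pv_qv // !mulr0.
- by rewrite innerC inner_pv_qv // !mulr0.
by rewrite inner_qv_qv // zv_dot mulrNN tt subrr mul0r oppr0 !mulr0.
Qed.

Lemma inner_avec_bvec i j : - (2 * inner (avec t i) (bvec t j)) = (i == j)%:R.
Proof.
have four : (4 : F) != 0 by rewrite (_ : 4 = 2 * 2) ?mulf_neq0 // -natrM.
rewrite /avec /bvec -{2}(splitK i) -{2}(splitK j).
case: (fintype.split i) => k; case: (fintype.split j) => l /=; rewrite innerZr.
- rewrite inner_pv_pv // zv_dot (inj_eq (@lshift_inj _ _)) mul1r opprK.
  by case: eqP => _; rewrite ?mulr0 ?oppr0 //=; field.
- by rewrite inner_pv_qv // !mulr0 oppr0 eq_lrshift.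
- by rewrite innerC inner_pv_qv // !mulr0 oppr0 eq_rlshift.
rewrite inner_qv_qv // zv_dot (inj_eq (@rshift_inj _ _)) [t * - t]mulrN tt opprK.
by case: eqP => _; rewrite ?mulr0 ?oppr0 ?mulr0 ?oppr0 //=; field.
Qed.

(** [avec] and [bvec] act as annihilation and creation operators, so [killed_line] applies. *)
Lemma avec_line (x y : 'cV[F]_(fdim (m + m))) :
    (forall i, cliff (avec t i) *m x = 0) -> (forall i, cliff (avec t i) *m y = 0) -> x != 0 ->
  exists c, y = c *: x.
Proof.
apply: (killed_line (b := fun i => cliff (bvec t i))) => [i j|i j|i].
- by rewrite clifford // inner_avec_bvec.
- by apply/eqP; rewrite -addr_eq0 clifford // inner_bvec mulr0 oppr0 raddf0.
- by rewrite cliff_sqr // inner_bvec oppr0 raddf0.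
Qed.

Lemma avec_pairing (x y : 'cV[F]_(fdim (m + m))) :
    (forall i, cliff (avec t i) *m x = 0) -> (forall i, cliff (bvec t i) *m y = 0) ->
  x != 0 -> y != 0 -> spairing x y != 0.
Proof.
move=> ax bY x0 y0; rewrite spairingE.
apply: (killed_pairing (a := fun i => cliff (avec t i)) (b := fun i => cliff (bvec t i)) (e := 1)) => //.
- by move=> i j; rewrite clifford // inner_avec_bvec.
- by move=> i j; apply/eqP; rewrite -addr_eq0 clifford // inner_bvec mulr0 oppr0 raddf0.
- by move=> i; rewrite cliff_sqr // inner_bvec oppr0 raddf0.
- exact: pairing_unitmx.
by move=> i; rewrite scale1r cliff_pairing // oddD addbb.
Qed.

Definition Imx : 'M[F]_(m + m) := block_mx 0 (- 1%:M) 1%:M 0.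

Lemma Imx_sqr : Imx *m Imx = - 1%:M.
Proof.
rewrite /Imx mulmx_block !(mul0mx, mulmx0, mul1mx, mulmx1, add0r, addr0).
by rewrite [in RHS](scalar_mx_block m m) opp_block_mx oppr0.
Qed.

Lemma Imx_tr : Imx^T *m Imx = 1%:M.
Proof.
rewrite /Imx tr_block_mx !trmx0 trmx1 [(- _)^T]linearN /= trmx1 mulmx_block.
rewrite !(mul0mx, mulmx0, mul1mx, mulmx1, add0r, addr0, mulNmx, mulmxN, opprK).
by rewrite -scalar_mx_block.
Qed.

(** For [t = 1] and [t = -1] these are the models of J_1 and J_0: they agree on V^+ and are opposite
    on V^-, so that minus their product is the model metric. *)
Definition Jmx : 'M[F]_((m + m) + (m + m)) := split_mx (- Imx) (- (t *: Imx)).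

Lemma Jmx_complex : complex_structure Jmx.
Proof.
split.
  apply: split_mx_isom => //; rewrite [(- _)^T]linearN /= mulNmx mulmxN opprK ?Imx_tr //.
  by rewrite [(_ *: _)^T]linearZ /= -scalemxAl -scalemxAr scalerA tt scale1r Imx_tr.
rewrite /Jmx split_mxM // !mulNmx !mulmxN !opprK -scalemxAl -scalemxAr scalerA tt scale1r.
by rewrite Imx_sqr split_mxN split_mx1.
Qed.

Let Imx_col (x y : 'cV[F]_m) : Imx *m col_mx x y = col_mx (- y) x.
Proof. by rewrite /Imx mul_block_col !mul0mx mul1mx mulNmx mul1mx add0r addr0. Qed.

Lemma Jmx_kills (x : 'cV[F]_(fdim (m + m))) :
  (forall i, cliff (avec t i) *m x = 0) -> eigen_kills ii Jmx x.
Proof.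
move=> ax v Jv.
have killp k : cliff (pv (zv 1 k)) *m x = 0.
  have := ax (lshift m k); rewrite /avec.
  by have -> : fintype.split (lshift m k) = inl k by have := unsplitK (inl k : 'I_m + 'I_m).
have killq k : cliff (qv (zv t k)) *m x = 0.
  have := ax (rshift m k); rewrite /avec.
  by have -> : fintype.split (rshift m k) = inr k by have := unsplitK (inr k : 'I_m + 'I_m).
(* An eigenvector is half of [v - ii *: (Jmx *m v)]. In this form the claim is linear in the vector
   and reduces to a basis, on which the expression is a multiple of some [zv]. *)
suff H w : cliff (w - ii *: (Jmx *m w)) *m x = 0.
  have := H v; rewrite Jv scalerA ii_sqr scaleN1r opprK -mulr2n -[v *+ 2]scaler_nat.
  by rewrite cliffZ -scalemxAl => /eqP; rewrite scaler_eq0 (negbTE two_neq0) => /eqP.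
have sum_delta p (X : 'cV[F]_p) : X = \sum_j X j 0 *: delta_mx j 0.
  by rewrite {1}[X]matrix_sum_delta; apply: eq_bigr => j _; rewrite big_ord1.
have cD u u' : cliff (u - ii *: (Jmx *m u)) *m x = 0 -> cliff (u' - ii *: (Jmx *m u')) *m x = 0 ->
    cliff ((u + u') - ii *: (Jmx *m (u + u'))) *m x = 0.
  move=> u0 u0'; rewrite mulmxDr scalerDr opprD addrACA cliffD mulmxDl u0 u0' addr0 //.
have cZ c u : cliff (u - ii *: (Jmx *m u)) *m x = 0 -> 
    cliff (c *: u - ii *: (Jmx *m (c *: u))) *m x = 0.
  move=> u0; rewrite -scalemxAr scalerA mulrC -scalerA -scalerBr cliffZ -scalemxAl u0.
  by rewrite scaler0.
have csum (r : seq 'I_m) (f : 'I_m -> 'cV[F]_((m + m) + (m + m))) :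
    (forall a, cliff (f a - ii *: (Jmx *m f a)) *m x = 0) ->
    cliff (\sum_(a <- r) f a - ii *: (Jmx *m (\sum_(a <- r) f a))) *m x = 0.
  move=> f0; apply: (big_ind (fun u => cliff (u - ii *: (Jmx *m u)) *m x = 0)) => // .
  by rewrite mulmx0 scaler0 subrr -(scale0r 0) cliffZ scale0r mul0mx.
have [X [Y ->]] := pv_qv_span two_neq0 w.
have colsplit (Z : 'cV[F]_(m + m)) : Z = \sum_k (usubmx Z) k 0 *: col_mx (delta_mx k 0) 0 +
   \sum_k (dsubmx Z) k 0 *: col_mx 0 (delta_mx k 0).
  rewrite -{1}[Z]vsubmxK [usubmx Z in LHS]sum_delta [dsubmx Z in LHS]sum_delta.
  have E (x' y' : 'cV[F]_m) : col_mx x' y' = col_mx x' 0 + col_mx 0 y'.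
    by rewrite add_col_mx addr0 add0r.
  rewrite E; congr (_ + _).
    rewrite (big_morph (fun z => col_mx z 0) (id1 := 0) (op1 := +%R)) => [|a b|].
    - by apply: eq_bigr => k _; rewrite scale_col_mx scaler0.
    - by rewrite add_col_mx addr0.
    - by rewrite col_mx0.
  rewrite (big_morph (fun z => col_mx 0 z) (id1 := 0) (op1 := +%R)) => [|a b|].
  - by apply: eq_bigr => k _; rewrite scale_col_mx scaler0.
  - by rewrite add_col_mx addr0.
  - by rewrite col_mx0.
have bigp (r : seq 'I_m) (f : 'I_m -> 'cV[F]_(m + m)) :
    pv (\sum_(a <- r) f a) = \sum_(a <- r) pv (f a).
  by apply: (big_morph _ (@pvD _ _)); rewrite /pv col_mx0.
have bigq (r : seq 'I_m) (f : 'I_m -> 'cV[F]_(m + m)) :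
    qv (\sum_(a <- r) f a) = \sum_(a <- r) qv (f a).
  by apply: (big_morph _ (@qvD _ _)); rewrite /qv oppr0 col_mx0.
apply: (cD).
  rewrite (colsplit X) pvD !bigp; apply: (cD); apply: (csum) => k; rewrite pvZ; apply: (cZ).
    rewrite split_mx_pv // mulNmx Imx_col oppr0 -pvZ -(scaleN1r (pv _)) -pvZ -pvD.
    rewrite (_ : _ + _ = zv 1 k) ?killp // /zv mul1r scaleN1r scalerN opprK.
    by rewrite scale_col_mx scaler0 add_col_mx addr0 add0r.
  rewrite split_mx_pv // mulNmx Imx_col -pvZ -(scaleN1r (pv _)) -pvZ -pvD.
  rewrite (_ : _ + _ = - ii *: zv 1 k) ?pvZ ?cliffZ -?scalemxAl ?killp ?scaler0 //.
  rewrite /zv mul1r scaleN1r scalerN opprK !scale_col_mx add_col_mx scaler0 add0r addr0.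
  by rewrite scalerN scaleNr scalerA mulNr ii_sqr opprK scale1r.
rewrite (colsplit Y) qvD !bigq; apply: (cD); apply: (csum) => k; rewrite qvZ; apply: (cZ).
  rewrite split_mx_qv // mulNmx -scalemxAl Imx_col oppr0 -qvZ -(scaleN1r (qv _)) -qvZ -qvD.
  rewrite (_ : _ + _ = zv t k) ?killq // /zv scaleN1r scalerN opprK scalerA [ii * t]mulrC.
  by rewrite scale_col_mx scaler0 add_col_mx addr0 add0r.
rewrite split_mx_qv // mulNmx -scalemxAl Imx_col -qvZ -(scaleN1r (qv _)) -qvZ -qvD.
rewrite (_ : _ + _ = - (t * ii) *: zv t k) ?qvZ ?cliffZ -?scalemxAl ?killq ?scaler0 //.
rewrite /zv scaleN1r scalerN opprK scalerA [ii * t]mulrC !scale_col_mx add_col_mx scaler0.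
rewrite add0r addr0 scalerN scaleNr scalerA mulNr mulrACA tt ii_sqr mul1r opprK scale1r.
by [].
Qed.

End Dual.

(* The invariant spinor of parameter 1, and the complex conjugate of the one of
   parameter -1. *)
Definition spin1 := fz (bas F finset.setT)^T (form1 F m).
Definition spin0c := fz (form1 F m)^T (form1 F m).

Lemma gvect_form1 k : gvect (zv 1 k) *m form1 F m = 0.
Proof. by rewrite gvect_zv subrr scale0r sub0r mulNmx -scalemxAl ctr_form1 scaler0 oppr0. Qed.

Lemma top_gvect k : (bas F finset.setT)^T *m gvect (zv 1 k) = 0.
Proof.
rewrite gvect_zv subrr scale0r sub0r mulmxN -scalemxAr /ctr -trmx_mul ext_bas finset.in_setT.
by rewrite trmx0 scaler0 oppr0.
Qed.

Lemma form1_gvect k : (form1 F m)^T *m gvect (zv (-1) k) = 0.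
Proof.
rewrite gvect_zv subrr scale0r subr0 -scalemxAr -[ext F k]trmxK -trmx_mul.
by rewrite -/(ctr F k) ctr_form1 trmx0 scaler0.
Qed.

Lemma spin1_killed i : cliff (avec 1 i) *m spin1 = 0.
Proof.
rewrite /avec; case: fintype.split => k; [apply: cliff_pv_fz|apply: cliff_qv_fz].
  exact: top_gvect.
exact: gvect_form1.
Qed.

Lemma spin0c_killed k : cliff (pv (zv (-1) k)) *m spin0c = 0 /\
  cliff (qv (zv 1 k)) *m spin0c = 0.
Proof.
split; [apply: cliff_pv_fz|apply: cliff_qv_fz]; [exact: form1_gvect|exact: gvect_form1].
Qed.

Lemma spin1_neq0 : spin1 != 0.
Proof.
apply: (@fz_neq0 _ _ [seq lshift m k | k <- enum 'I_m]).
rewrite big_map enumT -[Finite.enum _]/(Finite.enum 'I_m).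
have -> : \prod_(j <- Finite.enum 'I_m) gamma (lshift m j) = chir by rewrite /chir [index_enum _]unlock.
by rewrite chir_form1 -form_coord basE eqxx oner_eq0.
Qed.

Lemma spin0c_neq0 : spin0c != 0.
Proof.
apply: (@fz_neq0 _ _ [::]).
by rewrite big_nil mul1mx -form_coord basE eqxx oner_eq0.
Qed.

Lemma form1_parityF : has_parity false (form1 F m).
Proof. by move=> S; rewrite basE; have [->|//] := eqVneq S finset.set0; rewrite cards0. Qed.

Lemma spin1_parity : has_parity (odd m) spin1.
Proof.
rewrite -[odd m]addbF; apply: fz_parity; last exact: form1_parityF.
by move=> S; rewrite trmxK basE; have [->|//] := eqVneq S finset.setT; rewrite cardsT card_ord eqxx.
Qed.

Lemma spin0c_parity : has_parity false spin0c.
Proof.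
by rewrite -[false]addbF; apply: fz_parity; rewrite ?trmxK; exact: form1_parityF.
Qed.

End Gammas.

(** * Diagonalisation of unitary matrices and square roots in SU(m) *)

Section UnitarySpectral.
Variables (C : numClosedFieldType) (m : nat).
Implicit Types A B U : 'M[C]_m.

Definition adj A := (map_mx Num.conj A)^T.
Definition is_unitary A := adj A *m A = 1%:M.

Lemma adjM A B : adj (A *m B) = adj B *m adj A.
Proof. by rewrite /adj map_mxM trmx_mul. Qed.

Lemma adjK A : adj (adj A) = A.
Proof. by apply/matrixP => i j; rewrite !mxE conjCK. Qed.

Lemma is_unitary1 : is_unitary 1%:M.
Proof. by rewrite /is_unitary /adj map_mx1 trmx1 mulmx1. Qed.

Lemma is_unitaryM A B : is_unitary A -> is_unitary B -> is_unitary (A *m B).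
Proof.
by move=> uA uB; rewrite /is_unitary adjM -mulmxA (mulmxA _ A) uA mul1mx uB.
Qed.

Lemma is_unitaryV A : is_unitary A -> is_unitary (adj A).
Proof. by move=> /mulmx1C; rewrite /is_unitary adjK. Qed.

Lemma adj_diag (d : 'rV[C]_m) : adj (diag_mx d) = diag_mx (map_mx Num.conj d).
Proof. by rewrite /adj map_diag_mx tr_diag_mx. Qed.

Lemma unitary_diag (d : 'rV[C]_m) : is_unitary (diag_mx d) <-> forall k, d 0 k * (d 0 k)^* = 1.
Proof.
rewrite /is_unitary adj_diag mulmx_diag; split=> [/matrixP E k|E].
  by have := E k k; rewrite !mxE eqxx !mulr1n mulrC.
apply/matrixP => i j; rewrite !mxE; case: eqP => [->|]; rewrite ?mulr0n // !mulr1n.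
by rewrite mulrC E.
Qed.

Lemma unitary_spectral A : is_unitary A ->
  exists U d, [/\ is_unitary U, is_unitary (diag_mx d) & A = adj U *m diag_mx d *m U].
Proof.
move=> uA; have nA : A \is normalmx.
  apply/eqP; have E : map_mx Num.conj A^T = adj A by apply/matrixP => i j; rewrite !mxE.
  by rewrite E uA mulmx1C.
have /orthomx_spectralP AE := nA.
pose U := spectralmx A; pose d := spectral_diag A.
have uU : is_unitary U.
  have := spectral_unitarymx A; move/unitarymxP => UU.
  have E : map_mx Num.conj U^T = adj U by apply/matrixP => i j; rewrite !mxE.
  by rewrite /is_unitary -E; apply: mulmx1C; exact: UU.
have iU : invmx U = adj U.
  by rewrite -[LHS]mul1mx -uU mulmxK //; apply: spectral_unit.
exists U, d; rewrite -iU; split=> //.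
have -> : diag_mx d = U *m A *m adj U.
  rewrite AE -/U -/d -iU !mulmxA mulmxV ?spectral_unit // mul1mx.
  by rewrite mulmxK // spectral_unit.
by apply: is_unitaryM; [apply: is_unitaryM|apply: is_unitaryV].
Qed.

(** Roots of the eigenvalues are chosen arbitrarily; their product [p] satisfies [p * p = 1], and
    multiplying a single root by [p] makes the determinant 1. The positivity of [m] provides that
    root. *)
Lemma special_unitary_sqrt A : (0 < m)%N -> is_unitary A -> \det A = 1 ->
  exists B, [/\ is_unitary B, \det B = 1 & B *m B = A].
Proof.
move=> m0 uA dA; have [U [d [uU ud AE]]] := unitary_spectral uA.
pose e0 : 'rV[C]_m := \row_k sqrtC (d 0 k).
have e0d k : e0 0 k * e0 0 k = d 0 k by rewrite mxE -expr2 sqrtCK.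
pose p := \prod_k e0 0 k.
have dU : \det (adj U) * \det U = 1 by rewrite -det_mulmx uU det1.
have pp : p * p = 1.
  rewrite /p -big_split /=; under eq_bigr => k _ do rewrite e0d.
  by rewrite -det_diag -[RHS]dA AE !det_mulmx mulrAC dU mul1r.
pose k0 := Ordinal m0.
pose e : 'rV[C]_m := \row_k (if k == k0 then p * e0 0 k else e0 0 k).
have ed k : e 0 k * e 0 k = d 0 k.
  by rewrite mxE; case: ifP => _; rewrite ?e0d // mulrACA pp mul1r e0d.
have pe : \prod_k e 0 k = 1.
  rewrite (bigD1 k0) //= mxE eqxx -mulrA -[RHS]pp {2}/p (bigD1 k0 (F := fun k => e0 0 k)) //=.
  by rewrite [RHS]mulrC; congr (_ * (_ * _)); apply: eq_bigr => k /negbTE kk; rewrite mxE kk.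
have ue : is_unitary (diag_mx e).
  apply/unitary_diag => k; have /unitary_diag /(_ k) := ud.
  rewrite -ed rmorphM mulrACA -expr2 -normCK => /eqP.
  rewrite sqrf_eq1 => /orP[/eqP //|/eqP E].
  by have := exprn_ge0 2 (normr_ge0 (e 0 k)); rewrite E oppr_ge0 ler10.
exists (adj U *m diag_mx e *m U); split.
- by apply: is_unitaryM => //; apply: is_unitaryM => //; apply: is_unitaryV.
- by rewrite !det_mulmx det_diag pe mulr1 dU.
have UU : U *m adj U = 1%:M by apply: mulmx1C.
rewrite AE !mulmxA -(mulmxA _ U (adj U)) UU mulmx1 -(mulmxA _ (diag_mx e) (diag_mx e)).
rewrite mulmx_diag; congr (_ *m diag_mx _ *m _).
by apply/rowP => k; rewrite mxE ed.
Qed.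

End UnitarySpectral.

Section MapModel.
Variables (F F' : fieldType) (f : {rmorphism F -> F'}) (m : nat) (ii t : F).

Lemma map_pv n (X : 'cV[F]_n) : map_mx f (pv X) = pv (map_mx f X).
Proof. by rewrite /pv map_col_mx. Qed.

Lemma map_qv n (X : 'cV[F]_n) : map_mx f (qv X) = qv (map_mx f X).
Proof. by rewrite /qv map_col_mx map_mxN. Qed.

Lemma map_split_mx n (A B : 'M[F]_n) :
  map_mx f (split_mx A B) = split_mx (map_mx f A) (map_mx f B).
Proof.
by rewrite /split_mx map_mxZ map_block_mx !map_mxD !map_mxN fmorphV rmorphMn rmorph1.
Qed.

Lemma map_zv s (k : 'I_m) : map_mx f (zv ii s k) = zv (f ii) (f s) k.
Proof. by rewrite /zv map_col_mx map_mxZ !map_delta_mx rmorphM. Qed.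

Lemma map_avec (i : 'I_(m + m)) : map_mx f (avec ii t i) = avec (f ii) (f t) i.
Proof.
by rewrite /avec; case: fintype.split => k; rewrite ?map_pv ?map_qv map_zv ?rmorph1.
Qed.

Lemma map_avec_eq ii' t' (i : 'I_(m + m)) : f ii = ii' -> f t = t' ->
  map_mx f (avec ii t i) = avec ii' t' i.
Proof. by move=> <- <-; exact: map_avec. Qed.

Lemma map_Jmx : map_mx f (Jmx m t) = Jmx m (f t).
Proof.
rewrite /Jmx map_split_mx !map_mxN map_mxZ /Imx map_block_mx !map_mx0 map_mxN map_mx1.
by [].
Qed.

(** The dual basis is proportional to the conjugate one, so the conjugate of a model spinor is
    killed by all [bvec]. *)
Lemma bvec_avec (i : 'I_(m + m)) : exists c, bvec ii t i = c *: avec (- ii) t i.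
Proof.
rewrite /bvec /avec; case: fintype.split => k; eexists; congr (_ *: _); rewrite /zv.
  by rewrite mulN1r mul1r.
by rewrite mulrN mulNr.
Qed.

End MapModel.

Lemma fzZ (F : fieldType) m (ii c : F) (u : 'rV[F]_(fdim m)) w :
  fz ii (c *: u) w = c *: fz ii u w.
Proof. by apply/colP => s; rewrite mxE [RHS]mxE [in RHS]mxE -scalemxAl mxE. Qed.

Lemma conj_spin0c_killed (F : fieldType) (cj : {rmorphism F -> F}) m (ii : F)
    (i : 'I_(m + m)) : (2 : F) != 0 -> ii * ii = -1 -> cj ii = - ii ->
  cliff (avec ii (-1) i) *m map_mx cj (spin0c m ii) = 0.
Proof.
move=> two_neq0 ii_sqr cj_ii.
have <- : map_mx cj (avec (- ii) (-1) i) = avec ii (-1) i.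
  by apply: map_avec_eq; rewrite rmorphN ?rmorph1 // cj_ii opprK.
rewrite -map_cliff -map_mxM.
rewrite (_ : cliff _ *m _ = 0) ?map_mx0 // /avec.
case: (fintype.split i) => k; have [kp kq] := spin0c_killed two_neq0 ii_sqr k.
  by rewrite (_ : zv (- ii) 1 k = zv ii (-1) k) // /zv mul1r mulN1r.
by rewrite (_ : zv (- ii) (-1) k = zv ii 1 k) // /zv mul1r mulrNN mul1r.
Qed.

Section ModelFacts.
Variables (F : fieldType) (cj : {rmorphism F -> F}) (m : nat) (ii t : F).
Hypotheses (two_neq0 : (2 : F) != 0) (ii_sqr : ii * ii = -1) (tt : t * t = 1).
Hypotheses (cjK : involutive cj) (cj_ii : cj ii = - ii) (cj_t : cj t = t).
Local Notation N := (fdim (m + m)).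

Definition is_model (mod : 'cV[F]_N) :=
  mod != 0 /\ forall i, cliff (avec ii t i) *m mod = 0.

Variable mod : 'cV[F]_N.
Hypothesis mod_model : is_model mod.

Lemma is_model_conj i : cliff (bvec ii t i) *m map_mx cj mod = 0.
Proof.
have [c ->] := bvec_avec ii t i.
rewrite cliffZ -scalemxAl -{1}cj_t -cj_ii -map_avec -map_cliff -map_mxM.
by rewrite (mod_model.2 i) map_mx0 scaler0.
Qed.

Lemma map_mx_neq0 : map_mx cj mod != 0.
Proof. by rewrite map_mx_eq0; case: mod_model. Qed.

Lemma is_model_pairing : spairing mod (map_mx cj mod) != 0.
Proof.
by apply: (avec_pairing two_neq0 ii_sqr tt mod_model.2 is_model_conj mod_model.1 map_mx_neq0).
Qed.

Lemma is_model_kills : eigen_kills ii (Jmx m t) mod.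
Proof. exact: (Jmx_kills two_neq0 ii_sqr tt mod_model.2). Qed.

Lemma conj_kills (J : 'M[F]_((m + m) + (m + m))) (rho : 'cV[F]_N) : map_mx cj J = J ->
  eigen_kills ii J rho -> eigen_kills (- ii) J (map_mx cj rho).
Proof.
move=> JE Jr v Jv; have cjj p q (A : 'M[F]_(p, q)) : map_mx cj (map_mx cj A) = A.
  by apply/matrixP => i j; rewrite !mxE cjK.
rewrite -[v]cjj -map_cliff -map_mxM Jr ?map_mx0 //.
by rewrite -{1}JE -map_mxM Jv map_mxZ rmorphN cj_ii opprK.
Qed.

(** Undoing the lift turns [rho] into a vector killed by all [avec], and such vectors form a
    line. *)
Lemma is_model_transport b (s g J : _) (s' : 'M[F]_N) rho :
    s' *m s = 1%:M -> isom_mx g -> (forall v, s *m cliff v = (-1) ^+ b *: (cliff (g *m v) *m s)) ->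
    J *m g = g *m Jmx m t -> eigen_kills ii J rho ->
  exists c, rho = c *: (s *m mod).
Proof.
move=> ss ig sg Jg Jr; have s's := mulmx1C ss.
have ae i : Jmx m t *m avec ii t i = ii *: avec ii t i.
  have := killsE two_neq0 ii_sqr (Jmx_complex m two_neq0 tt) is_model_kills mod_model.1.
  by move/seteqP => [_]; apply; exact: mod_model.2.
have [|c E] := avec_line two_neq0 ii_sqr tt mod_model.2 (y := s' *m rho) _ mod_model.1.
  move=> i; apply: (can_inj (mulKmx (mulmx1_unit ss).2)).
  rewrite mulmx0 mulmxA sg -scalemxAl -mulmxA [s *m _]mulmxA s's mul1mx.
  by rewrite Jr ?scaler0 // mulmxA Jg -mulmxA ae -scalemxAr.
by exists c; rewrite scalemxAr -E mulmxA s's mul1mx.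
Qed.

End ModelFacts.

Section RealModel.
Variables (R : realType) (m : nat).
Local Notation C := R[i].
Local Notation N := (fdim (m + m)).
Local Notation cx := (map_mx (real_complex R)).
Local Notation ii := (Complex 0 1 : C).

Lemma two_neq0C : (2 : C) != 0. Proof. by rewrite pnatr_eq0. Qed.
Lemma two_neq0R : (2 : R) != 0. Proof. by rewrite pnatr_eq0. Qed.

Lemma ii_sqr : ii * ii = -1.
Proof. by apply/eqP; rewrite eq_complex /= !mul0r !mulr0 mulr1 sub0r addr0 oppr0 !eqxx. Qed.

Lemma conj_ii : conjc ii = - ii.
Proof. by apply/eqP; rewrite eq_complex /= oppr0 !eqxx. Qed.

Lemma conj_toC (c : R) : conjc (toC c) = toC c.
Proof. by apply/eqP; rewrite eq_complex /= oppr0 !eqxx. Qed.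

Lemma conj_cx p q (A : 'M[R]_(p, q)) : map_mx conjc (cx A) = cx A.
Proof. by apply/matrixP => i j; rewrite !mxE conj_toC. Qed.

Lemma conj_bas S : map_mx conjc (bas C S) = bas C S :> 'cV_(fdim m).
Proof. exact: (map_bas (conjc : {rmorphism C -> C})). Qed.

Lemma charge_vacuum : charge (vacuum R m) = bas C finset.setT.
Proof.
by rewrite /charge /vacuum form1E conj_bas -form1E (chir_form1 m ii).
Qed.

Lemma fierzE (Psi Phi : 'cV[C]_(fdim m)) : fierz Psi Phi = fz ii (map_mx conjc (charge Psi))^T Phi.
Proof. by apply/colP => s; rewrite !mxE. Qed.

Lemma model1E : model1 R m = spin1 m ii.
Proof. by rewrite /model1 fierzE charge_vacuum conj_bas. Qed.

Lemma model1_model : is_model ii 1 (model1 R m).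
Proof.
rewrite model1E; split; first exact: (spin1_neq0 m two_neq0C ii_sqr).
exact: (spin1_killed two_neq0C ii_sqr).
Qed.

Lemma model0E : exists2 e : C, e != 0 & model0 R m = e *: map_mx conjc (spin0c m ii).
Proof.
have [e e1 ce] := chir_sqr m two_neq0C ii_sqr.
exists e; first by apply: contra_eq_neq e1 => ->; rewrite mul0r eq_sym oner_eq0.
have cc : charge (charge (vacuum R m)) = e *: form1 C m.
  rewrite charge_vacuum /charge conj_bas -(chir_form1 m ii) mulmxA.
  by rewrite [_ *m chir m ii](ce : _) mul_scalar_mx.
rewrite /model0 fierzE cc map_mxZ form1E conj_bas -form1E [(_ *: _)^T]linearZ /=.
by rewrite fzZ map_mxZ /= conjcK.
Qed.

Lemma model0_model : is_model ii (- 1) (model0 R m).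
Proof.
have [e e0 ->] := model0E; split.
  rewrite scaler_eq0 negb_or e0 map_mx_eq0 /=; exact: (spin0c_neq0 m two_neq0C ii_sqr).
move=> i; rewrite -scalemxAr -[RHS](scaler0 _ e); congr (_ *: _).
have := @conj_spin0c_killed _ (conjc : {rmorphism C -> C}) m ii i two_neq0C ii_sqr conj_ii. by apply.
Qed.

Lemma model1_parity : has_parity (odd m) (model1 R m).
Proof. rewrite model1E; exact: spin1_parity. Qed.

Lemma model0_parity : has_parity false (model0 R m).
Proof.
have [e _ ->] := model0E; move=> S oS.
by rewrite [LHS]mxE [X in _ * X]mxE (spin0c_parity ii oS) rmorph0 mulr0.
Qed.

End RealModel.

(** * The lift of U(m) x U(m) and the stabiliser of the model spinors *)

Section Rotors.
Variables (F : fieldType) (n : nat).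
Hypothesis two_neq0 : (2 : F) != 0.
Variables (x y : 'cV[F]_(n + n)) (eta c d : F).
Hypotheses (xx : inner x x = eta) (yy : inner y y = eta) (xy : inner x y = 0).
Hypotheses (eta2 : eta * eta = 1) (cd : c * c + d * d = 1).

(** Half-angle form of a rotation in the plane of [x] and [y]; [eta] is their common norm, 1 in V^+
    and -1 in V^-. *)
Definition rotor := c%:M + d *: (cliff x *m cliff y).

Let X := cliff x. Let Y := cliff y.
Let X2 : X *m X = (- eta)%:M. Proof. by rewrite cliff_sqr // xx. Qed.
Let Y2 : Y *m Y = (- eta)%:M. Proof. by rewrite cliff_sqr // yy. Qed.
Let YX : Y *m X = - (X *m Y).
Proof. by apply/eqP; rewrite -addr_eq0 addrC clifford // xy mulr0 oppr0 raddf0. Qed.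
Let YXY : Y *m (X *m Y) = eta *: X.
Proof. by rewrite mulmxA YX mulNmx -mulmxA Y2 mul_mx_scalar scaleNr opprK. Qed.
Let XXY : X *m (X *m Y) = - eta *: Y.
Proof. by rewrite mulmxA X2 mul_scalar_mx. Qed.
Let XYX : X *m Y *m X = eta *: Y.
Proof. by rewrite -mulmxA YX mulmxN XXY scaleNr opprK. Qed.
Let XYY : X *m Y *m Y = - eta *: X.
Proof. by rewrite -mulmxA Y2 mul_mx_scalar. Qed.

Let mul_rotor a b : (a *: X + b *: Y) *m rotor =
  (a * c + b * (d * eta)) *: X + (a * (d * - eta) + b * c) *: Y.
Proof.
rewrite /rotor mulmxDr mul_mx_scalar scalerDr !scalerA -scalemxAr mulmxDl -!scalemxAl.
rewrite -/X -/Y XXY YXY scalerDr !scalerA [X in _ + _ + X]addrC addrACA !scalerDl.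
by rewrite [(c * b) *: Y + _]addrC; congr (_ *: _ + _ *: _ + (_ *: _ + _ *: _)); ring.
Qed.

Lemma rotor_x : rotor *m cliff x =
  cliff ((c * c - d * d) *: x + (2 * eta * c * d) *: y) *m rotor.
Proof.
rewrite cliffD !cliffZ mul_rotor /rotor mulmxDl mul_scalar_mx -scalemxAl -/X -/Y XYX scalerA.
congr (_ *: _ + _ *: _).
  transitivity (c * (c * c + d * d) + (eta * eta - 1) * (2 * c * d * d)); last by ring.
  by rewrite cd eta2 subrr mul0r mulr1 addr0.
by transitivity (d * eta * (c * c + d * d)); [rewrite cd mulr1|ring].
Qed.

Lemma rotor_y : rotor *m cliff y =
  cliff ((- (2 * eta * c * d)) *: x + (c * c - d * d) *: y) *m rotor.
Proof.
rewrite cliffD !cliffZ mul_rotor /rotor mulmxDl mul_scalar_mx -scalemxAl -/X -/Y XYY scalerA.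
rewrite addrC; congr (_ *: _ + _ *: _).
  by transitivity (- (d * eta * (c * c + d * d))); [rewrite cd mulr1 mulrN|ring].
transitivity (c * (c * c + d * d) + (eta * eta - 1) * (2 * c * d * d)); last by ring.
by rewrite cd eta2 subrr mul0r mulr1 addr0.
Qed.

Lemma rotor_perp v : inner x v = 0 -> inner y v = 0 -> rotor *m cliff v = cliff v *m rotor.
Proof.
move=> xv yv; rewrite /rotor mulmxDl mulmxDr scalar_mxC -scalemxAl -scalemxAr.
have E w : inner w v = 0 -> cliff w *m cliff v = - (cliff v *m cliff w).
  by move=> wv; apply/eqP; rewrite -addr_eq0 clifford // wv mulr0 oppr0 raddf0.
by rewrite -mulmxA E // mulmxN !mulmxA E // mulNmx opprK.
Qed.

Lemma rotor_phase w (r : 'cV[F]_(fdim n)) : cliff y *m r = w *: (cliff x *m r) ->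
  rotor *m r = (c - d * w * eta) *: r.
Proof.
move=> yr; rewrite /rotor mulmxDl mul_scalar_mx -scalemxAl -mulmxA yr -scalemxAr mulmxA X2.
by rewrite mul_scalar_mx !scalerA -scalerDl; congr (_ *: _); ring.
Qed.

(** The second factor has norm [eta] by [rotor_norm], so over the reals the rotor is a product of
    two unit vectors, hence in Spin. *)
Lemma rotorE : rotor = cliff x *m cliff ((- (eta * c)) *: x + d *: y).
Proof.
rewrite cliffD !cliffZ mulmxDr -!scalemxAr X2 scale_scalar_mx /rotor; congr (_%:M + _).
by rewrite mulrNN mulrAC eta2 mul1r.
Qed.

Lemma rotor_norm : inner ((- (eta * c)) *: x + d *: y) ((- (eta * c)) *: x + d *: y) = eta.
Proof.
rewrite !(innerDl, innerDr, innerZl, innerZr) xx yy xy (innerC y x) xy.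
transitivity (eta * (eta * eta * (c * c) + d * d)); first by ring.
by rewrite eta2 mul1r cd mulr1.
Qed.

End Rotors.

Section PolarBasis.
Variables (F : fieldType) (m : nat).
Hypothesis two_neq0 : (2 : F) != 0.

Definition el (j : 'I_m) : 'cV[F]_(m + m) := col_mx (delta_mx j 0) 0.
Definition er (j : 'I_m) : 'cV[F]_(m + m) := col_mx 0 (delta_mx j 0).

Lemma dot_el_el j k : ((el j)^T *m el k) 0 0 = (j == k)%:R.
Proof.
by rewrite /el tr_col_mx mul_row_col mulmx0 addr0 -colE !mxE eqxx andbT eq_sym.
Qed.
Lemma dot_er_er j k : ((er j)^T *m er k) 0 0 = (j == k)%:R.
Proof.
by rewrite /er tr_col_mx mul_row_col mulmx0 add0r -colE !mxE eqxx andbT eq_sym.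
Qed.
Lemma dot_el_er j k : ((el j)^T *m er k) 0 0 = 0.
Proof. by rewrite /el /er tr_col_mx mul_row_col mulmx0 trmx0 mul0mx addr0 mxE. Qed.
Lemma dot_er_el j k : ((er j)^T *m el k) 0 0 = 0.
Proof. by rewrite /el /er tr_col_mx mul_row_col mulmx0 trmx0 mul0mx addr0 mxE. Qed.

Lemma polar_lin_eq0 p q (f : 'cV[F]_((m + m) + (m + m)) -> 'M[F]_(p, q)) :
    (forall u v, f (u + v) = f u + f v) -> (forall c v, f (c *: v) = c *: f v) ->
    (forall j, [/\ f (pv (el j)) = 0, f (pv (er j)) = 0, f (qv (el j)) = 0 & f (qv (er j)) = 0]) ->
  forall v, f v = 0.
Proof.
move=> fD fZ fe.
have f0 : f 0 = 0 by rewrite -(scale0r 0) fZ scale0r.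
have fsum (r : seq 'I_m) (g : 'I_m -> 'cV[F]_((m + m) + (m + m))) :
    f (\sum_(a <- r) g a) = \sum_(a <- r) f (g a) by apply: (big_morph _ fD f0).
have sum_delta (X : 'cV[F]_m) : X = \sum_j X j 0 *: delta_mx j 0.
  by rewrite {1}[X]matrix_sum_delta; apply: eq_bigr => j _; rewrite big_ord1.
have colsplit (Z : 'cV[F]_(m + m)) :
    Z = \sum_k (usubmx Z) k 0 *: el k + \sum_k (dsubmx Z) k 0 *: er k.
  rewrite -{1}[Z]vsubmxK [usubmx Z in LHS]sum_delta [dsubmx Z in LHS]sum_delta.
  have E (x' y' : 'cV[F]_m) : col_mx x' y' = col_mx x' 0 + col_mx 0 y'.
    by rewrite add_col_mx addr0 add0r.
  rewrite E; congr (_ + _).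
    rewrite (big_morph (fun z => col_mx z 0) (id1 := 0) (op1 := +%R)) => [|a b|].
    - by apply: eq_bigr => k _; rewrite scale_col_mx scaler0.
    - by rewrite add_col_mx addr0.
    - by rewrite col_mx0.
  rewrite (big_morph (fun z => col_mx 0 z) (id1 := 0) (op1 := +%R)) => [|a b|].
  - by apply: eq_bigr => k _; rewrite scale_col_mx scaler0.
  - by rewrite add_col_mx addr0.
  - by rewrite col_mx0.
have bigp (r : seq 'I_m) (g : 'I_m -> 'cV[F]_(m + m)) :
    pv (\sum_(a <- r) g a) = \sum_(a <- r) pv (g a).
  by apply: (big_morph _ (@pvD _ _)); rewrite /pv col_mx0.
have bigq (r : seq 'I_m) (g : 'I_m -> 'cV[F]_(m + m)) :
    qv (\sum_(a <- r) g a) = \sum_(a <- r) qv (g a).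
  by apply: (big_morph _ (@qvD _ _)); rewrite /qv oppr0 col_mx0.
move=> v; have [X [Y ->]] := pv_qv_span two_neq0 v.
rewrite (colsplit X) (colsplit Y) pvD qvD !bigp !bigq !fD !fsum !big1 ?addr0 // => k _;
  rewrite ?pvZ ?qvZ fZ; have [e1 e2 e3 e4] := fe k; by rewrite ?(e1, e2, e3, e4) scaler0.
Qed.

End PolarBasis.

Section Realify.
Variables (R : realType) (m : nat).
Local Notation C := R[i].
Implicit Types (A B : 'M[C]_m).

Let Re (z : C) := complex.Re z.
Let Im (z : C) := complex.Im z.

Lemma Re_sum (I : Type) (r : seq I) (f : I -> C) : Re (\sum_(i <- r) f i) = \sum_(i <- r) Re (f i).
Proof. by apply: (big_morph Re) => // -[a b] [c d]. Qed.
Lemma Im_sum (I : Type) (r : seq I) (f : I -> C) : Im (\sum_(i <- r) f i) = \sum_(i <- r) Im (f i).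
Proof. by apply: (big_morph Im) => // -[a b] [c d]. Qed.

Lemma realifyM A B : realify (A *m B) = realify A *m realify B.
Proof.
have reM : map_mx Re (A *m B) = map_mx Re A *m map_mx Re B - map_mx Im A *m map_mx Im B.
  apply/matrixP => i j; rewrite !mxE Re_sum -sumrB; apply: eq_bigr => k _.
  by rewrite !mxE; case: (A i k) => a b; case: (B k j).
have imM : map_mx Im (A *m B) = map_mx Re A *m map_mx Im B + map_mx Im A *m map_mx Re B.
  apply/matrixP => i j; rewrite !mxE Im_sum -big_split; apply: eq_bigr => k _ /=.
  by rewrite !mxE; case: (A i k) => a b; case: (B k j).
rewrite /realify -/Re -/Im reM imM mulmx_block !mulNmx !mulmxN opprD.
by rewrite [in X in block_mx _ _ _ X]addrC [X in block_mx _ _ X _]addrC.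
Qed.

Lemma realify1 : realify (1%:M : 'M[C]_m) = 1%:M.
Proof.
have -> : realify (1%:M : 'M[C]_m) = block_mx 1%:M (- 0) 0 1%:M.
  congr block_mx; apply/matrixP => i j; rewrite !mxE; case: eqP => //= _;
    by rewrite ?oppr0.
by rewrite oppr0 -scalar_mx_block.
Qed.

Lemma realify_tr A : (realify A)^T = realify (map_mx conjc A)^T.
Proof.
rewrite /realify tr_block_mx; congr block_mx; apply/matrixP => i j; rewrite !mxE;
  case: (A j i) => a b //=.
  by rewrite opprK.
Qed.

Lemma realify_unitary A : (map_mx conjc A)^T *m A = 1%:M -> (realify A)^T *m realify A = 1%:M.
Proof. by move=> uA; rewrite realify_tr -realifyM uA realify1. Qed.

Lemma realify_inj A B : realify A = realify B -> A = B.
Proof.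
move=> /eq_block_mx[/matrixP E1 _ /matrixP E2 _]; apply/matrixP => i j.
have := E1 i j; have := E2 i j; rewrite !mxE; case: (A i j) => a b; case: (B i j) => a' b' /=.
by move=> -> ->.
Qed.

Lemma realify_commute (a : 'M[R]_(m + m)) : a *m Imx R m = Imx R m *m a ->
  exists A, a = realify A.
Proof.
rewrite -{1 2}[a]submxK /Imx !mulmx_block !(mulmx0, mul0mx, mulmx1, mul1mx, addr0, add0r).
rewrite !mulmxN !mulmx1 !mulNmx !mul1mx => /eq_block_mx[E1 E2 E3 E4].
exists (\matrix_(i, j) Complex (ulsubmx a i j) (dlsubmx a i j)).
rewrite -{1}[a]submxK /realify; congr block_mx; try by apply/matrixP => i j; rewrite !mxE.
  by rewrite E1; apply/matrixP => i j; rewrite !mxE.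
by rewrite E3; apply/matrixP => i j; rewrite !mxE.
Qed.

End Realify.

Section RotorCovers.
Variables (F : fieldType) (m : nat).
Hypothesis two_neq0 : (2 : F) != 0.
Variables (k : 'I_m) (c d : F) (A : 'M[F]_(m + m)).
Hypothesis cd : c * c + d * d = 1.

Let lin_eq (s : 'M[F]_(fdim (m + m))) (g : 'M[F]_((m + m) + (m + m))) :
    (forall j, [/\ s *m cliff (pv (el F j)) = cliff (g *m pv (el F j)) *m s,
                   s *m cliff (pv (er F j)) = cliff (g *m pv (er F j)) *m s,
                   s *m cliff (qv (el F j)) = cliff (g *m qv (el F j)) *m s
                 & s *m cliff (qv (er F j)) = cliff (g *m qv (er F j)) *m s]) ->
  forall v, s *m cliff v = cliff (g *m v) *m s.
Proof.
move=> E v; apply/eqP; rewrite -subr_eq0; apply/eqP; move: v.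
apply: (polar_lin_eq0 two_neq0) => [u v|a v|j].
- by rewrite mulmxDr !cliffD mulmxDr mulmxDl opprD addrACA.
- by rewrite -scalemxAr !cliffZ -scalemxAr -scalemxAl scalerBr.
by have [E1 E2 E3 E4] := E j; split; apply/eqP; rewrite subr_eq0; apply/eqP.
Qed.

Lemma rotor_pv_covers :
    A *m el F k = (c * c - d * d) *: el F k + (2 * c * d) *: er F k ->
    A *m er F k = (- (2 * c * d)) *: el F k + (c * c - d * d) *: er F k ->
    (forall j, j != k -> A *m el F j = el F j /\ A *m er F j = er F j) ->
  forall v, rotor (pv (el F k)) (pv (er F k)) c d *m cliff v =
    cliff (split_mx A 1%:M *m v) *m rotor (pv (el F k)) (pv (er F k)) c d.
Proof.
have xx : inner (pv (el F k)) (pv (el F k)) = 1 by rewrite inner_pv_pv // dot_el_el eqxx.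
have yy : inner (pv (er F k)) (pv (er F k)) = 1 by rewrite inner_pv_pv // dot_er_er eqxx.
have xy : inner (pv (el F k)) (pv (er F k)) = 0 by rewrite inner_pv_pv // dot_el_er.
move=> Ael Aer Aj; apply: lin_eq => j; rewrite !split_mx_pv // !split_mx_qv // !mul1mx.
have q1 : rotor (pv (el F k)) (pv (er F k)) c d *m cliff (qv (el F j)) =
   cliff (qv (el F j)) *m rotor (pv (el F k)) (pv (er F k)) c d.
  by apply: rotor_perp => //; rewrite inner_pv_qv.
have q2 : rotor (pv (el F k)) (pv (er F k)) c d *m cliff (qv (er F j)) =
   cliff (qv (er F j)) *m rotor (pv (el F k)) (pv (er F k)) c d.
  by apply: rotor_perp => //; rewrite inner_pv_qv.
have [jk|jk] := eqVneq j k.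
  rewrite {}jk in q1 q2 *; rewrite Ael Aer !pvD !pvZ; split=> //.
    by rewrite (rotor_x two_neq0 xx yy xy) ?mulr1.
  by rewrite (rotor_y two_neq0 xx yy xy) ?mulr1.
have kj : (k == j) = false by rewrite eq_sym (negbTE jk).
have [-> ->] := Aj j jk; split=> //; apply: rotor_perp => //; rewrite inner_pv_pv //.
- by rewrite dot_el_el kj.
- by rewrite dot_er_el.
- by rewrite dot_el_er.
- by rewrite dot_er_er kj.
Qed.

(** As [eta] is -1 here, the sense of rotation is opposite to that of [rotor_pv_covers]. *)
Lemma rotor_qv_covers :
    A *m el F k = (c * c - d * d) *: el F k + (- (2 * c * d)) *: er F k ->
    A *m er F k = (2 * c * d) *: el F k + (c * c - d * d) *: er F k ->
    (forall j, j != k -> A *m el F j = el F j /\ A *m er F j = er F j) ->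
  forall v, rotor (qv (el F k)) (qv (er F k)) c d *m cliff v =
    cliff (split_mx 1%:M A *m v) *m rotor (qv (el F k)) (qv (er F k)) c d.
Proof.
have xx : inner (qv (el F k)) (qv (el F k)) = - 1 by rewrite inner_qv_qv // dot_el_el eqxx.
have yy : inner (qv (er F k)) (qv (er F k)) = - 1 by rewrite inner_qv_qv // dot_er_er eqxx.
have xy : inner (qv (el F k)) (qv (er F k)) = 0 by rewrite inner_qv_qv // dot_el_er oppr0.
move=> Ael Aer Aj; apply: lin_eq => j; rewrite !split_mx_pv // !split_mx_qv // !mul1mx.
have q1 : rotor (qv (el F k)) (qv (er F k)) c d *m cliff (pv (el F j)) =
   cliff (pv (el F j)) *m rotor (qv (el F k)) (qv (er F k)) c d.
  by apply: rotor_perp => //; rewrite innerC inner_pv_qv.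
have q2 : rotor (qv (el F k)) (qv (er F k)) c d *m cliff (pv (er F j)) =
   cliff (pv (er F j)) *m rotor (qv (el F k)) (qv (er F k)) c d.
  by apply: rotor_perp => //; rewrite innerC inner_pv_qv.
have N1 : -1 * -1 = 1 :> F by rewrite mulrNN mulr1.
have [jk|jk] := eqVneq j k.
  rewrite {}jk in q1 q2 *; rewrite Ael Aer !qvD !qvZ; split=> //.
    by rewrite (rotor_x two_neq0 xx yy xy N1 cd) mulrN1 !mulNr.
  by rewrite (rotor_y two_neq0 xx yy xy N1 cd) mulrN1 !mulNr opprK.
have kj : (k == j) = false by rewrite eq_sym (negbTE jk).
have [-> ->] := Aj j jk; split=> //; apply: rotor_perp => //; rewrite inner_qv_qv //.
- by rewrite dot_el_el kj oppr0.
- by rewrite dot_er_el oppr0.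
- by rewrite dot_el_er oppr0.
- by rewrite dot_er_er kj oppr0.
Qed.

End RotorCovers.

Section RotorPhase.
Variables (F : fieldType) (m : nat) (ii t c d : F) (k : 'I_m).
Hypotheses (two_neq0 : (2 : F) != 0) (ii_sqr : ii * ii = -1) (tt : t * t = 1).
Variable mod : 'cV[F]_(fdim (m + m)).
Hypothesis mod_model : is_model ii t mod.

Let zvE s : zv ii s k = el F k + (s * ii) *: er F k.
Proof. by rewrite /zv /el /er scale_col_mx scaler0 add_col_mx addr0 add0r. Qed.

Lemma rotor_pv_phase :
  rotor (pv (el F k)) (pv (er F k)) c d *m mod = (c - d * ii) *: mod.
Proof.
have xx : inner (pv (el F k)) (pv (el F k)) = 1 by rewrite inner_pv_pv // dot_el_el eqxx.
rewrite (@rotor_phase _ _ two_neq0 _ _ 1 c d xx ii) ?mulr1 //.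
have := mod_model.2 (lshift m k); rewrite /avec.
have -> : fintype.split (lshift m k) = inl k by have := unsplitK (inl k : 'I_m + 'I_m).
rewrite zvE mul1r pvD pvZ cliffD cliffZ mulmxDl -scalemxAl => /(congr1 (fun z => ii *: z)).
rewrite scalerDr scalerA ii_sqr scaleN1r scaler0 => /eqP; rewrite subr_eq0 => /eqP <-.
by [].
Qed.

(** For real [c] and [d] the sign [t] gives the two models conjugate phases, whereas rotors in V^+
    give them equal ones; combining both kinds realises any pair of unit phases. *)
Lemma rotor_qv_phase :
  rotor (qv (el F k)) (qv (er F k)) c d *m mod = (c + d * (t * ii)) *: mod.
Proof.
have xx : inner (qv (el F k)) (qv (el F k)) = -1 by rewrite inner_qv_qv // dot_el_el eqxx.
rewrite (@rotor_phase _ _ two_neq0 _ _ (-1) c d xx (t * ii)) ?mulrN1 ?opprK //.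
have := mod_model.2 (rshift m k); rewrite /avec.
have -> : fintype.split (rshift m k) = inr k by have := unsplitK (inr k : 'I_m + 'I_m).
rewrite zvE qvD qvZ cliffD cliffZ mulmxDl -scalemxAl => /(congr1 (fun z => (t * ii) *: z)).
rewrite scalerDr scalerA mulrACA tt ii_sqr mul1r scaleN1r scaler0 => /eqP.
by rewrite subr_eq0 => /eqP <-.
Qed.

End RotorPhase.

Lemma twisted_covers_comb (F : fieldType) n (S : 'M[F]_(fdim n)) (G : 'M[F]_(n + n)) e k
    (a c : 'cV[F]_(n + n)) :
  S *m cliff a = e *: (cliff (G *m a) *m S) -> S *m cliff c = e *: (cliff (G *m c) *m S) ->
  S *m cliff (a + k *: c) = e *: (cliff (G *m (a + k *: c)) *m S).
Proof.
move=> Ea Ec; rewrite cliffD cliffZ mulmxDr -scalemxAr Ea Ec mulmxDr -scalemxAr cliffD cliffZ.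
by rewrite mulmxDl -scalemxAl scalerDr !scalerA [k * e]mulrC.
Qed.

Lemma map_isom (F F' : fieldType) (f : {rmorphism F -> F'}) n (g : 'M[F]_(n + n)) :
  isom_mx g -> isom_mx (map_mx f g).
Proof. by move=> /isom_mxP gE; apply/isom_mxP; rewrite -(map_gram f) map_trmx -!map_mxM gE. Qed.

Section Phases.
Variables (R : realType) (m : nat).
Local Notation C := R[i].
Local Notation N := (fdim (m + m)).
Local Notation cx := (map_mx (real_complex R)).
Local Notation ii := (Complex 0 1 : C).
Local Notation m0 := (model0 R m).
Local Notation m1 := (model1 R m).
Implicit Types (A B U V : 'M[C]_m) (s : 'M[R]_N) (alpha beta : C).

Lemma n_even : ~~ odd (m + m). Proof. by rewrite addnn odd_double. Qed.

Lemma cx_decomp p q (v : 'M[C]_(p, q)) : exists a c : 'M[R]_(p, q), v = cx a + ii *: cx c.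
Proof.
exists (map_mx (@complex.Re R) v), (map_mx (@complex.Im R) v).
apply/matrixP => i j; rewrite !mxE; case: (v i j) => x y.
by apply/eqP; rewrite eq_complex /= !(mul0r, mulr0, mul1r, subr0, addr0, add0r) !eqxx.
Qed.

Lemma tcovers_cx n b (s : 'M[R]_(fdim n)) g : tcovers b s g ->
  forall v : 'cV[C]_(n + n), cx s *m cliff v = (-1) ^+ b *: (cliff (cx g *m v) *m cx s).
Proof.
move=> sg v; have [a [c ->]] := cx_decomp v.
have E (w : 'cV[R]_(n + n)) : cx s *m cliff (cx w) = (-1) ^+ b *: (cliff (cx g *m cx w) *m cx s).
  rewrite -map_mxM -!map_cliff -!map_mxM sg map_mxZ.
  by congr (_ *: _); rewrite rmorphXn rmorphN1.
by apply: twisted_covers_comb.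
Qed.

Lemma so_soE n (A B : 'M[R]_n) : so_so A B = split_mx A B. Proof. by []. Qed.

Lemma realify_Imx A : realify A *m Imx R m = Imx R m *m realify A.
Proof.
rewrite /Imx /realify !mulmx_block !(mulmx0, mul0mx, mulmx1, mul1mx, addr0, add0r).
by rewrite !mulmxN !mulmx1 !mulNmx !mul1mx.
Qed.

Lemma realify_Jmx A B t :
  Jmx m t *m so_so (realify A) (realify B) = so_so (realify A) (realify B) *m Jmx m t.
Proof.
rewrite !so_soE /Jmx !(split_mxM (two_neq0R R)).
by rewrite !mulmxN !mulNmx -scalemxAl -scalemxAr !realify_Imx.
Qed.

Lemma realify_isom A B : is_unitary A -> is_unitary B ->
  isom_mx (so_so (realify A) (realify B)).
Proof.
by move=> uA uB; apply: (split_mx_isom (two_neq0R R)); apply: realify_unitary.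
Qed.

(** Replacing [s] by [- s] changes the sign of one of [alpha] and [beta]; this is why they are only
    required to be square roots of the determinants. *)
Definition phased A B s alpha beta :=
  [/\ Pin false s, tcovers false s (so_so (realify A) (realify B)),
      alpha * alpha = \det A /\ beta * beta = \det B,
      alpha * conjc alpha = 1 /\ beta * conjc beta = 1
    & cx s *m m0 = (conjc alpha * beta) *: m0 /\
      cx s *m m1 = (conjc alpha * conjc beta) *: m1].

Definition has_phase A B := exists s alpha beta, phased A B s alpha beta.

Lemma has_phase1 : has_phase 1%:M 1%:M.
Proof.
exists 1%:M, 1, 1; rewrite /phased !det1 !rmorph1 !mulr1 ?map_mx1 !mul1mx !scale1r realify1.
split=> //; first exact: Pin1.
by rewrite so_soE (split_mx1 _ (two_neq0R R)); apply: tcovers1.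
Qed.

Lemma has_phaseM A B A' B' : has_phase A B -> has_phase A' B' ->
  has_phase (A *m A') (B *m B').
Proof.
move=> [s [a [b [ps sg [aA bB] [a1 b1] [E0 E1]]]]].
move=> [s' [a' [b' [ps' sg' [aA' bB'] [a1' b1'] [E0' E1']]]]].
exists (s *m s'), (a * a'), (b * b'); split.
- exact: (PinM ps ps').
- have := tcoversM sg sg'; rewrite !so_soE (split_mxM (two_neq0R R)).
  by rewrite -!realifyM.
- by rewrite !det_mulmx -aA -aA' -bB -bB'; split; ring.
- by rewrite !rmorphM !(mulrACA _ _ (conjc _)) a1 a1' b1 b1' mulr1.
- rewrite map_mxM -!mulmxA E0' E1' -!scalemxAr E0 E1 !scalerA !rmorphM.
  by split; congr (_ *: _); ring.
Qed.

(** Unitary pairs commute with the model structures, so a lift of either parity preserves the line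
    of a model spinor. *)
Lemma lift_phase U V (b : bool) s t mod : is_unitary U -> is_unitary V -> Pin b s ->
    tcovers b s (so_so (realify U) (realify V)) -> t * t = 1 ->
    is_model ii (toC t) mod ->
  exists c : C, cx s *m mod = c *: mod.
Proof.
move=> uU uV ps sg tt md; have [s' [_ s's _]] := Pin_inv ps.
have ig := realify_isom uU uV.
have icx : isom_mx (cx (so_so (realify U) (realify V))).
  exact: map_isom.
have ttC : toC t * toC t = 1 :> C by rewrite -rmorphM tt.
have sC : cx s' *m cx s = 1%:M by rewrite -map_mxM s's map_mx1.
have JC : Jmx m (toC t) *m cx (so_so (realify U) (realify V)) =
    cx (so_so (realify U) (realify V)) *m Jmx m (toC t).
  by rewrite -(map_Jmx (real_complex R)) -!map_mxM realify_Jmx.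
have [c E] := is_model_transport (two_neq0C R) (ii_sqr R) ttC md sC icx (tcovers_cx sg) JC
  (is_model_kills (two_neq0C R) (ii_sqr R) ttC md).
have c0 : c != 0.
  by apply: contra_neq md.1 => c0; rewrite E c0 scale0r.
by exists c^-1; rewrite {2}E scalerA mulVf // scale1r.
Qed.

Let N1R : -1 * -1 = 1 :> R. Proof. by rewrite mulrNN mulr1. Qed.

Lemma model0_modelC : is_model ii (toC (-1)) m0.
Proof. by rewrite rmorphN1; exact: model0_model. Qed.

Lemma model1_modelC : is_model ii (toC 1) m1.
Proof. by rewrite rmorph1; exact: model1_model. Qed.

(** Allows reduction to diagonal matrices. The lift used for conjugation may be odd, but it occurs
    together with its inverse, so parities add up to even and its scalars on the models cancel. *)
Lemma has_phaseJ U V A B : is_unitary U -> is_unitary V -> has_phase A B ->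
  has_phase (adj U *m A *m U) (adj V *m B *m V).
Proof.
move=> uU uV [s [a [b [ps sg [aA bB] [a1 b1] [E0 E1]]]]].
have ig := realify_isom uU uV.
have [e [t [pt tg]]] := const_pin_lift 0 ig.
have [t' [pt' t't tt']] := Pin_inv pt.
have [c0 F0] := lift_phase uU uV pt tg N1R model0_modelC.
have [c1 F1] := lift_phase uU uV pt tg (mulr1 1) model1_modelC.
have inv (mod : 'cV[C]_N) (c : C) : cx t *m mod = c *: mod -> c *: (cx t' *m mod) = mod.
  by move=> E; rewrite scalemxAr -E mulmxA -map_mxM t't map_mx1 mul1mx.
have inv0 := inv _ _ F0; have inv1 := inv _ _ F1.
have dJ (W D : 'M[C]_m) : is_unitary W -> \det (adj W *m D *m W) = \det D.
  move=> uW; rewrite !det_mulmx mulrAC -det_mulmx (uW : adj W *m W = _) det1 mul1r.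
  by [].
exists (t' *m s *m t), a, b; split.
- by have := PinM (PinM pt' ps) pt; rewrite addbF addbb.
- have := tcoversM (tcoversM (tcoversV t't ig tg) sg) tg; rewrite addbF addbb.
  congr tcovers; rewrite !realifyM !so_soE -!(split_mxM (two_neq0R R)).
  congr (_ *m _ *m _); set G := split_mx (realify U) (realify V).
  rewrite -[RHS]mulmx1 -(isom_invr (two_neq0R R) (ig : isom_mx G)) mulmxA.
  rewrite /G (split_mxM (two_neq0R R)) -!realifyM uU uV !realify1 (split_mx1 _ (two_neq0R R)).
  by rewrite mul1mx.
- by rewrite !dJ.
- by [].
- rewrite !map_mxM -!mulmxA F0 F1 -!scalemxAr E0 E1 -!scalemxAr !scalerA.
  by rewrite ![_ * (conjc a * _)]mulrC -!scalerA inv0 inv1.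
Qed.

(* One diagonal entry at a time: it is the square of the phase of a rotor. *)
Definition diag1 (k : 'I_m) (z : C) : 'M[C]_m := diag_mx (\row_j if j == k then z else 1).

Lemma realify_diag1 k z (j : 'I_m) :
  [/\ realify (diag1 k z) *m el R k = complex.Re z *: el R k + complex.Im z *: er R k,
      realify (diag1 k z) *m er R k = - complex.Im z *: el R k + complex.Re z *: er R k
    & j != k -> realify (diag1 k z) *m el R j = el R j /\ realify (diag1 k z) *m er R j = er R j].
Proof.
have reE l : map_mx (@complex.Re R) (diag1 k z) *m delta_mx l 0 =
    (if l == k then complex.Re z else 1) *: (delta_mx l 0 : 'cV[R]_m).
  apply/colP => i; rewrite -colE !mxE eqxx andbT; have [->|_] := eqVneq i l.
    by rewrite mulr1n mulr1; case: (l == k).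
  by rewrite mulr0n mulr0.
have imE l : map_mx (@complex.Im R) (diag1 k z) *m delta_mx l 0 =
    (if l == k then complex.Im z else 0) *: (delta_mx l 0 : 'cV[R]_m).
  apply/colP => i; rewrite -colE !mxE eqxx andbT; have [->|_] := eqVneq i l.
    by rewrite mulr1n mulr1; case: (l == k).
  by rewrite mulr0n mulr0.
rewrite /realify /el /er; split=> [||jk]; rewrite ?mul_block_col !(mulmx0, addr0, add0r).
- by rewrite reE imE eqxx !scale_col_mx !scaler0 add_col_mx addr0 add0r.
- by rewrite mulNmx reE imE eqxx !scale_col_mx !scaler0 add_col_mx addr0 add0r scaleNr.
- rewrite mulNmx !reE !imE (negbTE jk).
  by rewrite scale1r scale0r oppr0.
Qed.

Lemma ComplexE (c d : R) : Complex c d = toC c + toC d * ii.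
Proof.
by apply/eqP; rewrite eq_complex /= !(mul0r, mulr0, mulr1, addr0, add0r, subr0) !eqxx.
Qed.

Lemma ComplexNE (c d : R) : conjc (Complex c d) = toC c - toC d * ii.
Proof. by rewrite -mulNr -(rmorphN (real_complex R)) -ComplexE. Qed.

Section RotorModels.
Variables (k : 'I_m) (c d : R).
Hypothesis cd : c * c + d * d = 1.
Let two0 := two_neq0R R.

Let cx_rotor (v w : 'cV[R]_((m + m) + (m + m))) :
  cx (rotor v w c d) = rotor (cx v) (cx w) (toC c) (toC d).
Proof. by rewrite /rotor map_mxD map_scalar_mx map_mxZ map_mxM !map_cliff. Qed.

Let cx_el : cx (el R k) = el C k. Proof. by rewrite /el map_col_mx map_delta_mx map_mx0. Qed.
Let cx_er : cx (er R k) = er C k. Proof. by rewrite /er map_col_mx map_delta_mx map_mx0. Qed.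

Lemma rotor_pv_models : let s := rotor (pv (el R k)) (pv (er R k)) c d in
  [/\ Pin false s, cx s *m m0 = (toC c - toC d * ii) *: m0
    & cx s *m m1 = (toC c - toC d * ii) *: m1].
Proof.
have px : inner (pv (el R k)) (pv (el R k)) = 1 by rewrite inner_pv_pv // dot_el_el eqxx.
have py : inner (pv (er R k)) (pv (er R k)) = 1 by rewrite inner_pv_pv // dot_er_er eqxx.
have pxy : inner (pv (el R k)) (pv (er R k)) = 0 by rewrite inner_pv_pv // dot_el_er.
rewrite /= !cx_rotor !map_pv cx_el cx_er; split.
- rewrite (rotorE two0 _ _ _ px (mulr1 1)).
  apply: (PinM (b := true) (b' := true)); apply: Pin_cliff; first by rewrite px normr1.
  by rewrite (rotor_norm px py pxy (mulr1 1) cd) normr1.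
- exact: (rotor_pv_phase _ _ k (two_neq0C R) (ii_sqr R) (model0_model R m)).
exact: (rotor_pv_phase _ _ k (two_neq0C R) (ii_sqr R) (model1_model R m)).
Qed.

Lemma rotor_qv_models : let s := rotor (qv (el R k)) (qv (er R k)) c d in
  [/\ Pin false s, cx s *m m0 = (toC c - toC d * ii) *: m0
    & cx s *m m1 = (toC c + toC d * ii) *: m1].
Proof.
have qx : inner (qv (el R k)) (qv (el R k)) = - 1 by rewrite inner_qv_qv // dot_el_el eqxx.
have qy : inner (qv (er R k)) (qv (er R k)) = - 1 by rewrite inner_qv_qv // dot_er_er eqxx.
have qxy : inner (qv (el R k)) (qv (er R k)) = 0 by rewrite inner_qv_qv // dot_el_er oppr0.
rewrite /= !cx_rotor !map_qv cx_el cx_er; split.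
- rewrite (rotorE two0 _ _ _ qx N1R).
  apply: (PinM (b := true) (b' := true)); apply: Pin_cliff; first by rewrite qx normrN1.
  by rewrite (rotor_norm qx qy qxy N1R) ?normrN1 // mulrNN.
- rewrite (rotor_qv_phase _ _ k (two_neq0C R) (ii_sqr R) _ (model0_model R m)) ?mulrNN ?mulr1 //.
  by rewrite mulN1r mulrN.
rewrite (rotor_qv_phase _ _ k (two_neq0C R) (ii_sqr R) _ (model1_model R m)) ?mulr1 //.
by rewrite mul1r.
Qed.

End RotorModels.

Lemma has_phase_diag1 k z : z * conjc z = 1 ->
  has_phase (diag1 k z) 1%:M /\ has_phase 1%:M (diag1 k z).
Proof.
(* A rotor turns by twice its angle, hence the square root [w] of [z]. *)
move=> zz; have [w wz] : exists w : C, w * w = z by exists (sqrtC z); rewrite -expr2 sqrtCK.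
have dz : \det (diag1 k z) = z.
  rewrite det_diag (bigD1 k) //= mxE eqxx big1 ?mulr1 // => j jk.
  by rewrite mxE (negbTE jk).
case: w wz => c d wz.
have [zr zi] : complex.Re z = c * c - d * d /\ complex.Im z = 2 * c * d.
  by rewrite -wz /=; split=> //; ring.
have cd : c * c + d * d = 1.
  have : complex.Re (z * conjc z) = 1 by rewrite zz.
  case: (z) zr zi => x y /= -> -> E.
  have : (c * c + d * d) ^+ 2 = 1 by rewrite -E; ring.
  move/eqP; rewrite sqrf_eq1 => /orP[/eqP //|/eqP E1].
  by have := addr_ge0 (sqr_ge0 c) (sqr_ge0 d); rewrite !expr2 E1 oppr_ge0 ler10.
set w := Complex c d in wz.
have ww : w * conjc w = 1.
  by apply/eqP; rewrite eq_complex /= mulrN opprK cd mulrN mulrC addNr !eqxx.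
have rE j := realify_diag1 k z j.
have [El Er _] := rE k; have two0 := two_neq0R R.
have [pp p0 p1] := rotor_pv_models k cd.
(* The opposite sense of rotation in V^- is compensated by the sign of [d]. *)
have cNd : c * c + (- d) * (- d) = 1 by rewrite mulrNN.
have [qp q0 q1] := rotor_qv_models k cNd.
split.
  exists (rotor (pv (el R k)) (pv (er R k)) c d), w, 1; split=> //.
  - rewrite realify1 so_soE => v; rewrite expr0 scale1r; apply: rotor_pv_covers => //.
    + by rewrite El zr zi.
    + by rewrite Er zr zi.
    by move=> j jk; have [_ _] := rE j; apply.
  - by rewrite dz det1 mulr1.
  - by rewrite rmorph1 mulr1.
  - by rewrite p0 p1 -ComplexNE rmorph1 !mulr1.
exists (rotor (qv (el R k)) (qv (er R k)) c (- d)), 1, w; split=> //.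
- rewrite realify1 so_soE => v; rewrite expr0 scale1r; apply: rotor_qv_covers => //.
  + by rewrite El zr zi mulrNN mulrN opprK.
  + by rewrite Er zr zi mulrNN mulrN.
  by move=> j jk; have [_ _] := rE j; apply.
- by rewrite dz det1 mulr1.
- by rewrite rmorph1 mulr1.
by rewrite q0 q1 -ComplexNE -ComplexE rmorph1 !mul1r /= opprK.
Qed.

Lemma has_phase_diag (d e : 'rV[C]_m) : is_unitary (diag_mx d) -> is_unitary (diag_mx e) ->
  has_phase (diag_mx d) (diag_mx e).
Proof.
move=> /unitary_diag ud /unitary_diag ue.
pose D (c : 'rV[C]_m) p : 'M[C]_m := diag_mx (\row_j if (j < p)%N then c 0 j else 1).
have D0 c : D c 0 = 1%:M.
  by rewrite -diag_const_mx; congr diag_mx; apply/rowP => j; rewrite !mxE.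
have Dm c : D c m = diag_mx c.
  by congr diag_mx; apply/rowP => j; rewrite !mxE ltn_ord.
have DS c (p : 'I_m) : D c p.+1 = D c p *m diag1 p (c 0 p).
  rewrite /D /diag1 mulmx_diag; congr diag_mx; apply/rowP => j; rewrite !mxE ltnS.
  have [->|jp] := eqVneq j p; first by rewrite leqnn ltnn mul1r.
  by rewrite leq_eqVlt (inj_eq val_inj) (negbTE jp) /= mulr1.
suff H p : (p <= m)%N -> has_phase (D d p) (D e p) by have := H m (leqnn m); rewrite !Dm.
elim: p => [_|p IH pm]; first by rewrite !D0; apply: has_phase1.
have -> : p = Ordinal pm by [].
rewrite !DS.
have [H1 _] := has_phase_diag1 (Ordinal pm) (ud (Ordinal pm)).
have [_ H2] := has_phase_diag1 (Ordinal pm) (ue (Ordinal pm)).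
have := has_phaseM (has_phaseM (IH (ltnW pm)) H1) H2.
by rewrite !mulmx1.
Qed.

Lemma unitary_phase A B : is_unitary A -> is_unitary B -> has_phase A B.
Proof.
move=> uA uB; have [U [d [uU ud ->]]] := unitary_spectral uA.
have [V [e [uV ue ->]]] := unitary_spectral uB.
by apply: has_phaseJ => //; apply: has_phase_diag.
Qed.

(** The given lift differs from the constructed one at most by a sign, which is absorbed in
    [alpha]. *)
Lemma Spin_phase A B s : is_unitary A -> is_unitary B -> Spin s ->
    covers s (so_so (realify A) (realify B)) -> exists alpha beta, phased A B s alpha beta.
Proof.
move=> uA uB /SpinE ps /coversE sg; have [t [a [b [pt tg ab ab1 [E0 E1]]]]] := unitary_phase uA uB.
have [->|sE] := Pin_uniq n_even pt ps tg sg; first by exists a, b; split.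
exists (- a), b; split=> //.
- by rewrite mulrNN.
- by rewrite rmorphN mulrNN.
- by rewrite sE map_mxN !mulNmx E0 E1 rmorphN !mulNr !scaleNr.
Qed.

End Phases.

Lemma eigen_sqr1 (F : comPzRingType) n (S : 'M[F]_n) (v : 'cV[F]_n) c :
  S *m v = c *: v -> c * c = 1 -> S *m (S *m v) = v.
Proof. by move=> Sv cc; rewrite Sv -scalemxAr Sv scalerA cc scale1r. Qed.

Lemma scale_fix (F : fieldType) p q (v : 'M[F]_(p, q)) c : v != 0 -> v = c *: v -> c = 1.
Proof.
move=> v0 /eqP; rewrite -subr_eq0 -{1}[v]scale1r -scalerBl scaler_eq0 (negbTE v0) orbF.
by rewrite subr_eq0 => /eqP.
Qed.

Section Stabiliser.
Variables (R : realType) (m : nat).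
Local Notation C := R[i].
Local Notation N := (fdim (m + m)).
Local Notation cx := (map_mx (real_complex R)).
Local Notation ii := (Complex 0 1 : C).
Local Notation m0 := (model0 R m).
Local Notation m1 := (model1 R m).
Variable iota : 'M[C]_m -> 'M[C]_m -> 'M[R]_N.
Hypotheses (m_gt0 : (0 < m)%N) (iota_lift : spin_lift iota).

Lemma SU_sqrt (A : 'M[C]_m) : SU A -> exists2 B, SU B & B *m B = A.
Proof.
move=> [uA dA]; have [B [uB dB BB]] := special_unitary_sqrt m_gt0 uA dA.
by exists B.
Qed.

(* Elements of SU(m) are squares, and the phases of their square roots are signs. *)
Lemma iota_models A B : SU A -> SU B ->
  cx (iota A B) *m m0 = m0 /\ cx (iota A B) *m m1 = m1.
Proof.
move=> sA sB; have [iS iC iM] := iota_lift.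
have [A' sA' <-] := SU_sqrt sA; have [B' sB' <-] := SU_sqrt sB.
rewrite iM // map_mxM -!mulmxA.
have [a [b [_ _ [aa bb] [a1 b1] [E0 E1]]]] := Spin_phase sA'.1 sB'.1 (iS _ _ sA' sB') (iC _ _ sA' sB').
have ca : conjc a * conjc a = 1 by rewrite -rmorphM aa sA'.2 rmorph1.
have cb : conjc b * conjc b = 1 by rewrite -rmorphM bb sB'.2 rmorph1.
have caa : conjc a * conjc b * (conjc a * conjc b) = 1 by rewrite mulrACA ca cb mulr1.
have cab : conjc a * b * (conjc a * b) = 1 by rewrite mulrACA ca bb sB'.2 mulr1.
by rewrite (eigen_sqr1 E0 cab) (eigen_sqr1 E1 caa).
Qed.

Lemma SUxSU_models s : SUxSU iota s -> cx s *m m0 = m0 /\ cx s *m m1 = m1.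
Proof. by move=> [A [B [sA sB ->]]]; exact: iota_models. Qed.

(** A real [s] fixing [mod] fixes its conjugate too. The two spinors determine both eigenspaces of
    the structure, so [g] cannot move it. *)
Lemma fixes_Jmx (t : R) g s (mod : 'cV[C]_N) : t * t = 1 -> is_model ii (toC t) mod ->
    cx s *m mod = mod -> isom_mx g -> tcovers false s g -> g *m Jmx m t = Jmx m t *m g.
Proof.
move=> tt md smod ig sg.
have two0 := two_neq0C R; have i2 := ii_sqr R.
have ttC : toC t * toC t = 1 :> C by rewrite -rmorphM tt.
have icx : isom_mx (cx g) by exact: map_isom.
have sgC v : cx s *m cliff v = 1 *: (cliff (cx g *m v) *m cx s) := tcovers_cx sg v.
have csJ := Jmx_complex m two0 ttC.
have k1 := is_model_kills two0 i2 ttC md.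
have JE : map_mx conjc (Jmx m (toC t)) = Jmx m (toC t).
  by rewrite -(map_Jmx (real_complex R)) conj_cx.
have k2 : eigen_kills (- ii) (Jmx m (toC t)) (map_mx conjc mod).
  by apply: (conj_kills (cj := conjc : {rmorphism C -> C})) k1 => //; [exact: conjcK|exact: conj_ii].
have sc : cx s *m map_mx conjc mod = map_mx conjc mod.
  by rewrite -{1}(conj_cx s) -map_mxM smod.
have k1' := kills_transport two0 (mulr1 1) k1 icx sgC.
have k2' := kills_transport two0 (mulr1 1) k2 icx sgC.
rewrite smod in k1'; rewrite sc in k2'.
have E := complex_structure_uniq two0 i2 csJ (complex_structure_conj two0 csJ icx) k1 k1' md.1 k2 k2'.
apply: (@map_mx_inj _ _ (real_complex R)); rewrite !map_mxM !map_Jmx.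
rewrite {2}E; last by rewrite map_mx_eq0; case: md.
by rewrite -[RHS]mulmxA (isom_invl two0 icx) mulmx1.
Qed.

Lemma stabiliser s : Spin s -> cx s *m m0 = m0 -> cx s *m m1 = m1 -> SUxSU iota s.
Proof.
move=> sS s0 s1; have [iS iC _] := iota_lift; have two0 := two_neq0R R.
have /SpinE ps := sS; have [g ig sg] := Pin_covers ps.
have N1R : -1 * -1 = 1 :> R by rewrite mulrNN mulr1.
have gJ0 := fixes_Jmx N1R (model0_modelC R m) s0 ig sg.
have gJ1 := fixes_Jmx (mulr1 1) (model1_modelC R m) s1 ig sg.
(* Commuting with both structures entails commuting with the model metric, hence preserving V^+ and
   V^-. *)
have JJ : Jmx m 1 *m Jmx m (-1) = - split_mx 1%:M (- 1%:M) :> 'M[R]_((m + m) + (m + m)).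
  rewrite /Jmx (split_mxM two0) -split_mxN // !mulNmx !mulmxN !opprK scale1r scaleN1r.
  by rewrite mulmxN Imx_sqr opprK.
have [a [b gE]] : exists a b, g = split_mx a b.
  apply: (split_mx_commute two0); apply: oppr_inj.
  by rewrite -mulmxN -mulNmx -JJ mulmxA gJ1 -mulmxA gJ0 mulmxA.
have [aI bI] : a *m Imx R m = Imx R m *m a /\ b *m Imx R m = Imx R m *m b.
  move: gJ1; rewrite gE /Jmx scale1r !(split_mxM two0) => /(split_mx_inj two0).
  by rewrite !mulmxN !mulNmx => -[/oppr_inj ? /oppr_inj].
have [A aA] := realify_commute aI; have [B bB] := realify_commute bI.
rewrite gE aA bB in ig sg.
have [oA oB] := split_mx_isomE two0 ig.
have uA : is_unitary A.
  by apply: realify_inj; rewrite realifyM -realify_tr oA realify1.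
have uB : is_unitary B.
  by apply: realify_inj; rewrite realifyM -realify_tr oB realify1.
have [al [be [_ _ [aa bb] [a1 b1] [E0 E1]]]] := Spin_phase uA uB sS (iffRL (coversE _ _) sg).
(* Both phases equal 1, so [be] is real and equal to [al]; the determinants, which are the squares
   of these unit numbers, are then 1. *)
have p0 := scale_fix (model0_model R m).1 (etrans (esym s0) E0).
have p1 := scale_fix (model1_model R m).1 (etrans (esym s1) E1).
have ba : be = al by rewrite -[be]mul1r -a1 -mulrA p0 mulr1.
have cba : conjc be = al by rewrite -[conjc be]mul1r -a1 -mulrA p1 mulr1.
have dA : \det A = 1 by rewrite -aa -{1}ba -cba b1.
have dB : \det B = 1 by rewrite -bb -{2}(conjcK be) cba -ba b1.
have sA : SU A by [].
have sB : SU B by [].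
exists A, B; split=> //.
have /SpinE pi := iS _ _ sA sB.
(* The other sign is excluded because [iota A B] and [s] both fix the first model spinor. *)
have [//|sE] := Pin_uniq (n_even m) pi ps (iffLR (coversE _ _) (iC _ _ sA sB)) sg.
have := (iota_models sA sB).1; rewrite -[iota A B]opprK -sE map_mxN mulNmx s0.
move=> /esym; rewrite -scaleN1r => /(scale_fix (model0_model R m).1)/eqP.
by rewrite eq_sym -subr_eq0 opprK (negbTE (two_neq0C R)).
Qed.

End Stabiliser.

(** * Smooth adapted frames *)

Section Definite.
Variables (R : realType) (n : nat).
Implicit Types (v w : 'cV[R]_(n + n)) (G P : 'M[R]_(n + n)).
Let two_neq0 : (2 : R) != 0. Proof. by rewrite pnatr_eq0. Qed.

Lemma inner_sumr (I : Type) (r : seq I) (p : pred I) v (f : I -> 'cV[R]_(n + n)) :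
  inner v (\sum_(i <- r | p i) f i) = \sum_(i <- r | p i) inner v (f i).
Proof. by apply: (big_morph (inner v) (@innerDr _ _ v) (inner0r v)). Qed.

Lemma outer_gramE (c a z : 'cV[R]_(n + n)) (A : 'M[R]_(n + n)) :
  c *m a^T *m gram R n *m A *m z = inner a (A *m z) *: c.
Proof. by rewrite -!(mulmxA c) -mul_mx_scalar /inner -mulmxA -mx11_scalar. Qed.

Lemma norm_innerE w v : inner (w + v) (w + v) = inner w w + 2 * inner w v + inner v v.
Proof. by rewrite !(innerDl, innerDr) (innerC v w); ring. Qed.

(** On a definite subspace the Gram matrix [K] of a basis is invertible, which yields the orthogonal
    projection. *)
Lemma positive_definite_proj (V : {vspace 'cV[R]_(n + n)}) v : positive_definite V ->
  exists2 a, a \in V & forall w, w \in V -> inner (v - a) w = 0.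
Proof.
move=> Vp; pose A : 'M[R]_(n + n, \dim V) := \matrix_(i, j) (vbasis V)`_j i 0.
have AE (x : 'cV[R]_(\dim V)) : A *m x = \sum_j x j 0 *: (vbasis V)`_j.
  apply/colP => i; rewrite mxE summxE; apply: eq_bigr => j _.
  by rewrite !mxE mulrC.
have AV x : A *m x \in V.
  by rewrite AE memv_suml // => j _; rewrite memvZ // vbasis_mem // mem_nth // size_tuple.
have VA w : w \in V -> exists x, w = A *m x.
  move=> wV; exists (\col_j coord (vbasis V) j w).
  by rewrite AE {1}(coord_vbasis wV); apply: eq_bigr => j _; rewrite mxE.
have A0 (x : 'cV[R]_(\dim V)) : A *m x = 0 -> x = 0.
  rewrite AE => x0; have /freeP fV := basis_free (vbasisP V).
  by apply/colP => j; rewrite (fV (fun j => x j 0) x0 j) mxE.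
pose K := A^T *m gram R n *m A.
have innerA (x y : 'cV[R]_(\dim V)) : inner (A *m x) (A *m y) = (x^T *m K *m y) 0 0.
  by rewrite /inner /K trmx_mul !mulmxA.
have uK : K \in unitmx.
  rewrite -row_free_unit -kermx_eq0; apply/eqP/row_matrixP => i; rewrite row0.
  have kK : row i (kermx K) *m K = 0 by rewrite -row_mul mulmx_ker row0.
  apply: trmx_inj; rewrite trmx0; apply: A0; apply/eqP; apply: contraT => z0.
  by have := Vp _ (AV _) z0; rewrite innerA trmxK kK mul0mx mxE ltxx.
pose a := A *m (invmx K *m (A^T *m gram R n *m v)).
exists a => [|w /VA[x ->]]; first exact: AV.
rewrite innerDl innerNl (innerC a) /a innerA innerC /inner trmx_mul.
by rewrite -[x^T *m K *m _]mulmxA mulKVmx // !mulmxA subrr.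
Qed.

(** The fixed space of [G] is [V], by projecting to [V]. A positive vector with eigenvalue -1 could
    be added to [V], against maximality, so the form is nonpositive there; a null vector then lies
    in the radical and vanishes by nondegeneracy. *)
Lemma generalised_metric_definite G : isom_mx G -> G *m G = 1%:M ->
    generalised_metric_at G ->
  (forall v, G *m v = v -> v != 0 -> 0 < inner v v) /\
  (forall v, G *m v = - v -> v != 0 -> inner v v < 0).
Proof.
move=> iG GG [V [[Vp Vmax] GV GVp]].
have pos v : G *m v = v -> v \in V.
  move=> Gv; have [a aV va] := positive_definite_proj v Vp.
  have := GVp _ va; rewrite mulmxBr Gv GV // => /eqP.
  rewrite -subr_eq0 opprK -mulr2n -scaler_nat scaler_eq0 (negbTE two_neq0) subr_eq0.
  by move=> /eqP ->.
split=> [v Gv v0|]; first by apply: Vp => //; exact: pos.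
have GN v w : G *m v = - v -> w \in V -> inner v w = 0.
  move=> Gv wV; have := iG v w; rewrite Gv (GV w wV) innerNl => E.
  by apply/eqP; rewrite -eqNr E.
have nonpos v : G *m v = - v -> inner v v <= 0.
  move=> Gv; rewrite leNgt; apply/negP => vv.
  have : v \in V.
    have vU : v \in (V + <[v]>)%VS by rewrite (subvP (addvSr _ _)) // memv_line.
    apply: (subvP (Vmax _ (addvSl V <[v]>) _) _ vU) => u /memv_addP[a aV [b /vlineP[k ->]] ->].
    rewrite norm_innerE !innerZr innerZl (innerC a v) (GN v a) // !mulr0 addr0 => n0.
    have [a0|a0] := eqVneq a 0.
      have k0 : k != 0 by apply: contra_neq n0 => ->; rewrite a0 scale0r addr0.
      by rewrite a0 inner0l add0r mulrA -expr2 mulr_gt0 // exprn_even_gt0.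
    by rewrite ltr_wpDr ?Vp // mulrA -expr2 mulr_ge0 ?sqr_ge0 // ltW.
  by move=> vV; have := vv; rewrite (GN v v) // ltxx.
move=> v Gv v0; rewrite lt_neqAle nonpos // andbT; apply/eqP => vv.
(* Cauchy-Schwarz for a semidefinite form: the test vector would have positive norm unless [b = 0].
   Dividing by [1 + a] rather than [a] covers the case of a null [w]. *)
have perp w : G *m w = - w -> inner v w = 0.
  move=> Gw; set b := inner v w; pose a := - inner w w.
  have a0 : 0 <= a by rewrite oppr_ge0 nonpos.
  have Gk : G *m (v + (b / (1 + a)) *: w) = - (v + (b / (1 + a)) *: w).
    by rewrite mulmxDr -scalemxAr Gv Gw scalerN opprD.
  have := nonpos _ Gk; rewrite norm_innerE vv add0r !(innerZl, innerZr) -/b.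
  have -> : inner w w = - a by rewrite opprK.
  have a1 : 0 < 1 + a by rewrite ltr_pwDl.
  have a1' : 1 + a != 0 by rewrite gt_eqF.
  have -> : 2 * (b / (1 + a) * b) + b / (1 + a) * (b / (1 + a) * - a) =
     b ^+ 2 * ((2 + a) / (1 + a) ^+ 2) by field.
  rewrite pmulr_lle0 ?divr_gt0 ?exprn_gt0 //; last by rewrite ltr_pwDl.
  by move=> bb; apply/eqP; rewrite -sqrf_eq0 eq_le bb sqr_ge0.
move/eqP: v0; apply; apply: inner_nondeg => // w.
have Gw : G *m (w - G *m w) = - (w - G *m w) by rewrite mulmxBr mulmxA GG mul1mx opprB.
have := perp _ Gw; rewrite innerDr innerNr.
have -> : inner v (G *m w) = - inner v w.
  by rewrite -iG mulmxA GG mul1mx Gv innerNl.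
by rewrite opprK -mulr2n -mulr_natl => /eqP; rewrite mulf_eq0 (negbTE two_neq0) => /eqP.
Qed.

Lemma mxrank_inj p q r (A : 'M[R]_(p, q)) (B : 'M[R]_(q, r)) :
  (forall v : 'cV_r, A *m (B *m v) = 0 -> B *m v = 0) -> \rank B = \rank (A *m B).
Proof.
move=> AB; apply/eqP; rewrite eqn_leq mxrankM_maxr andbT; apply: mxrankS.
rewrite submxE; apply/eqP/matrixP => i j; set K := cokermx _.
have : B *m (K *m delta_mx j 0) = 0 :> 'cV_q.
  have cK : (A *m B) *m K = 0 := mulmx_coker _.
  by apply: AB; rewrite mulmxA mulmxA cK mul0mx.
by rewrite mulmxA -colE => /colP/(_ i); rewrite !mxE.
Qed.

(* A definite subspace meets the opposite model subspace trivially. *)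
Lemma mxrank_definite (eps : R) P : eps * eps = 1 ->
  (forall v, P *m v != 0 -> 0 < eps * inner (P *m v) (P *m v)) -> (\rank P <= n)%N.
Proof.
move=> ee Pp; pose K := invmx (polar R n).
pose L : 'M[R]_(n, n + n) := if eps == 1 then usubmx K else dsubmx K.
rewrite (@mxrank_inj _ _ _ L) ?rank_leq_row // => v Lv.
apply/eqP; apply: contraT => /Pp; have [X [Y E]] := pv_qv_span two_neq0 (P *m v).
have KE : K *m (P *m v) = col_mx X Y.
  by rewrite E -polarE mulKmx // polar_unit.
have sq (Z : 'cV[R]_n) : 0 <= (Z^T *m Z) 0 0.
  by rewrite mxE sumr_ge0 // => i _; rewrite mxE -expr2 sqr_ge0.
move: Lv; rewrite /L; have [e1|e1] := eqVneq eps 1.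
  rewrite mul_usub_mx KE col_mxKu => X0; rewrite E X0 /pv col_mx0 add0r inner_qv_qv //.
  by rewrite e1 mul1r oppr_gt0 ltNge sq.
rewrite mul_dsub_mx KE col_mxKd => Y0; rewrite E Y0 /qv oppr0 col_mx0 addr0 inner_pv_pv //.
have -> : eps = -1.
  have /eqP : eps ^+ 2 = 1 by rewrite expr2.
  by rewrite sqrf_eq1 (negbTE e1) => /eqP.
by rewrite mulN1r oppr_gt0 ltNge sq.
Qed.

Definition eigproj (eps : R) G := 2^-1 *: (1%:M + eps *: G).

Section EigenProjections.
Variables (G : 'M[R]_(n + n)).
Hypotheses (iG : isom_mx G) (GG : G *m G = 1%:M) (mG : generalised_metric_at G).

Lemma eigprojE eps v : eps * eps = 1 -> G *m (eigproj eps G *m v) = eps *: (eigproj eps G *m v).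
Proof.
move=> ee; rewrite /eigproj -scalemxAl -scalemxAr scalerA mulrC -scalerA; congr (_ *: _).
by rewrite mulmxDl mul1mx -scalemxAl mulmxDr -scalemxAr mulmxA GG mul1mx scalerDr scalerA ee
  scale1r addrC.
Qed.

Lemma eigproj_fix eps v : eps * eps = 1 -> G *m v = eps *: v -> eigproj eps G *m v = v.
Proof.
move=> ee Gv; rewrite /eigproj -scalemxAl mulmxDl mul1mx -scalemxAl Gv scalerA ee scale1r.
by rewrite -mulr2n -[v *+ 2]scaler_nat scalerA mulVf // scale1r.
Qed.

Lemma eigproj_inner eps v w : inner (eigproj eps G *m v) w = inner v (eigproj eps G *m w).
Proof.
have sG : inner (G *m v) w = inner v (G *m w) by rewrite -iG mulmxA GG mul1mx.
rewrite /eigproj -!scalemxAl !mulmxDl !mul1mx -!scalemxAl innerZl innerZr.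
by rewrite innerDl innerDr innerZl innerZr sG.
Qed.

Lemma eigproj_definite eps v : eps * eps = 1 -> eigproj eps G *m v = v -> v != 0 ->
  0 < eps * inner v v.
Proof.
move=> ee Pv v0; have [pos neg] := generalised_metric_definite iG GG mG.
have := eigprojE v ee; rewrite Pv => Gv.
have /eqP : eps ^+ 2 = 1 by rewrite expr2.
rewrite sqrf_eq1 => /orP[]/eqP e1; rewrite e1 in Gv *.
  by rewrite mul1r pos // Gv scale1r.
by rewrite mulN1r oppr_gt0 neg // Gv scaleN1r.
Qed.

(** Each eigenspace is definite, so of dimension at most [n], while the two projections add up to
    the identity, of rank [n + n]. *)
Lemma eigproj_rank eps : eps * eps = 1 -> (n <= \rank (eigproj eps G))%N.
Proof.
move=> ee; have le e : e * e = 1 -> (\rank (eigproj e G) <= n)%N.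
  move=> e1; apply: (mxrank_definite e1) => v; apply: eigproj_definite => //.
  by rewrite eigproj_fix // eigprojE.
have : (\rank (eigproj eps G + eigproj (- eps) G)%R <= \rank (eigproj eps G) + n)%N.
  by apply: (leq_trans (mxrank_add _ _)); rewrite leq_add2l le // mulrNN.
rewrite /eigproj -scalerDr addrACA scaleNr addrN addr0 -raddfD scale_scalar_mx mulVf //.
by rewrite mxrank1 leq_add2r.
Qed.

End EigenProjections.

End Definite.

Section GramSchmidt.
Variables (R : realType) (n p : nat).
Local Notation X := 'cV[R]_p.
Variables (x : X) (J P : X -> 'M[R]_(n + n)) (eps : R).
Hypotheses (sJ : smooth_mx_near x J) (sP : smooth_mx_near x P) (ee : eps * eps = 1).

(** [P] stands for the projection on V^+ when [eps = 1], on V^- when [eps = -1]. *)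
Definition hermitian_at y :=
  [/\ complex_structure (J y), J y *m P y = P y *m J y, P y *m P y = P y,
      forall v w, inner (P y *m v) w = inner v (P y *m w)
    & forall v, P y *m v = v -> v != 0 -> 0 < eps * inner v v].

(** A unitary frame of the image of [P] for the structure [J]. Indices are natural numbers so that
    the frame can grow by one vector at a time. *)
Definition frame_at k (u : nat -> X -> 'cV[R]_(n + n)) y :=
  forall i j, (i < k)%N -> (j < k)%N ->
  [/\ P y *m u j y = u j y, inner (u i y) (u j y) = eps * (i == j)%:R
    & inner (u i y) (J y *m u j y) = 0].

Definition residue (k : nat) (u : nat -> X -> 'cV[R]_(n + n)) v y :=
  P y *m v - \sum_(j < k) ((eps * inner (u j y) (P y *m v)) *: u j y +
    (eps * inner (J y *m u j y) (P y *m v)) *: (J y *m u j y)).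

Lemma inner_J_skew (K : 'M[R]_(n + n)) v w : complex_structure K ->
  inner (K *m v) w = - inner v (K *m w).
Proof. by move=> [iK KK]; rewrite -iK mulmxA KK mulNmx mul1mx innerNl. Qed.

Lemma residue_perp k u v y : hermitian_at y -> frame_at k u y ->
  [/\ P y *m residue k u v y = residue k u v y,
      forall i, (i < k)%N -> inner (u i y) (residue k u v y) = 0
    & forall i, (i < k)%N -> inner (u i y) (J y *m residue k u v y) = 0].
Proof.
move=> [csJ JP PP _ _] fu; have skew := inner_J_skew _ _ csJ.
have iJ a b : inner (J y *m a) (J y *m b) = inner a b by case: csJ.
have JJ a : J y *m (J y *m a) = - a by rewrite mulmxA csJ.2 mulNmx mul1mx.
split=> [|i ik|i ik].
- rewrite /residue mulmxBr mulmxA PP mulmx_sumr; congr (_ - _); apply: eq_bigr => j _.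
  have [Pu _ _] := fu j j (ltn_ord j) (ltn_ord j).
  by rewrite mulmxDr -!scalemxAr mulmxA -JP -mulmxA Pu.
- rewrite /residue innerDr innerNr inner_sumr (bigD1 (Ordinal ik)) //= big1 => [|j ji].
    have [_ uu uJ] := fu i i ik ik; rewrite addr0 innerDr !innerZr.
    by rewrite uu uJ mulr0 addr0 eqxx mulr1 mulrAC ee mul1r subrr.
  have [_ uu uJ] := fu i j ik (ltn_ord j).
  have ij : (i == j) = false by apply/negbTE; rewrite eq_sym; apply: contra_neq ji => ji; apply: val_inj.
  by rewrite innerDr !innerZr uu uJ ij !mulr0 addr0.
- rewrite -[LHS]opprK -skew /residue innerDr innerNr inner_sumr (bigD1 (Ordinal ik)) //= big1 => [|j ji].
    have [_ uu uJ] := fu i i ik ik; rewrite addr0 innerDr !innerZr iJ uu.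
    by rewrite (skew (u i y) (u i y)) uJ oppr0 mulr0 add0r eqxx mulr1 mulrAC ee mul1r subrr oppr0.
  have [_ uu uJ] := fu i j ik (ltn_ord j).
  have ij : (i == j) = false by apply/negbTE; rewrite eq_sym; apply: contra_neq ji => ji; apply: val_inj.
  by rewrite innerDr !innerZr iJ uu (skew (u i y) (u j y)) uJ ij !(mulr0, oppr0) addr0.
Qed.

(** If every residue vanished, [P x] would be a sum of [k + k] matrices of rank at most one. *)
Lemma residue_neq0 k u : (k + k < \rank (P x))%N -> exists v, residue k u v x != 0.
Proof.
move=> kP; apply: contrapT => /forallNP r0; move: kP; rewrite ltnNge => /negP; apply.
pose W : 'M[R]_(n + n) := \sum_(j < k) eps *: (u j x *m (u j x)^T *m gram R n *m P x +
   J x *m u j x *m (J x *m u j x)^T *m gram R n *m P x).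
have -> : P x = W.
  apply/matrixP => a b; rewrite -[P x]mulmx1 -[W]mulmx1.
  have /eqP : residue k u (delta_mx b 0) x = 0 by apply/eqP/negP => /negP; exact: r0.
  rewrite /residue subr_eq0 => /eqP E.
  suff : P x *m delta_mx b 0 = W *m delta_mx b 0 :> 'cV_(n + n).
    by rewrite !mulmx1 -!colE => /colP/(_ a); rewrite !mxE.
  rewrite E /W mulmx_suml; apply: eq_bigr => j _.
  rewrite -scalemxAl mulmxDl scalerDr -!scalerA; congr (_ *: _ + _ *: _).
    by rewrite outer_gramE.
  by rewrite outer_gramE.
have rk1 (c : 'cV[R]_(n + n)) (r : 'rV[R]_(n + n)) : (\rank (c *m r) <= 1)%N.
  exact: leq_trans (mxrankM_maxl _ _) (rank_leq_col _).
have -> : (k + k = \sum_(j < k) 2)%N by rewrite sum_nat_const card_ord muln2 addnn.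
rewrite /W; elim/big_ind2: _ => [|A a B b Aa Bb|j _]; first by rewrite mxrank0.
  exact: leq_trans (mxrank_add _ _) (leq_add Aa Bb).
apply: leq_trans (mxrank_scale _ _) _; apply: leq_trans (mxrank_add _ _) _.
by rewrite -!(mulmxA _ (_^T)) -!(mulmxA _ (_ *m _)) (leq_add (rk1 _ _) (rk1 _ _)).
Qed.

(** The new vector is the normalised residue of a constant vector that works at [x]; its norm keeps
    the sign of [eps] nearby, so the square root is smooth. *)
Lemma gram_schmidt k : (k + k <= \rank (P x))%N -> (\forall y \near x, hermitian_at y) ->
  exists2 u, (forall i, (i < k)%N -> smooth_mx_near x (u i)) & \forall y \near x, frame_at k u y.
Proof.
move=> + nH; elim: k => [_|k IH kP].
  by exists (fun _ _ => 0) => //; apply: near_all.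
have kP' : (k + k < \rank (P x))%N by apply: leq_trans kP; rewrite addSn addnS.
have [u su nu] := IH (ltnW kP'); have [v v0] := residue_neq0 u kP'.
pose w := residue k u v; pose q y := eps * inner (w y) (w y).
have sw : smooth_mx_near x w.
  have sPv : smooth_mx_near x (fun y => P y *m v) by apply: smxM => //; apply: smx_cst.
  apply: smxB => //; apply: smx_sum => j; have suj := su j (ltn_ord j).
  have sJu : smooth_mx_near x (fun y => J y *m u j y) by apply: smxM.
  by apply: smxD; apply: smxZ => //; apply: snM; (try exact: sn_cst); apply: sn_inner.
have sq : smooth_near x q by apply: snM; [exact: sn_cst|apply: sn_inner].
have q0 : 0 < q x.
  have Hx := nbhs_singleton nH; have [Pw _ _] := residue_perp v Hx (nbhs_singleton nu).
  by case: Hx => _ _ _ _; apply.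
exists (fun i y => if i == k then (Num.sqrt (q y))^-1 *: w y else u i y).
  move=> i; rewrite ltnS leq_eqVlt => /orP[->|ik]; last by rewrite ltn_eqF //; apply: su.
  apply: smxZ => //; apply: snV; first by rewrite gt_eqF // sqrtr_gt0.
  exact: sn_sqrt.
near=> y.
have Hy : hermitian_at y by near: y.
have fy : frame_at k u y by near: y.
have qy : 0 < q y by near: y; apply: smooth_near_gt0.
have [Pw uw uJw] := residue_perp v Hy fy; rewrite -/(w y) in Pw uw uJw.
have s0 : Num.sqrt (q y) != 0 by rewrite gt_eqF // sqrtr_gt0.
have [csJ _ _ _ _] := Hy; have skew a b := inner_J_skew a b csJ.
have antisym a : inner a (J y *m a) = 0.
  have : inner a (J y *m a) = - inner a (J y *m a) by rewrite -{1}skew innerC.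
  by move=> /eqP; rewrite -subr_eq0 opprK -mulr2n mulrn_eq0 => /eqP.
have ww : inner ((Num.sqrt (q y))^-1 *: w y) ((Num.sqrt (q y))^-1 *: w y) = eps.
  rewrite innerZl innerZr mulrA -invfM -expr2 sqr_sqrtr ?ltW // /q invfM.
  have ee1 : eps != 0 by apply: contra_eq_neq ee => ->; rewrite mul0r eq_sym oner_eq0.
  have w0 : inner (w y) (w y) != 0 by apply: contraTneq qy => E; rewrite /q E mulr0 ltxx.
  by rewrite divfK // -[LHS]mulr1 -ee mulKf.
move=> i j; rewrite ltnS leq_eqVlt => /orP[/eqP->|ik]; rewrite ltnS leq_eqVlt => /orP[/eqP->|jk].
- by rewrite eqxx -!scalemxAr Pw ww mulr1 innerZr innerZl antisym !mulr0.
- have [Pu _ _] := fy j j jk jk; rewrite eqxx (ltn_eqF jk) (gtn_eqF jk) Pu innerZl innerC uw //.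
  by rewrite innerZl innerC skew uJw // oppr0 !mulr0.
- rewrite eqxx (ltn_eqF ik) -!scalemxAr Pw !innerZr uw //.
  by rewrite uJw // !mulr0.
- rewrite (ltn_eqF ik) (ltn_eqF jk).
  exact: fy.
Unshelve. all: by end_near.
Qed.

End GramSchmidt.

Section ModelFrame.
Variables (R : realType) (m : nat).
Local Notation T := (bool * bool * 'I_m)%type.
Local Notation V := 'cV[R]_((m + m) + (m + m)).
Implicit Types (i j : T) (a : T -> V).
Let two_neq0 : (2 : R) != 0. Proof. by rewrite pnatr_eq0. Qed.

(** The first boolean selects V^-, the second the imaginary direction. *)
Definition polar_basis i : V :=
  let e := if i.1.2 then er R i.2 else el R i.2 in if i.1.1 then qv e else pv e.

Lemma inner_polar_basis i j :
  inner (polar_basis i) (polar_basis j) = (-1) ^+ i.1.1 * (i == j)%:R.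
Proof.
case: i => [[s h] k]; case: j => [[s' h'] l]; rewrite -pair_eqE /= -pair_eqE /= /polar_basis /=.
by case: s; case: s'; case: h; case: h';
  rewrite ?inner_pv_pv ?inner_qv_qv ?inner_pv_qv ?(innerC (qv _)) ?inner_pv_qv //
   ?dot_el_el ?dot_er_er ?dot_el_er ?dot_er_el /= ?expr0 ?expr1 ?mul1r ?mulN1r ?oppr0.
Qed.

Lemma polar_basis_ext (A B : 'M[R]_((m + m) + (m + m))) :
  (forall i, A *m polar_basis i = B *m polar_basis i) -> A = B.
Proof.
move=> AB; suff AB0 v : (A - B) *m v = 0 :> 'cV_((m + m) + (m + m)).
  apply/eqP; rewrite -subr_eq0; apply/eqP/matrixP => i j.
  by have := AB0 (delta_mx j 0); rewrite -colE => /colP/(_ i); rewrite !mxE.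
move: v; apply: (polar_lin_eq0 two_neq0) => [u v|c v|k]; rewrite ?mulmxDr -?scalemxAr //.
have E i : (A - B) *m polar_basis i = 0 by rewrite mulmxBl AB subrr.
by have := (E (false, false, k), E (false, true, k), E (true, false, k), E (true, true, k));
  case=> -[[]].
Qed.

(** The linear map sending each [polar_basis i] to [a i]; the sign is the norm of [polar_basis i],
    by which coordinates are divided. *)
Definition frame_mx a : 'M[R]_((m + m) + (m + m)) :=
  \sum_(i : T) (-1) ^+ i.1.1 *: (a i *m (polar_basis i)^T *m gram R (m + m)).

Lemma frame_mxE a j : frame_mx a *m polar_basis j = a j.
Proof.
rewrite /frame_mx mulmx_suml (bigD1 j) //= big1 => [|i ij];
  rewrite -scalemxAl -[_ *m gram R _]mulmx1 outer_gramE mul1mx inner_polar_basis.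
  by rewrite eqxx mulr1 scalerA -expr2 sqrr_sign scale1r addr0.
by rewrite (negbTE ij) mulr0 scale0r scaler0.
Qed.

Lemma frame_mx_isom a :
  (forall i j, inner (a i) (a j) = (-1) ^+ i.1.1 * (i == j)%:R) -> isom_mx (frame_mx a).
Proof.
move=> aa; have span (v : V) : v = \sum_(i : T) ((-1) ^+ i.1.1 * inner (polar_basis i) v) *: polar_basis i.
  suff E : frame_mx polar_basis *m v = v.
    rewrite -{1}E /frame_mx mulmx_suml; apply: eq_bigr => i _.
    by rewrite -scalemxAl -[_ *m gram R _]mulmx1 outer_gramE mul1mx scalerA.
  rewrite (_ : frame_mx _ = 1%:M) ?mul1mx //; apply: polar_basis_ext => i.
  by rewrite frame_mxE mul1mx.
move=> v w; rewrite (span v) (span w) !mulmx_sumr !inner_sumr; apply: eq_bigr => j _.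
rewrite innerC [RHS]innerC !inner_sumr; apply: eq_bigr => i _.
by rewrite -!scalemxAr !frame_mxE !(innerZl, innerZr) aa inner_polar_basis.
Qed.

Lemma Jmx_polar_basis (t : R) (k : 'I_m) :
  [/\ Jmx m t *m polar_basis (false, false, k) = - polar_basis (false, true, k),
      Jmx m t *m polar_basis (false, true, k) = polar_basis (false, false, k),
      Jmx m t *m polar_basis (true, false, k) = - t *: polar_basis (true, true, k)
    & Jmx m t *m polar_basis (true, true, k) = t *: polar_basis (true, false, k)].
Proof.
have [Il Ir] : Imx R m *m el R k = er R k /\ Imx R m *m er R k = - el R k.
  rewrite /Imx /el /er !mul_block_col !(mulmx0, mul0mx, mul1mx, addr0, add0r) mulNmx mul1mx.
  by rewrite opp_col_mx oppr0.
have pvN (X : 'cV[R]_(m + m)) : pv (- X) = - pv X by rewrite -[- X]scaleN1r pvZ scaleN1r.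
have qvN (X : 'cV[R]_(m + m)) : qv (- X) = - qv X by rewrite -[- X]scaleN1r qvZ scaleN1r.
rewrite /polar_basis /Jmx /= !(split_mx_pv two_neq0) !(split_mx_qv two_neq0) !mulNmx -!scalemxAl.
rewrite Il Ir !pvN !qvN !qvZ qvN !opprK scalerN opprK scaleNr.
by [].
Qed.

End ModelFrame.

Section KahlerFrame.
Variables (R : realType) (m p : nat).
Local Notation X := 'cV[R]_p.
Local Notation n := (m + m)%N.
Variables (x : X) (J0 J1 : X -> 'M[R]_(n + n)).
Hypotheses (s0 : smooth_mx_near x J0) (s1 : smooth_mx_near x J1).

Definition kahler_at y := [/\ complex_structure (J0 y), complex_structure (J1 y),
  J0 y *m J1 y = J1 y *m J0 y & generalised_metric_at (- (J0 y *m J1 y))].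

Let G y := - (J0 y *m J1 y).

Lemma kahler_metric y : kahler_at y -> isom_mx (G y) /\ G y *m G y = 1%:M.
Proof.
move=> [[i0 J00] [i1 J11] J01 _]; split=> [v w|].
  by rewrite !mulNmx innerNl innerNr opprK -!mulmxA i0 i1.
rewrite /G mulNmx mulmxN opprK -mulmxA [J1 y *m _]mulmxA -J01 -mulmxA J11.
by rewrite !mulmxN mulmx1 J00 opprK.
Qed.

Lemma kahler_hermitian eps y : eps * eps = 1 -> kahler_at y ->
  hermitian_at J0 (fun z => eigproj eps (G z)) eps y.
Proof.
move=> ee ky; have [iG GG] := kahler_metric ky; have [cs0 _ J01 mG] := ky; split=> //.
- rewrite /eigproj -scalemxAl -scalemxAr mulmxDl mulmxDr mul1mx mulmx1 -scalemxAl -scalemxAr.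
  by rewrite /G mulmxN mulNmx J01 mulmxA J01.
- apply: (@polar_basis_ext _ m) => i; rewrite -mulmxA; apply: eigproj_fix => //.
  exact: eigprojE.
- by move=> v w; apply: eigproj_inner.
- by move=> v; apply: eigproj_definite.
Qed.

(** A frame adapted to [J0] on V^+ and V^- is adapted to [J1] too, because [J1 = J0 G] equals [J0]
    on V^+ and [- J0] on V^-. *)
Lemma kahler_frame : (\forall y \near x, kahler_at y) ->
  exists2 g, smooth_mx_near x g & \forall y \near x,
    [/\ isom_mx (g y), J0 y *m g y = g y *m Jmx m (-1) & J1 y *m g y = g y *m Jmx m 1].
Proof.
move=> nk; have kx := nbhs_singleton nk; have [iGx GGx] := kahler_metric kx.
have mGx : generalised_metric_at (G x) by case: kx.
have N1 : -1 * -1 = 1 :> R by rewrite mulrNN mulr1.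
have sP eps : smooth_mx_near x (fun y => eigproj eps (G y)).
  apply: smxZ; first exact: sn_cst.
  apply: smxD; first exact: smx_cst.
  by apply: smxZ; [exact: sn_cst|apply: smxN; apply: smxM].
have nH eps : eps * eps = 1 ->
    \forall y \near x, hermitian_at J0 (fun z => eigproj eps (G z)) eps y.
  by move=> ee; apply: filterS nk => y; apply: kahler_hermitian.
have [u su nu] := gram_schmidt s0 (sP 1) (mulr1 1)
  (eigproj_rank iGx GGx mGx (mulr1 1)) (nH _ (mulr1 1)).
have [u' su' nu'] := gram_schmidt s0 (sP (-1)) N1 (eigproj_rank iGx GGx mGx N1) (nH _ N1).
(* The signs follow the model of [J0], which takes [el] to [- er] in V^+ and to [er] in V^-. *)
pose a y (i : bool * bool * 'I_m) : 'cV[R]_(n + n) :=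
  if i.1.1 then if i.1.2 then J0 y *m u' i.2 y else u' i.2 y
  else if i.1.2 then - (J0 y *m u i.2 y) else u i.2 y.
exists (fun y => frame_mx (a y)).
  apply: smx_sum => -[[s h] k]; apply: smxZ; first exact: sn_cst.
  apply: smxM (smx_cst _ _); apply: smxM (smx_cst _ _); rewrite /a /=.
  have suk := su k (ltn_ord k); have suk' := su' k (ltn_ord k).
  by case: s; case: h => //; [apply: smxM|apply: smxN; apply: smxM].
near=> y.
have ky : kahler_at y by near: y.
have fu : frame_at J0 (fun z => eigproj 1 (G z)) 1 m u y by near: y.
have fu' : frame_at J0 (fun z => eigproj (-1) (G z)) (-1) m u' y by near: y.
have [[i0 J00] [i1 J11] J01 mG] := ky; have [iG GG] := kahler_metric ky.
have Gu k : G y *m u (k : 'I_m) y = u k y.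
  have [Pu _ _] := fu k k (ltn_ord k) (ltn_ord k); rewrite -Pu.
  by rewrite eigprojE ?mulr1 // scale1r.
have Gu' k : G y *m u' (k : 'I_m) y = - u' k y.
  have [Pu _ _] := fu' k k (ltn_ord k) (ltn_ord k); rewrite -Pu.
  by rewrite eigprojE // scaleN1r.
have JJ v : J0 y *m (J0 y *m v) = - v by rewrite mulmxA J00 mulNmx mul1mx.
have J1E v : J1 y *m v = J0 y *m (G y *m v).
  by rewrite /G mulNmx -mulmxA mulmxN JJ opprK.
have JG v : J0 y *m (G y *m v) = G y *m (J0 y *m v).
  have E : J0 y *m G y = G y *m J0 y by rewrite /G mulmxN mulNmx -[in RHS]mulmxA -J01.
  by rewrite mulmxA E mulmxA.
have skew v w : inner (J0 y *m v) w = - inner v (J0 y *m w).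
  by apply: inner_J_skew.
have perp v w : G y *m v = v -> G y *m w = - w -> inner v w = 0.
  move=> Gv Gw; have := iG v w; rewrite Gv Gw innerNr => /esym/eqP.
  by rewrite -subr_eq0 opprK -mulr2n mulrn_eq0 => /eqP.
have GJu k : G y *m (J0 y *m u (k : 'I_m) y) = J0 y *m u k y by rewrite -JG Gu.
have GJu' k : G y *m (J0 y *m u' (k : 'I_m) y) = - (J0 y *m u' k y) by rewrite -JG Gu' mulmxN.
split.
- apply: frame_mx_isom => -[[s h] k] [[s' h'] l].
  have [_ uu uJ] := fu k l (ltn_ord k) (ltn_ord l).
  have [_ uu' uJ'] := fu' k l (ltn_ord k) (ltn_ord l).
  rewrite -pair_eqE /= -pair_eqE /= /a /=.
  case: s; case: s'; rewrite /= ?mulr0.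
  + case: h; case: h'; rewrite /= ?i0 ?skew ?uu' ?uJ' ?oppr0 ?mulr0 ?expr1 //.
  + by case: h; case: h'; rewrite innerC ?innerNl perp ?oppr0.
  + by case: h; case: h'; rewrite ?innerNl perp ?oppr0.
  case: h; case: h'; rewrite /= ?(innerNl, innerNr) ?opprK ?i0 ?skew ?uu ?uJ ?oppr0 ?mulr0 ?expr0 //.
- apply: polar_basis_ext => -[[s h] k]; rewrite -!mulmxA !frame_mxE.
  have [Eff Eft Etf Ett] := Jmx_polar_basis (-1 : R) k.
  case: s; case: h; rewrite ?(Eff, Eft, Etf, Ett) ?mulmxN -?scalemxAr ?frame_mxE /a /=.
  + by rewrite JJ scaleN1r.
  + by rewrite opprK scale1r.
  + by rewrite JJ opprK.
  + by rewrite opprK.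
- apply: polar_basis_ext => -[[s h] k]; rewrite -!mulmxA !frame_mxE J1E.
  have [Eff Eft Etf Ett] := Jmx_polar_basis (1 : R) k.
  case: s; case: h; rewrite ?(Eff, Eft, Etf, Ett) ?mulmxN -?scalemxAr ?frame_mxE /a /=.
  + by rewrite GJu' ?mulmxN JJ opprK scale1r.
  + by rewrite Gu' ?mulmxN scaleN1r.
  + by rewrite GJu ?mulmxN JJ opprK.
  + by rewrite Gu opprK.
Unshelve. all: by end_near.
Qed.

End KahlerFrame.

Lemma sqr_unitE (F : comNzRingType) (h h' w r : F) :
  h = w * h' -> r * r * (h * h') = 1 -> h * h * (r * r) = w.
Proof.
move=> hE rr; transitivity (w * (r * r * (h * h'))); last by rewrite rr mulr1.
by rewrite {2}hE; ring.
Qed.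

Lemma scale_eigen (F : comNzRingType) n (S A : 'M[F]_n) (v : 'cV[F]_n) r u :
  A *m v = u *: v -> r *: (S *m A *m v) = (r * u) *: (S *m v).
Proof. by move=> Av; rewrite -mulmxA Av -scalemxAr scalerA. Qed.

Lemma eigenM (F : comNzRingType) n (A B : 'M[F]_n) (v : 'cV[F]_n) a b :
  A *m v = a *: v -> B *m v = b *: v -> A *m B *m v = (b * a) *: v.
Proof. by move=> Av Bv; rewrite -mulmxA Bv -scalemxAr Av scalerA. Qed.

(** * Smooth scalar factors and adapted local sections *)

Section SmoothSections.
Variables (R : realType) (m p : nat).
Local Notation X := 'cV[R]_p.
Local Notation C := R[i].
Local Notation N := (fdim (m + m)).
Local Notation cx := (map_mx (real_complex R)).
Local Notation ii := (Complex 0 1 : C).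
Local Notation m0 := (model0 R m).
Local Notation m1 := (model1 R m).
Variable x : X.

(* With e^2 = w(x), the root is e (1 + w / e^2) / |1 + w / e^2|. *)
Lemma unit_sqrt (w : X -> C) : csmooth_near x w -> (\forall y \near x, w y * conjc (w y) = 1) ->
  exists2 z, csmooth_near x z &
    \forall y \near x, z y * z y = w y /\ z y * conjc (z y) = 1.
Proof.
move=> sw nw; have [e ee] : exists e : C, e * e = w x by exists (sqrtC (w x)); rewrite -expr2 sqrtCK.
have e1 : e * conjc e = 1.
  have E : toC (sqr_norm e) ^+ 2 = 1 :> C.
    by rewrite sqr_normE expr2 mulrACA -rmorphM ee (nbhs_singleton nw).
  rewrite -sqr_normE; have : sqr_norm e ^+ 2 = 1.
    by apply: (fmorph_inj (real_complex R)); rewrite rmorphXn rmorph1.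
  move/eqP; rewrite sqrf_eq1 => /orP[/eqP->|/eqP E1]; first exact: rmorph1.
  have : e != 0 by apply: contra_eq_neq E => ->; rewrite /sqr_norm /= mulr0 addr0 rmorph0 expr2 mul0r eq_sym oner_eq0.
  by move/sqr_norm_gt0; rewrite E1 oppr_gt0 ltr10.
pose w' y := w y * (conjc e * conjc e); pose h y := 1 + w' y.
have sh : csmooth_near x h by apply: csnD; [exact: csn_cst|apply: csnM; [|exact: csn_cst]].
have ce : conjc e * e = 1 by rewrite mulrC.
have hx : h x != 0.
  by rewrite /h /w' -ee mulrACA e1 mulr1 (two_neq0C R).
have Nx := sqr_norm_gt0 hx; have sN := sn_sqr_norm sh.
exists (fun y => e * h y * toC (Num.sqrt (sqr_norm (h y)))^-1).
  apply: csnM; first by apply: csnM; [exact: csn_cst|].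
  by apply: csn_real; apply: snV; [rewrite gt_eqF // sqrtr_gt0|apply: sn_sqrt].
near=> y.
have wy : w y * conjc (w y) = 1 by near: y.
have Ny : 0 < sqr_norm (h y) by near: y; apply: smooth_near_gt0.
set r := toC _; have rc : conjc r = r by rewrite conj_toC.
have rr : r * r * (h y * conjc (h y)) = 1.
  rewrite -sqr_normE -!rmorphM -invfM -expr2 sqr_sqrtr ?ltW // mulVf ?gt_eqF //.
clearbody r.
have hE : h y = w' y * conjc (h y).
  rewrite /h rmorphD rmorph1 mulrDr mulr1 addrC; congr (_ + _).
  have cw : conjc (w' y) = conjc (w y) * (e * e) by rewrite /w' rmorphM rmorphM /= conjcK.
  by rewrite [X in _ * X]cw /w' mulrACA wy mul1r mulrACA ce mulr1.
have h2 : h y * h y * (r * r) = w' y.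
  exact: sqr_unitE hE rr.
split.
  rewrite mulrACA (mulrACA e) -mulrA h2 /w' mulrC -mulrA (mulrACA (conjc e)) ce mulr1.
  by rewrite ?mulr1.
have -> : conjc (e * h y * r) = conjc e * conjc (h y) * r by rewrite rmorphM rmorphM /= rc.
by rewrite mulrACA (mulrACA e) e1 mul1r mulrC.
Unshelve. all: by end_near.
Qed.

(* A rotor in V^+ multiplies (m_0, m_1) by (z, z) and one in V^- by (v^*, v);
   hence z^2 = u_0 u_1 and v = u_1 / z. *)
Lemma smooth_rotation (u0 u1 : X -> C) : (0 < m)%N ->
    csmooth_near x u0 -> csmooth_near x u1 ->
    (\forall y \near x, u0 y * conjc (u0 y) = 1 /\ u1 y * conjc (u1 y) = 1) ->
  exists2 q : X -> 'M[R]_N, smooth_mx_near x q & \forall y \near x,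
    [/\ Pin false (q y), cx (q y) *m m0 = u0 y *: m0 & cx (q y) *m m1 = u1 y *: m1].
Proof.
move=> m_gt0 su0 su1 nu.
have [|z sz nz] := unit_sqrt (csnM su0 su1).
  by apply: filterS nu => y [e0 e1]; rewrite rmorphM mulrACA e0 e1 mulr1.
pose v y := u1 y * conjc (z y).
have sv : csmooth_near x v by apply: csnM => //; apply: csn_conj.
pose k := Ordinal m_gt0.
pose a y := rotor (pv (el R k)) (pv (er R k)) (complex.Re (z y)) (- complex.Im (z y)).
pose b y := rotor (qv (el R k)) (qv (er R k)) (complex.Re (v y)) (complex.Im (v y)).
have srot (s t : 'cV[R]_((m + m) + (m + m))) c d : smooth_near x c -> smooth_near x d ->
    smooth_mx_near x (fun y => rotor s t (c y) (d y)).
  move=> sc sd; apply: smxD; last by apply: smxZ => //; exact: smx_cst.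
  apply: smx_eq (smxZ sc (smx_cst _ 1%:M)); apply: near_all => y.
  by rewrite scalemx1.
exists (fun y => a y *m b y).
  by apply: smxM; apply: srot; [exact: sz.1|exact: snN sz.2|exact: sv.1|exact: sv.2].
near=> y.
have [e0 e1] : u0 y * conjc (u0 y) = 1 /\ u1 y * conjc (u1 y) = 1 by near: y.
have [zz z1] : z y * z y = u0 y * u1 y /\ z y * conjc (z y) = 1 by near: y.
have vc : conjc (v y) = conjc (u1 y) * z y by rewrite /v rmorphM /= conjcK.
have v1 : v y * conjc (v y) = 1 by rewrite vc /v mulrACA e1 mul1r mulrC.
have unit (c : C) : c * conjc c = 1 ->
    complex.Re c * complex.Re c + complex.Im c * complex.Im c = 1.
  by rewrite -sqr_normE => /(congr1 (@complex.Re R)).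
have zu := unit _ z1; rewrite -[X in _ + X = _]mulrNN in zu.
have [pa a0 a1] := rotor_pv_models k zu; have [pb b0 b1] := rotor_qv_models k (unit _ v1).
have cE (c : C) : toC (complex.Re c) + toC (complex.Im c) * ii = c.
  by rewrite -ComplexE; case: c.
have cNE (c : C) : toC (complex.Re c) - toC (complex.Im c) * ii = conjc c.
  by rewrite -ComplexNE; case: c.
rewrite rmorphN mulNr opprK cE in a0 a1; rewrite cNE in b0; rewrite cE in b1.
split; first exact: (PinM pa pb).
- rewrite map_mxM (eigenM a0 b0) vc; congr (_ *: _).
  by rewrite -mulrA zz mulrCA [conjc _ * _]mulrC e1 mulr1.
- rewrite map_mxM (eigenM a1 b1); congr (_ *: _).
  by rewrite /v -mulrA [conjc _ * _]mulrC z1 mulr1.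
Unshelve. all: by end_near.
Qed.

Lemma Pin_parity_cx b b' (s : 'M[R]_N) (r : 'cV[C]_N) :
  Pin b s -> has_parity b' r -> has_parity (b (+) b') (cx s *m r).
Proof.
move=> ps br; move: b s ps; apply: Pin_ind => [|v b s _ _ IH]; first by rewrite map_mx1 mul1mx.
by rewrite map_mxM map_cliff -mulmxA -addTb -addbA addTb; apply: has_parity_cliff.
Qed.

Lemma Pin_spairing b (s : 'M[R]_N) : Pin b s -> exists2 e : R, e * e = 1 &
  forall r t : 'cV[C]_N, spairing (cx s *m r) (cx s *m t) = toC e * spairing r t.
Proof.
move=> ps; have [e e1 sK] := Pin_pairing (n_even m) ps; exists e => // r t.
have E : (cx s)^T *m pairing_mx C (m + m) *m cx s = toC e *: pairing_mx C (m + m).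
  by rewrite -(map_pairing (real_complex R)) map_trmx -!map_mxM sK map_mxZ.
by rewrite !spairingE trmx_mul -!mulmxA (mulmxA _ (pairing_mx _ _)) (mulmxA _ (cx s)) E
  -scalemxAl -scalemxAr mxE.
Qed.

Lemma csn_spairing (r t : X -> 'cV[C]_N) : csmooth_mx_near x r -> csmooth_mx_near x t ->
  csmooth_near x (fun y => spairing (r y) (t y)).
Proof.
move=> sr st; apply: csn_eq (csmxM (csmxM (csmx_tr sr) (csmx_cst _ (pairing_mx C _))) st 0 0).
by apply: near_all => y; rewrite spairingE.
Qed.

Section Coefficient.
Variables (t : R) (mod : 'cV[C]_N) (b : bool) (s : X -> 'M[R]_N) (g : X -> 'M[R]_((m + m) + (m + m))).
Hypotheses (tt : t * t = 1) (md : is_model ii (toC t) mod) (sg : smooth_lift x b s g).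

(** The coefficient exists pointwise because both spinors lie on one line. It is smooth as a
    quotient of pairings with the transported conjugate model, with which the transported model
    pairs nontrivially. *)
Lemma smooth_coefficient (J : X -> 'M[R]_((m + m) + (m + m))) rho :
    (\forall y \near x, J y *m g y = g y *m Jmx m t) ->
    (\forall y \near x, eigen_kills ii (cx (J y)) (rho y)) -> csmooth_mx_near x rho ->
  exists2 z, csmooth_near x z & \forall y \near x, rho y = z y *: (cx (s y) *m mod).
Proof.
move=> nJ nk srho; have [ss sg' nl] := sg.
have ttC : toC t * toC t = 1 :> C by rewrite -rmorphM tt.
have scx (c : 'cV[C]_N) : csmooth_mx_near x (fun y => cx (s y) *m c).
  by apply: csmxM; [exact: csmx_real|exact: csmx_cst].
pose q c y := spairing c (cx (s y) *m map_mx conjc mod).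
have D0 y : Pin b (s y) -> q (cx (s y) *m mod) y != 0.
  move=> ps; have [e e1 qE] := Pin_spairing ps; rewrite /q qE.
  have e0 : e != 0 by apply: contra_eq_neq e1 => ->; rewrite mul0r eq_sym oner_eq0.
  rewrite mulf_neq0 //; first by rewrite (fmorph_eq0 (real_complex R)).
  apply: (is_model_pairing (cj := conjc : {rmorphism C -> C}) (two_neq0C R) (ii_sqr R) ttC) => //.
    exact: conj_ii.
  exact: conj_toC.
exists (fun y => q (rho y) y * (q (cx (s y) *m mod) y)^-1).
  apply: csnM; first exact: csn_spairing.
  apply: csnV; last exact: csn_spairing.
  by apply: D0; have [] := nbhs_singleton nl.
near=> y.
have [ps cg ig] : [/\ Pin b (s y), tcovers b (s y) (g y) & isom_mx (g y)] by near: y.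
have Jg : J y *m g y = g y *m Jmx m t by near: y.
have ky : eigen_kills ii (cx (J y)) (rho y) by near: y.
have [s' [_ s's _]] := Pin_inv ps.
have sC : cx s' *m cx (s y) = 1%:M by rewrite -map_mxM s's map_mx1.
have JgC : cx (J y) *m cx (g y) = cx (g y) *m Jmx m (toC t).
  by rewrite -(map_Jmx (real_complex R)) -!map_mxM Jg.
have [c E] := is_model_transport (two_neq0C R) (ii_sqr R) ttC md sC (map_isom _ ig)
  (tcovers_cx cg) JgC ky.
rewrite E; congr (_ *: _); rewrite /q spairingZl mulfK //.
exact: D0 ps.
Unshelve. all: by end_near.
Qed.

End Coefficient.

Lemma smooth_modulus (z : X -> C) : csmooth_near x z -> (\forall y \near x, z y != 0) ->
  exists r u, [/\ smooth_near x r, csmooth_near x u & \forall y \near x,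
    [/\ 0 < r y, z y = toC (r y) * u y & u y * conjc (u y) = 1]].
Proof.
move=> sz nz; have Nx := sqr_norm_gt0 (nbhs_singleton nz).
have sr : smooth_near x (fun y => Num.sqrt (sqr_norm (z y))) by apply: sn_sqrt => //; apply: sn_sqr_norm.
exists (fun y => Num.sqrt (sqr_norm (z y))), (fun y => z y * toC (Num.sqrt (sqr_norm (z y)))^-1).
split=> //.
  by apply: csnM => //; apply: csn_real; apply: snV => //; rewrite gt_eqF // sqrtr_gt0.
apply: filterS nz => y zy; have Ny := sqr_norm_gt0 zy.
have r0 : Num.sqrt (sqr_norm (z y)) != 0 by rewrite gt_eqF // sqrtr_gt0.
split; first by rewrite sqrtr_gt0.
  by rewrite mulrCA -rmorphM mulfV // rmorph1 mulr1.
have -> (a : R) : conjc (z y * toC a) = conjc (z y) * toC a.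
  by rewrite rmorphM; congr (_ * _); exact: conj_toC.
rewrite mulrACA -sqr_normE -!rmorphM -invfM -expr2 sqr_sqrtr ?ltW //.
by rewrite mulfV ?gt_eqF // rmorph1.
Qed.

Lemma kahler_section (J0 J1 : X -> 'M[R]_((m + m) + (m + m))) (rho0 rho1 : X -> 'cV[C]_N) :
    (0 < m)%N -> smooth_mx_near x J0 -> smooth_mx_near x J1 ->
    csmooth_mx_near x rho0 -> csmooth_mx_near x rho1 ->
    (\forall y \near x, kahler_at J0 J1 y) ->
    (\forall y \near x, eigen_kills ii (cx (J0 y)) (rho0 y) /\ eigen_kills ii (cx (J1 y)) (rho1 y)) ->
    (\forall y \near x, rho0 y != 0 /\ rho1 y != 0) -> has_parity false (rho0 x) ->
  exists r0 r1 s, [/\ smooth_near x r0, smooth_near x r1, smooth_mx_near x s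
    & \forall y \near x, [/\ 0 < r0 y, 0 < r1 y, Spin (s y),
        rho0 y = toC (r0 y) *: (cx (s y) *m m0) & rho1 y = toC (r1 y) *: (cx (s y) *m m1)]].
Proof.
move=> m_gt0 sJ0 sJ1 srho0 srho1 nk nkill n0 par.
have [g sg ng] := kahler_frame sJ0 sJ1 nk.
have [|b [s lift]] := smooth_pin_lift sg; first by apply: filterS ng => y [].
have N1R : -1 * -1 = 1 :> R by rewrite mulrNN mulr1.
have [|||z0 sz0 nz0] := smooth_coefficient N1R (model0_modelC R m) lift (J := J0) (rho := rho0).
- by apply: filterS ng => y [].
- by apply: filterS nkill => y [].
- by [].
have [|||z1 sz1 nz1] := smooth_coefficient (mulr1 1) (model1_modelC R m) lift (J := J1) (rho := rho1).
- by apply: filterS ng => y [].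
- by apply: filterS nkill => y [].
- by [].
have [ss _ nl] := lift.
(* An odd lift would make [rho0 x] odd, while it is even and nonzero. *)
have b0 : b = false.
  have [ps _ _] := nbhs_singleton nl.
  have := Pin_parity_cx ps (@model0_parity R m); rewrite addbF => pb.
  apply: contraTF (nbhs_singleton n0).1 => b1; rewrite b1 in pb; apply/negPn/eqP/colP => i.
  rewrite -(enum_valK i) mxE; set S := enum_val i.
  have [oS|oS] := boolP (odd #|S|); first by apply: par; rewrite oS.
  by rewrite (nbhs_singleton nz0) mxE pb ?mulr0 // (negbTE oS).
have z0n : \forall y \near x, z0 y != 0.
  by apply: filterS2 n0 nz0 => y [+ _] E; apply: contra_neq => z0E; rewrite E z0E scale0r.
have z1n : \forall y \near x, z1 y != 0.
  by apply: filterS2 n0 nz1 => y [_ +] E; apply: contra_neq => z1E; rewrite E z1E scale0r.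
have [r0 [u0 [sr0 su0 nu0]]] := smooth_modulus sz0 z0n.
have [r1 [u1 [sr1 su1 nu1]]] := smooth_modulus sz1 z1n.
have [|q sq nq] := smooth_rotation m_gt0 su0 su1.
  by apply: filterS2 nu0 nu1 => y [_ _ ?] [].
exists r0, r1, (fun y => s y *m q y); split=> //; first exact: smxM.
near=> y.
have [r0y z0E _] : [/\ 0 < r0 y, z0 y = toC (r0 y) * u0 y & u0 y * conjc (u0 y) = 1] by near: y.
have [r1y z1E _] : [/\ 0 < r1 y, z1 y = toC (r1 y) * u1 y & u1 y * conjc (u1 y) = 1] by near: y.
have [pq q0 q1] : [/\ Pin false (q y), cx (q y) *m m0 = u0 y *: m0 & cx (q y) *m m1 = u1 y *: m1].
  by near: y.
have [ps _ _] : [/\ Pin b (s y), tcovers b (s y) (g y) & isom_mx (g y)] by near: y.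
have E0 : rho0 y = z0 y *: (cx (s y) *m m0) by near: y.
have E1 : rho1 y = z1 y *: (cx (s y) *m m1) by near: y.
split; [exact: r0y|exact: r1y| | |].
- by rewrite b0 in ps; apply/SpinE; exact: PinM ps pq.
- by rewrite E0 z0E map_mxM (scale_eigen _ _ q0).
- by rewrite E1 z1E map_mxM (scale_eigen _ _ q1).
Unshelve. all: by end_near.
Qed.

End SmoothSections.

(** * Adapted frames at a point *)

Section MetricOfSplitting.
Variables (R : realType) (n : nat) (G : 'M[R]_(n + n)).
Hypotheses (iG : isom_mx G) (GG : G *m G = 1%:M).
Hypothesis (Gp : forall v, G *m v = v -> v != 0 -> 0 < inner v v).
Hypothesis (Gn : forall v, G *m v = - v -> inner v v <= 0).

(** With [u], a larger positive definite [U] contains its component in the -1 eigenspace; the form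
    is not positive there, so this component is 0. *)
Lemma definite_generalised_metric : generalised_metric_at G.
Proof.
pose V := lker (linfun (mulmx (G - 1%:M)) : 'Hom('cV[R]_(n + n), 'cV[R]_(n + n))).
have VE v : (v \in V) = (G *m v == v).
  by rewrite memv_ker lfunE /= mulmxBl mul1mx subr_eq0.
have eP v : eigproj 1 G *m v \in V by rewrite VE eigprojE ?mulr1 // scale1r.
have P2 (v : 'cV[R]_(n + n)) : eigproj 1 G *m v + eigproj 1 G *m v = v + G *m v.
  rewrite -mulr2n -scaler_nat /eigproj -scalemxAl scalerA mulfV ?two_neq0R // !scale1r.
  by rewrite mulmxDl mul1mx.
have eN (v : 'cV[R]_(n + n)) : G *m (v - eigproj 1 G *m v) = - (v - eigproj 1 G *m v).
  rewrite mulmxBr eigprojE ?mulr1 // scale1r opprB; apply/eqP; rewrite subr_eq.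
  by rewrite addrAC P2 addrC addKr.
exists V; split.
- split=> [v|U VU Up]; first by rewrite VE => /eqP; exact: Gp.
  apply/subvP => u uU; pose w := u - eigproj 1 G *m u.
  have wU : w \in U by rewrite memvB // (subvP VU).
  have [w0|w0] := eqVneq w 0; first by move/eqP: w0; rewrite subr_eq0 => /eqP ->.
  by have := Up _ wU w0; rewrite ltNge (Gn (eN u)).
- by move=> v; rewrite VE => /eqP.
move=> v vV; have := eN v; suff -> : eigproj 1 G *m v = 0 by rewrite subr0.
apply/eqP; apply: contraT => n0; have := Gp _ n0; rewrite eigprojE ?mulr1 // scale1r => /(_ erefl).
have <- : inner v (eigproj 1 G *m v) = inner (eigproj 1 G *m v) (eigproj 1 G *m v).
  by rewrite [RHS]eigproj_inner // [in RHS]eigproj_fix ?mulr1 ?eigprojE ?mulr1.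
by rewrite vV // ltxx.
Qed.

End MetricOfSplitting.

Section Fibres.
Variables (R : realType) (m : nat).
Local Notation C := R[i].
Local Notation N := (fdim (m + m)).
Local Notation cx := (map_mx (real_complex R)).
Local Notation ii := (Complex 0 1 : C).
Local Notation m0 := (model0 R m).
Local Notation m1 := (model1 R m).
Local Notation frame := (R * 'M[R]_N)%type.
Implicit Types (r : R) (s : 'M[R]_N) (p q : frame) (rho : 'cV[C]_N).

Definition act (p : frame) rho := toC p.1 *: (cx p.2 *m rho).

(** Positivity of the scalar selects one of [(r, s)] and [(- r, - s)], which act alike on
    spinors. *)
Definition fibre rho0 rho1 : set frame :=
  [set p | [/\ 0 < p.1, Spin p.2, rho0 = act p m0 & rho1 = act p m1]].

Definition model_norm t : C := let mod := if t then m1 else m0 in spairing mod (map_mx conjc mod).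

Lemma model_norm_neq0 t : model_norm t != 0.
Proof.
have N1C : -1 * -1 = 1 :> C by rewrite mulrNN mulr1.
rewrite /model_norm; case: t.
  apply: (is_model_pairing (cj := conjc : {rmorphism C -> C}) (two_neq0C R) (ii_sqr R)
    (mulr1 1) (conj_ii R) _ (model1_model R m)); exact: rmorph1.
apply: (is_model_pairing (cj := conjc : {rmorphism C -> C}) (two_neq0C R) (ii_sqr R)
  N1C (conj_ii R) _ (model0_model R m)); exact: rmorphN1.
Qed.

Lemma spairing_act s : Spin s -> exists2 e : R, e * e = 1 &
  forall r rho, spairing (act (r, s) rho) (map_mx conjc (act (r, s) rho)) =
    toC (r * r * e) * spairing rho (map_mx conjc rho).
Proof.
move=> /SpinE ps; have [e e1 E] := Pin_spairing ps; exists e => // r rho.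
rewrite /act map_mxZ map_mxM conj_cx spairingZl spairingZr E.
by rewrite [X in _ * (X * _)](conj_toC r) !mulrA !rmorphM.
Qed.

(** The pairing of [rho0] with its conjugate is [r^2] times a sign times a fixed number; fourth
    powers remove the sign, and positivity recovers [r]. *)
Lemma fibre_norm p q rho0 rho1 : fibre rho0 rho1 p -> fibre rho0 rho1 q -> p.1 = q.1.
Proof.
case: p => r s; case: q => r' s' [p0 ps E0 _] [q0 qs F0 _].
have [e e1 E] := spairing_act ps; have [f f1 F] := spairing_act qs.
have := congr1 (fun v => spairing v (map_mx conjc v)) (etrans (esym E0) F0).
rewrite E F => /(mulIf (model_norm_neq0 false))/(fmorph_inj (real_complex R)) ef.
have pq : r ^+ 2 ^+ 2 = r' ^+ 2 ^+ 2.
  have := congr1 (fun z => z * z) ef; rewrite mulrACA e1 [in RHS]mulrACA f1 !mulr1.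
  by rewrite !expr2.
apply/eqP; rewrite -(eqrXn2 (n := 2)) ?ltW // -(eqrXn2 (n := 2)) ?exprn_ge0 ?ltW //.
by rewrite pq.
Qed.

Variable iota : 'M[C]_m -> 'M[C]_m -> 'M[R]_N.
Hypotheses (m_gt0 : (0 < m)%N) (iota_lift : spin_lift iota).
Local Notation K := (SUxSU iota).

Lemma K_Spin k : K k -> Spin k.
Proof. by case: iota_lift => iS _ _ [A [B [sA sB ->]]]; exact: iS. Qed.

Lemma SU1 : SU (1%:M : 'M[C]_m).
Proof. by split; [exact: is_unitary1|exact: det1]. Qed.

Lemma SUM (A B : 'M[C]_m) : SU A -> SU B -> SU (A *m B).
Proof. by move=> [uA dA] [uB dB]; split; [exact: is_unitaryM|rewrite det_mulmx dA dB mulr1]. Qed.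

Lemma K_nonempty : exists k, K k.
Proof. by exists (iota 1%:M 1%:M), 1%:M, 1%:M; split=> //; exact: SU1. Qed.

Lemma K_mul k k' : K k -> K k' -> K (k *m k').
Proof.
case: iota_lift => _ _ iM [A [B [sA sB ->]]] [A' [B' [sA' sB' ->]]].
by exists (A *m A'), (B *m B'); split; [exact: SUM|exact: SUM|rewrite iM].
Qed.

Lemma act_K r s k : K k ->
  act (r, s *m k) m0 = act (r, s) m0 /\ act (r, s *m k) m1 = act (r, s) m1.
Proof.
by move=> /(SUxSU_models m_gt0 iota_lift)[k0 k1]; rewrite /act /= map_mxM -!mulmxA k0 k1.
Qed.

Lemma fibreM p k rho0 rho1 : K k -> fibre rho0 rho1 p -> fibre rho0 rho1 (p.1, p.2 *m k).
Proof.
case: p => r s Kk [p0 ps E0 E1]; have [k0 k1] := act_K r s Kk.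
by split; [exact: p0|exact: SpinM ps (K_Spin Kk)|rewrite k0; exact: E0|rewrite k1; exact: E1].
Qed.

(** The two scalars agree, so the quotient of the Spin components fixes both model spinors and lies
    in their stabiliser. *)
Lemma fibre_torsor p q rho0 rho1 : fibre rho0 rho1 p -> fibre rho0 rho1 q ->
  exists2 k, K k & q = (p.1, p.2 *m k).
Proof.
move=> fp fq; have pq := fibre_norm fp fq; have [p0 ps E0 E1] := fp; have [_ qs F0 F1] := fq.
have /SpinE /Pin_inv[s' [/SpinE ps' s'p ps's]] := ps.
exists (s' *m q.2); last by rewrite mulmxA ps's mul1mx pq; case: (q).
have p00 : toC p.1 != 0 :> C by rewrite (fmorph_eq0 (real_complex R)) gt_eqF.
have fix_ mod : act p mod = act q mod -> cx (s' *m q.2) *m mod = mod.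
  rewrite /act -pq => /(scalerI p00) E.
  by rewrite map_mxM -mulmxA -E mulmxA -map_mxM s'p map_mx1 mul1mx.
apply: (stabiliser m_gt0 iota_lift); first exact: SpinM.
  by apply: fix_; rewrite -E0.
by apply: fix_; rewrite -E1.
Qed.

End Fibres.

Lemma mulmx_conjM (F : comNzRingType) n (g h a b : 'M[F]_n) : h *m g = 1%:M ->
  g *m a *m h *m (g *m b *m h) = g *m (a *m b) *m h.
Proof. by move=> hg; rewrite !mulmxA -[g *m a *m h *m g]mulmxA hg mulmx1. Qed.

Lemma Jmx_mul (F : fieldType) m (t t' : F) : (2 : F) != 0 ->
  Jmx m t *m Jmx m t' = split_mx (- 1%:M) (- (t * t')%:M).
Proof.
move=> two0; rewrite /Jmx (split_mxM two0) !mulNmx !mulmxN !opprK -scalemxAl -scalemxAr.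
by rewrite Imx_sqr scalerA !scalerN scalemx1.
Qed.

Section AdaptedStructures.
Variables (R : realType) (m : nat).
Local Notation C := R[i].
Local Notation N := (fdim (m + m)).
Local Notation cx := (map_mx (real_complex R)).
Local Notation ii := (Complex 0 1 : C).
Local Notation m0 := (model0 R m).
Local Notation m1 := (model1 R m).
Local Notation T := 'M[R]_((m + m) + (m + m)).
Implicit Types (J g : T) (rho : 'cV[C]_N).
Let two0 := two_neq0R R.

Lemma complex_structure_cx J : complex_structure J -> complex_structure (cx J).
Proof.
move=> [iJ JJ]; split; first exact: map_isom.
by rewrite -map_mxM JJ map_mxN map_mx1.
Qed.

Lemma conj_kills_cx J rho : eigen_kills ii (cx J) rho -> eigen_kills (- ii) (cx J) (map_mx conjc rho).
Proof.
apply: (conj_kills (cj := conjc : {rmorphism C -> C}) _ (conj_ii R) (conj_cx J)).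
exact: conjcK.
Qed.

Lemma eigen_killsZ (c d : C) (J : 'M[C]_((m + m) + (m + m))) rho :
  eigen_kills c J rho -> eigen_kills c J (d *: rho).
Proof. by move=> Jr v Jv; rewrite -scalemxAr Jr ?scaler0. Qed.

Lemma real_structure_uniq J J' rho : complex_structure J -> complex_structure J' ->
  eigen_kills ii (cx J) rho -> eigen_kills ii (cx J') rho -> rho != 0 -> J = J'.
Proof.
move=> cJ cJ' Jr Jr' r0; apply: (@map_mx_inj _ _ (real_complex R)).
apply: (complex_structure_uniq (two_neq0C R) (ii_sqr R) (complex_structure_cx cJ)
  (complex_structure_cx cJ') Jr Jr' r0 (conj_kills_cx Jr) (conj_kills_cx Jr')).
by rewrite map_mx_eq0.
Qed.

Lemma transported_kills J g (s : 'M[R]_N) rho : isom_mx g -> covers s g ->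
  eigen_kills ii (cx J) rho -> eigen_kills ii (cx (g *m J *m isom_inv g)) (cx s *m rho).
Proof.
move=> ig /coversE sg Jr; have sgC v : cx s *m cliff v = 1 *: (cliff (cx g *m v) *m cx s) := tcovers_cx sg v.
have gi : cx (isom_inv g) = isom_inv (cx g).
  rewrite -[LHS]mulmx1 -(isom_invr (two_neq0C R) (map_isom (real_complex R) ig)) mulmxA.
  by rewrite -map_mxM (isom_invl two0 ig) map_mx1 mul1mx.
rewrite map_mxM [cx (g *m J)]map_mxM gi.
exact: (kills_transport (two_neq0C R) (mulr1 1) Jr (map_isom _ ig) sgC).
Qed.

Definition adapted rho0 rho1 J0 J1 := exists p g,
  [/\ [/\ p.1 != 0, Spin p.2, covers p.2 g & isom_mx g], rho0 = act p m0, rho1 = act p m1,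
      J0 = g *m Jmx m (-1) *m isom_inv g & J1 = g *m Jmx m 1 *m isom_inv g].

Lemma adapted_exists (p : R * 'M[R]_N) : p.1 != 0 -> Spin p.2 -> exists JJ : T * T, adapted (act p m0) (act p m1) JJ.1 JJ.2.
Proof.
move=> p0 ps; have /SpinE /Pin_covers[g ig /coversE sg] := ps.
by exists (g *m Jmx m (-1) *m isom_inv g, g *m Jmx m 1 *m isom_inv g), p, g.
Qed.

Let N1R : -1 * -1 = 1 :> R. Proof. by rewrite mulrNN mulr1. Qed.

Lemma act_neq0 (p : R * 'M[R]_N) rho : p.1 != 0 -> Spin p.2 -> rho != 0 -> act p rho != 0.
Proof.
move=> p0 /SpinE /Pin_inv[s' [_ s's _]] r0.
rewrite /act scaler_eq0 (fmorph_eq0 (real_complex R)) (negbTE p0) /=.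
apply: contra_neq r0 => E; rewrite -[rho]mul1mx -(map_mx1 (real_complex R)) -s's map_mxM.
by rewrite -mulmxA E mulmx0.
Qed.

Section Facts.
Variables (rho0 rho1 : 'cV[C]_N) (J0 J1 : T).
Hypothesis ad : adapted rho0 rho1 J0 J1.

Lemma adapted_complex : complex_structure J0 /\ complex_structure J1.
Proof.
have [p [g [[_ _ _ ig] _ _ -> ->]]] := ad.
by split; apply: complex_structure_conj => //; apply: Jmx_complex => //; rewrite mulr1.
Qed.

Lemma adapted_neq0 : rho0 != 0 /\ rho1 != 0.
Proof.
have [p [g [[p0 ps _ _] -> -> _ _]]] := ad.
by split; apply: act_neq0 => //; [case: (model0_model R m)|case: (model1_model R m)].
Qed.

Lemma adapted_kills : eigen_kills ii (cx J0) rho0 /\ eigen_kills ii (cx J1) rho1.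
Proof.
have [p [g [[_ _ pg ig] -> -> -> ->]]] := ad.
have k (t : R) mod : t * t = 1 -> is_model ii (toC t) mod ->
    eigen_kills ii (cx (g *m Jmx m t *m isom_inv g)) (act p mod).
  move=> tt md; apply: eigen_killsZ; apply: transported_kills => //.
  rewrite map_Jmx; apply: is_model_kills md; [exact: two_neq0C|exact: ii_sqr|].
  by rewrite -rmorphM tt rmorph1.
by split; apply: k; rewrite ?mulr1 //; [exact: model0_modelC|exact: model1_modelC].
Qed.

Lemma adapted_commute : J0 *m J1 = J1 *m J0.
Proof.
have [p [g [[_ _ _ ig] _ _ -> ->]]] := ad.
have := isom_invl two0 ig; move: (isom_inv g) => h hg.
rewrite (mulmx_conjM (Jmx m (-1)) (Jmx m 1) hg) (mulmx_conjM (Jmx m 1) (Jmx m (-1)) hg).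
by rewrite (Jmx_mul _ (-1) 1 two0) (Jmx_mul _ 1 (-1) two0) mulrC.
Qed.

(** Minus the product is the model metric transported by [g], so the signs of norms can be read off
    in the coordinates [pv X + qv Y]. *)
Lemma adapted_metric : generalised_metric_at (- (J0 *m J1)).
Proof.
have [p [g [[_ _ _ ig] _ _ J0E J1E]]] := ad.
have GE : - (J0 *m J1) = g *m split_mx 1%:M (- 1%:M) *m isom_inv g.
  rewrite J0E J1E; have := isom_invl two0 ig; move: (isom_inv g) => h hg.
  rewrite (mulmx_conjM _ _ hg) Jmx_mul // mulr1 raddfN opprK -mulNmx -mulmxN.
  by rewrite -split_mxN opprK.
have [[i0 J00] [i1 J11]] := adapted_complex.
have GG : - (J0 *m J1) *m - (J0 *m J1) = 1%:M.
  rewrite mulNmx mulmxN opprK -mulmxA [J1 *m _]mulmxA -adapted_commute -mulmxA J11.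
  by rewrite !mulmxN mulmx1 J00 opprK.
have iG : isom_mx (- (J0 *m J1)).
  by move=> v w; rewrite !mulNmx innerNl innerNr opprK -!mulmxA i0 i1.
have gE v : exists X Y, v = g *m (pv X + qv Y).
  have [X [Y E]] := pv_qv_span two0 (isom_inv g *m v).
  by exists X, Y; rewrite -E mulmxA isom_invr // mul1mx.
have gG X Y : - (J0 *m J1) *m (g *m (pv X + qv Y)) = g *m (pv X - qv Y).
  rewrite GE; have := isom_invl two0 ig; move: (isom_inv g) => h hg.
  rewrite -[LHS]mulmxA [h *m _]mulmxA hg mul1mx -mulmxA mulmxDr.
  rewrite (split_mx_pv two0) (split_mx_qv two0) mul1mx mulNmx mul1mx.
  by rewrite -[- Y]scaleN1r qvZ scaleN1r.
have ginj u w : g *m u = g *m w -> u = w :> 'cV_((m + m) + (m + m)).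
  by move/(congr1 (mulmx (isom_inv g))); rewrite !mulmxA isom_invl // !mul1mx.
have dbl (u : 'cV[R]_((m + m) + (m + m))) : u = - u -> u = 0.
  by move/eqP; rewrite -subr_eq0 opprK -mulr2n -scaler_nat scaler_eq0 (negbTE two0) => /eqP.
have sq (Z : 'cV[R]_(m + m)) : 0 <= (Z^T *m Z) 0 0.
  by rewrite mxE sumr_ge0 // => i _; rewrite mxE -expr2 sqr_ge0.
have sq0 (Z : 'cV[R]_(m + m)) : (Z^T *m Z) 0 0 = 0 -> Z = 0.
  rewrite mxE => /eqP; rewrite psumr_eq0 => [/allP Z0|i _]; last by rewrite mxE -expr2 sqr_ge0.
  by apply/colP => i; have /eqP := Z0 i (mem_index_enum i); rewrite !mxE => /eqP; rewrite mulf_eq0 orbb => /eqP.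
apply: definite_generalised_metric => // v; have [X [Y ->]] := gE v; rewrite gG => E.
  move: E => /ginj/addrI/esym/dbl Y0; rewrite Y0 addr0 ig inner_pv_pv //.
  move=> X0; rewrite lt_neqAle sq andbT eq_sym; apply: contra_neq X0 => /sq0 ->.
  by rewrite /pv col_mx0 mulmx0.
have X0 : pv X = 0.
  apply: dbl; apply: (addIr (- qv Y)); rewrite -opprD; apply: ginj.
  by rewrite E mulmxN.
by rewrite X0 add0r ig inner_qv_qv // oppr_le0.
Qed.

End Facts.

End AdaptedStructures.

(** * Manifolds *)

Section Charts.
Variables (R : realType) (n : nat) (M : topologicalType) (I : Type).
Variable At : oriented_atlas R n M I.
Local Notation dom := (dom At).
Local Notation chart := (chart At).
Local Notation cochart := (cochart At).
Implicit Types (a b : I) (x : M) (V : set M).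

Lemma dom_open a : open (dom a). Proof. by case: At. Qed.

Lemma dom_cover x : exists a, dom a x. Proof. by case: At. Qed.

Lemma chart_dom_open a : open (chart a @` dom a). Proof. by case: At. Qed.

Lemma cochartK a x : dom a x -> cochart a (chart a x) = x. Proof. by case: At a x. Qed.

Lemma chart_continuous a x : dom a x -> {for x, continuous (chart a)}.
Proof. by case: At a x. Qed.

Lemma cochart_continuous a x : dom a x -> {for chart a x, continuous (cochart a)}.
Proof. by case: At a x. Qed.

Lemma transition_det_gt0 a b x : dom a x -> dom b x -> 0 < \det (transition At a b x).
Proof. by rewrite /transition; case: At a b x. Qed.

Lemma near_chart a V x : open V -> V x -> V `<=` dom a ->
  \forall y \near chart a x, V (cochart a y) /\ chart a (cochart a y) = y.
Proof.
move=> oV Vx Vd; have dx := Vd _ Vx.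
have nV : nbhs (cochart a (chart a x)) V.
  by rewrite cochartK //; apply: open_nbhs_nbhs.
have nd : nbhs (chart a x) (chart a @` dom a).
  by apply: open_nbhs_nbhs; split; [exact: chart_dom_open|exists x].
have nV' : \forall y \near chart a x, V (cochart a y) by exact: (cochart_continuous dx nV).
by apply: filterS2 nV' nd => y Vy [z dz zy]; split=> //; rewrite -zy cochartK.
Qed.

Lemma chart_image_open a V : open V -> V `<=` dom a -> open (chart a @` V).
Proof.
move=> oV Vd; rewrite openE => _ [x Vx <-].
apply: filterS (near_chart oV Vx Vd) => y [Vy <-].
by exists (cochart a y).
Qed.

Lemma chart_preimage_open a (U : set 'cV[R]_n) : open U -> open (dom a `&` chart a @^-1` U).
Proof.
move=> oU; rewrite openE => x [dx Ux]; apply: filterI.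
  by apply: open_nbhs_nbhs; split=> //; exact: dom_open.
by apply: (chart_continuous dx); apply: open_nbhs_nbhs.
Qed.

Lemma smooth_in_near a V f x : open V -> V x -> V `<=` dom a -> smooth_in At a V f ->
  smooth_near (chart a x) (f \o cochart a).
Proof. by move=> oV Vx Vd sf; exists (chart a @` V); split=> //; exact: chart_image_open. Qed.

Lemma near_smooth_in a V f : open V -> V `<=` dom a ->
  (forall x, V x -> smooth_near (chart a x) (f \o cochart a)) -> smooth_in At a V f.
Proof.
move=> oV Vd sf k; apply: Ck_local; first exact: chart_image_open.
by move=> _ [x /sf[U [oU Ux sU]] <-]; exists U; split.
Qed.

Lemma smooth_cmx_in_near a V x p q (f : M -> 'M[R[i]]_(p, q)) :
    open V -> V x -> V `<=` dom a -> smooth_cmx_in At a V f ->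
  csmooth_mx_near (chart a x) (f \o cochart a).
Proof.
move=> oV Vx Vd [sr si] i j; split.
  by apply: smooth_near_eq (smooth_in_near oV Vx Vd (sr i j)); apply: near_all => y; rewrite /= mxE.
by apply: smooth_near_eq (smooth_in_near oV Vx Vd (si i j)); apply: near_all => y; rewrite /= mxE.
Qed.

Lemma near_smooth_cmx_in a V p q (f : M -> 'M[R[i]]_(p, q)) : open V -> V `<=` dom a ->
  (forall x, V x -> csmooth_mx_near (chart a x) (f \o cochart a)) -> smooth_cmx_in At a V f.
Proof.
move=> oV Vd sf; split=> i j; apply: near_smooth_in => // x /sf sx.
  by apply: smooth_near_eq (sx i j).1; apply: near_all => y; rewrite /= mxE.
by apply: smooth_near_eq (sx i j).2; apply: near_all => y; rewrite /= mxE.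
Qed.

Lemma local_section a x p q (r : 'cV[R]_n -> R) (s : 'cV[R]_n -> 'M[R]_(p, q)) P : dom a x ->
    smooth_near (chart a x) r -> smooth_mx_near (chart a x) s ->
    (\forall y \near chart a x, P y) ->
  exists V : set M, [/\ open V, V x, V `<=` dom a & [/\ smooth_in At a V (r \o chart a),
    smooth_mx_in At a V (s \o chart a) & forall y, V y -> P (chart a y)]].
Proof.
move=> dx [U1 [oU1 U1x sr]] ss /nbhs_open[U3 [oU3 U3x PU]].
have [U2 [oU2 U2x {}ss]] := smooth_mx_near_on ss.
have oU : open (U1 `&` U2 `&` U3) by apply: openI => //; apply: openI.
exists (dom a `&` chart a @^-1` (U1 `&` U2 `&` U3)).
have oV := chart_preimage_open a oU.
have Vd : dom a `&` chart a @^-1` (U1 `&` U2 `&` U3) `<=` dom a by move=> y [].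
split=> //; split=> [|i j|y [_ [_ ?]]]; last exact: PU.
- apply: near_smooth_in => // y Vy; have [dy [[U1y U2y] U3y]] := Vy.
  apply: (@smooth_near_eq _ _ _ r); last by exists U1.
  by apply: filterS (near_chart oV Vy Vd) => z [_] /= ->.
apply: near_smooth_in => // y Vy; have [dy [[U1y U2y] U3y]] := Vy.
apply: (@smooth_near_eq _ _ _ (fun z => s z i j)); last by exists U2.
by apply: filterS (near_chart oV Vy Vd) => z [_] /= ->.
Qed.

End Charts.

Section Transitions.
Variables (R : realType) (n : nat) (M : topologicalType) (I : Type).
Variable At : oriented_atlas R n M I.
Variable B : I -> M -> 'M[R]_n.
Hypotheses (n_gt0 : (0 < n)%N) (n_even : ~~ odd n).
Hypothesis B_skew : forall a x, dom At a x -> (B a x)^T = - B a x.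

Lemma beta_skew a b x : dom At a x -> dom At b x -> (beta At B a b x)^T = - beta At B a b x.
Proof.
move=> ax bx; rewrite /beta linearB /= !trmx_mul trmxK !B_skew // mulNmx mulmxN mulmxA.
by rewrite opprB opprK addrC.
Qed.

Lemma S_trans_Spin a b x : dom At a x -> dom At b x -> Spin (S_trans At B a b x).
Proof.
move=> ax bx; apply: SpinM; first by apply: bfield_Spin => //; exact: beta_skew.
by apply: gl_Spin => //; exact: transition_det_gt0.
Qed.

Lemma E_trans_isom a b x : dom At a x -> dom At b x -> isom_mx (E_trans At B a b x).
Proof.
move=> ax bx; apply: isom_mxM; first by apply: bfield_isom; exact: beta_skew.
by apply: gl_isom; exact: transition_det_gt0.
Qed.

Lemma S_trans_covers a b x : dom At a x -> dom At b x ->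
  covers (S_trans At B a b x) (E_trans At B a b x).
Proof.
move=> ax bx; apply/coversE; rewrite -[false]/(false (+) false); apply: tcoversM; apply/coversE.
  by apply: bfield_covers => //; exact: beta_skew.
by apply: gl_covers; exact: transition_det_gt0.
Qed.

End Transitions.

Section FrameAction.
Variables (R : realType) (m : nat).
Local Notation C := R[i].
Local Notation N := (fdim (m + m)).
Local Notation cx := (map_mx (real_complex R)).
Local Notation m0 := (model0 R m).
Local Notation m1 := (model1 R m).
Implicit Types (r : R) (S s : 'M[R]_N) (rho : 'cV[C]_N).

Lemma act_mul S r s rho : act (r, S *m s) rho = cx S *m act (r, s) rho.
Proof. by rewrite /act map_mxM -mulmxA -[RHS]scalemxAr. Qed.

Lemma act_scale c r s rho : toC c *: act (r, s) rho = act (c * r, s) rho.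
Proof. by rewrite /act scalerA -(rmorphM (real_complex R)). Qed.

Lemma act_opp r s rho : act (- r, - s) rho = act (r, s) rho.
Proof. by rewrite /act /= map_mxN mulNmx scalerN (rmorphN (real_complex R)) scaleNr opprK. Qed.

Lemma fibre_mul S rho0 rho1 p : Spin S -> fibre rho0 rho1 p ->
  fibre (cx S *m rho0) (cx S *m rho1) (p.1, S *m p.2).
Proof.
case: p => r s SS [p0 ps E0 E1]; split; [exact: p0|exact: SpinM SS ps| |].
- by rewrite act_mul E0.
- by rewrite act_mul E1.
Qed.

End FrameAction.

Lemma norm_ratio (F : fieldType) (c n0 n1 a b e : F) : b != 0 -> e != 0 ->
  c * (a * a * e * n0) = b * b * e * n1 -> c * n0 * (a / b) ^+ 2 = n1.
Proof.
move=> b0 e0 E; apply: (mulfI e0); apply: (mulfI b0); apply: (mulfI b0).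
transitivity (b * b * e * n1); last by rewrite !mulrA.
by rewrite -E; field; rewrite b0.
Qed.

(** * From generalised Calabi-Yau metrics to reductions *)

Section Forward.
Variables (R : realType) (m : nat) (M : topologicalType) (I : Type).
Variables (At : oriented_atlas R (m + m) M I) (B : I -> M -> 'M[R]_(m + m)).
Variable iota : 'M[R[i]]_m -> 'M[R[i]]_m -> 'M[R]_(fdim (m + m)).
Hypotheses (m_gt0 : (0 < m)%N) (iota_lift : spin_lift iota).
Hypothesis B_skew : forall a x, dom At a x -> (B a x)^T = - B a x.
Local Notation C := R[i].
Local Notation N := (fdim (m + m)).
Local Notation cx := (map_mx (real_complex R)).
Local Notation ii := (Complex 0 1 : C).
Local Notation m0 := (model0 R m).
Local Notation m1 := (model1 R m).
Local Notation K := (SUxSU iota).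

Let n_gt0 : (0 < m + m)%N. Proof. by rewrite addn_gt0 m_gt0. Qed.

Section Metric.
Variables rho0 rho1 : I -> M -> 'cV[C]_N.
Hypothesis cy : generalised_CY_metric At B rho0 rho1.

Let spairing0 (v : 'cV[C]_N) : spairing 0 v = 0.
Proof. by rewrite spairingE trmx0 !mul0mx mxE. Qed.

Lemma CY_section a x : dom At a x ->
  exists r0 r1 s, [/\ smooth_near (chart At a x) r0, smooth_near (chart At a x) r1,
    smooth_mx_near (chart At a x) s & \forall y \near chart At a x,
      [/\ 0 < r0 y, 0 < r1 y, Spin (s y),
        rho0 a (cochart At a y) = act (r0 y, s y) m0 & rho1 a (cochart At a y) = act (r1 y, s y) m1]].
Proof.
move=> dx; have [[[s0 par0 _] _ n0] [[s1 _ _] _ n1] _ [J0 [J1 [ind0 ind1]]]] := cy.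
move=> [[[sJ0 _] iJ0 JJ0] [[sJ1 _] iJ1 JJ1] JC Jm].
have nd := near_chart (dom_open At a) dx (@subset_refl _ _).
have od := dom_open At a; have sd : dom At a `<=` dom At a by [].
apply: (@kahler_section R m _ (chart At a x) (J0 a \o cochart At a) (J1 a \o cochart At a)
  (rho0 a \o cochart At a) (rho1 a \o cochart At a)) => //.
- by move=> i j; apply: (smooth_in_near od dx sd (sJ0 a i j)).
- by move=> i j; apply: (smooth_in_near od dx sd (sJ1 a i j)).
- exact: smooth_cmx_in_near od dx sd (s0 a).
- exact: smooth_cmx_in_near od dx sd (s1 a).
- apply: filterS nd => y [dy _]; split.
  + by split; [move=> v w; exact: iJ0|exact: JJ0].
  + by split; [move=> v w; exact: iJ1|exact: JJ1].
  + exact: JC.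
  + exact: Jm.
- apply: filterS nd => y [dy _]; split=> v Jv.
  + by have /seteqP[+ _] := ind0 _ _ dy; apply.
  + by have /seteqP[+ _] := ind1 _ _ dy; apply.
- apply: filterS nd => y [dy _]; split.
  + by apply: contra_neq (n0 _ _ dy) => /= ->; exact: spairing0.
  + by apply: contra_neq (n1 _ _ dy) => /= ->; exact: spairing0.
- by rewrite /= cochartK //; exact: par0.
Qed.

Lemma CY_frame a x : dom At a x -> exists r0 r1 s,
  [/\ 0 < r0, 0 < r1, Spin s, rho0 a x = act (r0, s) m0 & rho1 a x = act (r1, s) m1].
Proof.
move=> dx; have [r0 [r1 [s [_ _ _ nE]]]] := CY_section dx.
by have := nbhs_singleton nE; rewrite cochartK // => E; exists (r0 (chart At a x)), (r1 (chart At a x)), (s (chart At a x)).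
Qed.

(** Both spinors share [s], hence the sign in their pairings; the norm condition then expresses
    [(r0 / r1)^2] through [c] and the model norms, independently of the point. *)
Lemma CY_ratio : exists2 lambda : R, 0 < lambda & forall a x r0 r1 s, dom At a x ->
  0 < r0 -> 0 < r1 -> Spin s -> rho0 a x = act (r0, s) m0 -> rho1 a x = act (r1, s) m1 ->
  r0 = lambda * r1.
Proof.
have [_ _ [c cE] _] := cy.
have key a x r0 r1 s : dom At a x -> 0 < r0 -> 0 < r1 -> Spin s ->
    rho0 a x = act (r0, s) m0 -> rho1 a x = act (r1, s) m1 ->
    c * model_norm R m false * toC ((r0 / r1) ^+ 2) = model_norm R m true.
  move=> dx r00 r10 ps E0 E1; have := cE _ _ dx; rewrite E0 E1.
  have [e e1 F] := spairing_act ps; rewrite !F => E.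
  have nz (z : R) : z != 0 -> toC z != 0 :> C by rewrite (fmorph_eq0 (real_complex R)).
  have e0 : e != 0 by apply: contra_eq_neq e1 => ->; rewrite mul0r eq_sym oner_eq0.
  rewrite (rmorphXn (real_complex R)) (fmorph_div (real_complex R)).
  apply: (norm_ratio (nz _ (lt0r_neq0 r10)) (nz _ e0)).
  by rewrite -!(rmorphM (real_complex R)).
have c0 a x : dom At a x -> c * model_norm R m false != 0.
  move=> dx; have [r0 [r1 [s [r00 r10 ps E0 E1]]]] := CY_frame dx.
  have := key _ _ _ _ _ dx r00 r10 ps E0 E1; apply: contra_eq_neq => ->.
  by rewrite mul0r eq_sym model_norm_neq0.
(* On an empty manifold any positive constant will do. *)
have [[x _]|noM] := pselect (exists x : M, True); last first.
  by exists 1 => // a x; case: noM; exists x.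
have [a dx] := dom_cover At x; have [r0 [r1 [s [r00 r10 ps E0 E1]]]] := CY_frame dx.
exists (r0 / r1) => [|b y r0' r1' s' dy r00' r10' ps' E0' E1']; first exact: divr_gt0.
have := key _ _ _ _ _ dx r00 r10 ps E0 E1; rewrite -(key _ _ _ _ _ dy r00' r10' ps' E0' E1').
move=> /(mulfI (c0 _ _ dx)) /(fmorph_inj (real_complex R)) /eqP.
rewrite eqrXn2 ?divr_ge0 ?ltW // => /eqP ->.
by rewrite divfK // gt_eqF.
Qed.

Theorem CY_structure : exists2 lambda : R, 0 < lambda &
  let Q a x := fibre (rho0 a x) (toC lambda *: rho1 a x) in
  [/\ generalised_SU_structure At B iota Q,
      invariant_pair At Q rho0 (fun a x => toC lambda *: rho1 a x)
    & forall Q', generalised_SU_structure At B iota Q' ->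
        invariant_pair At Q' rho0 (fun a x => toC lambda *: rho1 a x) -> same_action At Q Q'].
Proof.
have [lambda l0 lE] := CY_ratio; exists lambda => // Q.
have trans rho a b x : spinor_field At B rho.1 rho.2 -> dom At a x -> dom At b x ->
    rho.2 a x = cx (S_trans At B a b x) *m rho.2 b x.
  by case: rho => p rho [_ _ +]; apply.
have [[sf0 _ _] [sf1 _ _] _ _] := cy.
have Qtrans a b x p S : dom At a x -> dom At b x -> Spin S ->
    rho0 a x = cx S *m rho0 b x -> rho1 a x = cx S *m rho1 b x -> Q b x p ->
    Q a x (p.1, S *m p.2).
  move=> ax bx SS E0 E1 Qp; rewrite /Q E0 E1 [toC _ *: _]scalemxAr.
  exact: fibre_mul.
have Qsub a b x p : dom At a x -> dom At b x -> Q b x p -> Q a x (p.1, S_trans At B a b x *m p.2).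
  move=> ax bx; apply: Qtrans => //; first exact: S_trans_Spin (n_even m) B_skew _ _ _ ax bx.
    exact: (trans (_, _) _ _ _ sf0).
  exact: (trans (_, _) _ _ _ sf1).
have Qred : generalised_SU_structure At B iota Q.
  split=> [a x p dx [p0 ps _ _]|a b x ax bx|a x dx].
  - by split; [exact: lt0r_neq0|exact: ps].
  - apply/seteqP; split=> [p Qp|_ [p Qp <-]]; last exact: Qsub.
    have SS := S_trans_Spin n_gt0 (n_even m) B_skew ax bx.
    have /SpinE /Pin_inv[S' [/SpinE S'S S'1 S1']] := SS.
    have inv rho : spinor_field At B rho.1 rho.2 -> rho.2 b x = cx S' *m rho.2 a x.
      move=> sf; rewrite (trans _ _ _ _ sf ax bx) mulmxA -map_mxM S'1 map_mx1 mul1mx.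
      by [].
    exists (p.1, S' *m p.2).
      exact: (Qtrans _ _ _ _ _ bx ax S'S (inv (_, _) sf0) (inv (_, _) sf1)).
    by rewrite mulmxA S1' mul1mx; case: (p).
  have [r0 [r1 [s [sr0 _ ss nE]]]] := CY_section dx.
  have [V [oV Vx Vd [srV ssV PV]]] := local_section dx sr0 ss nE.
  exists V; split=> //; exists (r0 \o chart At a), (s \o chart At a); split=> // y Vy.
  have dy := Vd _ Vy; have := PV _ Vy; rewrite cochartK // => -[r00 r10 ps E0 E1].
  (* The factor [lambda] turns the scalar of the second spinor into that of the first, so that one
     frame serves both. *)
  have Qy : Q a y (r0 (chart At a y), s (chart At a y)).
    split; [exact: r00|exact: ps|exact: E0|rewrite E1 act_scale].
    by rewrite -(lE _ _ _ _ _ dy r00 r10 ps E0 E1).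
  apply/seteqP; split=> [p Qp|_ [k Kk <-]].
    by have [k Kk ->] := fibre_torsor m_gt0 iota_lift Qy Qp; exists k.
  by have := fibreM m_gt0 iota_lift Kk Qy.
split=> //; first by split=> a x p dx [].
move=> Q' [Q'0 _ Q'loc] [Q'inv0 Q'inv1] a x dx.
(* After a common change of sign where needed, a frame of [Q'] has positive scalar and lies in
   [Q]. *)
have norm p : Q' a x p -> exists2 q, Q a x q & q.1 *: q.2 = p.1 *: p.2.
  move=> Q'p; have [p0 ps] := Q'0 _ _ _ dx Q'p.
  have E0 := Q'inv0 _ _ _ dx Q'p; have E1 := Q'inv1 _ _ _ dx Q'p.
  have [pp|pn] := ltP 0 p.1; first by exists p.
  exists (- p.1, - p.2); last by rewrite /= scaleNr scalerN opprK.
  split; rewrite ?act_opp.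
  - by rewrite oppr_gt0 lt_neqAle p0.
  - exact: SpinN.
  - by case: (p) E0.
  - by case: (p) E1.
apply/seteqP; split=> [_ [p Qp <-]|_ [p Q'p <-]]; last first.
  by have [q Qq E] := norm p Q'p; exists q.
(* Conversely one frame of [Q'] suffices: up to sign it lies in [Q], all of [Q] is reached from it
   by [K], and [Q'] is closed under [K]. *)
have [V [_ Vx _ [r' [s' [_ _ Q'V]]]]] := Q'loc _ _ dx.
have [k0 Kk0] := K_nonempty iota.
have Q'p' : Q' a x (r' x, s' x *m k0) by rewrite Q'V //; exists k0.
have [q Qq E] := norm _ Q'p'; have [k Kk ->] := fibre_torsor m_gt0 iota_lift Qq Qp.
exists (r' x, s' x *m (k0 *m k)).
  by rewrite Q'V //; exists (k0 *m k) => //; apply: (K_mul iota_lift).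
by rewrite /= mulmxA [LHS]scalemxAl [RHS]scalemxAl; congr (_ *m _); exact: esym E.
Qed.

End Metric.
End Forward.

Section SmoothStructure.
Variables (R : realType) (m p : nat).
Local Notation C := R[i].
Local Notation N := (fdim (m + m)).
Local Notation cx := (map_mx (real_complex R)).
Local Notation ii := (Complex 0 1 : C).
Local Notation T := 'M[R]_((m + m) + (m + m)).
Variables (x : 'cV[R]_p) (J : 'cV[R]_p -> T) (rho : 'cV[R]_p -> 'cV[C]_N).

Lemma gram_mul_entry (A : T) i j :
  (gram R (m + m) *m A) i j = inner (delta_mx i 0) (A *m delta_mx j 0).
Proof.
by rewrite /inner trmx_delta !mulmxA -colE [RHS]mxE -mulmxA -rowE [RHS]mxE.
Qed.

Lemma structure_smooth : csmooth_mx_near x rho ->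
    (\forall y \near x, [/\ complex_structure (J y), eigen_kills ii (cx (J y)) (rho y)
      & spairing (rho y) (map_mx conjc (rho y)) != 0]) ->
  smooth_mx_near x J.
Proof.
move=> sr nJ.
pose h (i j : 'I_((m + m) + (m + m))) y : C :=
  - (spairing (cliff (delta_mx i 0) *m (cliff (delta_mx j 0) *m rho y)) (map_mx conjc (rho y)) /
     spairing (rho y) (map_mx conjc (rho y))).
have sh i j : csmooth_near x (h i j).
  have src := csmx_conj sr.
  have scl : csmooth_mx_near x
      (fun y => cliff (delta_mx i 0 : 'cV[C]_((m + m) + (m + m))) *m (cliff (delta_mx j 0) *m rho y)).
    by apply: csmxM; [exact: csmx_cst|apply: csmxM => //; exact: csmx_cst].
  apply: csn_eq (csnM (csn_cst x (-1)) (csnM (csn_spairing scl src) (csnV _ (csn_spairing sr src)))).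
    by apply: near_all => y; rewrite mulN1r.
  by have [] := nbhs_singleton nJ.
(* The entries of the Gram matrix times [J] are the imaginary parts in [inner_JE]; the constant Gram
   matrix is inverted afterwards. *)
have sgJ : smooth_mx_near x (fun y => gram R (m + m) *m J y).
  move=> i j; apply: smooth_near_eq (sh i j).2; apply: filterS nJ => y [cJ kJ n0].
  have := inner_JE (two_neq0C R) (ii_sqr R) (complex_structure_cx cJ) kJ (n_even m)
    (conj_kills_cx kJ) n0 (delta_mx i 0) (delta_mx j 0); rewrite -/(h i j y) => <-.
  have dE k : delta_mx k 0 = cx (delta_mx k 0) :> 'cV[C]_((m + m) + (m + m)).
    by rewrite map_delta_mx.
  by rewrite !dE -map_mxM !map_inner mulrC -ComplexE /= gram_mul_entry.
apply: smx_eq (smxM (smx_cst x (invmx (gram R (m + m)))) sgJ); apply: near_all => y.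
by rewrite mulKmx // gram_unit // two_neq0R.
Qed.

End SmoothStructure.

(** * From reductions to generalised Calabi-Yau metrics *)

Section Reverse.
Variables (R : realType) (m : nat) (M : topologicalType) (I : Type).
Variables (At : oriented_atlas R (m + m) M I) (B : I -> M -> 'M[R]_(m + m)).
Variable iota : 'M[R[i]]_m -> 'M[R[i]]_m -> 'M[R]_(fdim (m + m)).
Hypotheses (m_gt0 : (0 < m)%N) (iota_lift : spin_lift iota).
Hypothesis B_skew : forall a x, dom At a x -> (B a x)^T = - B a x.
Local Notation C := R[i].
Local Notation N := (fdim (m + m)).
Local Notation cx := (map_mx (real_complex R)).
Local Notation ii := (Complex 0 1 : C).
Local Notation m0 := (model0 R m).
Local Notation m1 := (model1 R m).
Local Notation K := (SUxSU iota).
Local Notation T := 'M[R]_((m + m) + (m + m)).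

Let n_gt0 : (0 < m + m)%N. Proof. by rewrite addn_gt0 m_gt0. Qed.

Lemma spinor_structure b rho J : spinor_field At B b rho ->
    (forall a x, dom At a x -> [/\ complex_structure (J a x), eigen_kills ii (cx (J a x)) (rho a x),
       rho a x != 0 & spairing (rho a x) (map_mx conjc (rho a x)) != 0]) ->
  [/\ generalised_CY At B b rho, induces At rho J & generalised_complex At B J].
Proof.
move=> sf H; have two0 := two_neq0C R; have i2 := ii_sqr R; have [srho _ tr] := sf; split.
- split=> // a x dx; have [cJ kJ n0 p0] := H _ _ dx; last exact: p0.
  exact (kills_pure two0 i2 (complex_structure_cx cJ) kJ n0).
- move=> a x dx; have [cJ kJ n0 _] := H _ _ dx.
  exact (killsE two0 i2 (complex_structure_cx cJ) kJ n0).
split; [split=> [a i j|a b' x ax bx]|by move=> a x v w dx; have [[iJ _] _ _ _] := H _ _ dx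
  |by move=> a x dx; have [[_ JJ] _ _ _] := H _ _ dx].
- apply: near_smooth_in => [||x dx]; [exact: dom_open|by []|].
  have sr := smooth_cmx_in_near (dom_open At a) dx (@subset_refl _ _) (srho a).
  apply: (structure_smooth (J := J a \o cochart At a) sr).
  apply: filterS (near_chart (dom_open At a) dx (@subset_refl _ _)) => y [dy _] /=.
  by have [? ? _ ?] := H _ _ dy.
have iE := E_trans_isom B_skew ax bx; have SE := S_trans_covers n_gt0 B_skew ax bx.
have [cJ kJ n0 _] := H _ _ ax; have [cJ' kJ' _ _] := H _ _ bx.
(* The structure carried over from the other chart kills the same spinor, so it is the same
   structure. *)
have k' := transported_kills iE SE kJ'; rewrite -(tr _ _ _ ax bx) in k'.
have -> : J a x = E_trans At B a b' x *m J b' x *m isom_inv (E_trans At B a b' x).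
  by apply: real_structure_uniq kJ k' n0 => //; apply: complex_structure_conj => //; exact: two_neq0R.
by rewrite -[LHS]mulmxA isom_invl ?mulmx1 // two_neq0R.
Qed.

Section Structure.
Variable Q : I -> M -> set (R * 'M[R]_N).
Hypothesis su : generalised_SU_structure At B iota Q.

Lemma SU_nonempty a x : dom At a x -> exists p, Q a x p.
Proof.
move=> dx; have [_ _ loc] := su; have [V [_ Vx _ [r [s [_ _ QV]]]]] := loc _ _ dx.
by have [k Kk] := K_nonempty iota; exists (r x, s x *m k); rewrite QV //; exists k.
Qed.

(** All frames at a point differ by elements of [K], which fix the model spinors. *)
Lemma SU_act_uniq a x p q : dom At a x -> Q a x p -> Q a x q ->
  act p m0 = act q m0 /\ act p m1 = act q m1.
Proof.
move=> dx; have [_ _ loc] := su; have [V [_ Vx _ [r [s [_ _ QV]]]]] := loc _ _ dx.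
rewrite (QV _ Vx) => -[k Kk <-] [l Kl <-].
have [k0 k1] := act_K m_gt0 iota_lift (r x) (s x) Kk.
have [l0 l1] := act_K m_gt0 iota_lift (r x) (s x) Kl.
by rewrite k0 k1 l0 l1.
Qed.

Lemma SU_invariant_pair : exists rho0 rho1, invariant_pair At Q rho0 rho1.
Proof.
(* Where the fibre is empty, which happens only outside [dom a], the value is the default [(0, 0)];
   it is never read there. *)
pose p a x := xget (0, 0) (Q a x).
have Qp a x : dom At a x -> Q a x (p a x) by move=> dx; apply: xgetPex; exact: SU_nonempty.
exists (fun a x => act (p a x) m0), (fun a x => act (p a x) m1).
by split=> a x q dx Qq; have [E0 E1] := SU_act_uniq dx (Qp _ _ dx) Qq.
Qed.

Variables rho0 rho1 : I -> M -> 'cV[C]_N.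
Hypothesis inv : invariant_pair At Q rho0 rho1.

Lemma invariant_spinor_field b mod rho : has_parity b mod -> invariant_spinor At Q mod rho ->
  spinor_field At B b rho.
Proof.
move=> pm rhoE; have [Q0 Qtr loc] := su; split=> [a|a x dx|a b' x ax bx].
- apply: near_smooth_cmx_in => [||x dx]; [exact: dom_open|by []|].
  have [V [oV Vx Vd [r [s [sr ss QV]]]]] := loc _ _ dx.
  (* A fixed element of [K] turns the local section into a smooth choice of frames. *)
  have [k Kk] := K_nonempty iota.
  have sr' := smooth_in_near oV Vx Vd sr.
  have ss' : smooth_mx_near (chart At a x) (s \o cochart At a).
    by move=> i j; apply: (smooth_in_near oV Vx Vd (ss i j)).
  have sact : csmooth_mx_near (chart At a x)
      (fun y => toC (r (cochart At a y)) *: (cx (s (cochart At a y) *m k) *m mod)).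
    apply: csmxZ; first exact: csn_real.
    by apply: csmxM (csmx_cst _ _); apply: csmx_real; apply: smxM => //; exact: smx_cst.
  move=> i j; apply: csn_eq (sact i j).
  apply: filterS (near_chart oV Vx Vd) => y [Vy _] /=.
  rewrite (rhoE a _ (r (cochart At a y), s (cochart At a y) *m k)) //; first exact: Vd.
  by rewrite QV //; exists k.
- have [p Qp] := SU_nonempty dx; have [_ /SpinE ps] := Q0 _ _ _ dx Qp.
  rewrite (rhoE _ _ _ dx Qp) => S oS; rewrite mxE (Pin_parity_cx ps pm) ?mulr0 //.
- have [p Qp] := SU_nonempty bx.
  have Qa : Q a x (p.1, S_trans At B a b' x *m p.2) by rewrite (Qtr a b' x ax bx); exists p.
  rewrite (rhoE _ _ _ ax Qa) (rhoE _ _ _ bx Qp).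
  by have := act_mul (S_trans At B a b' x) p.1 p.2 mod.
Qed.

Lemma invariant_adapted a x : dom At a x -> exists JJ : T * T, adapted (rho0 a x) (rho1 a x) JJ.1 JJ.2.
Proof.
move=> dx; have [p Qp] := SU_nonempty dx; have [Q0 _ _] := su.
have [p0 ps] := Q0 _ _ _ dx Qp; have [E0 E1] := (inv.1 _ _ _ dx Qp, inv.2 _ _ _ dx Qp).
by rewrite E0 E1; exact: adapted_exists.
Qed.

(** A frame scales both pairings by the same real number, so the constant is the ratio of the model
    norms. *)
Lemma invariant_norm : exists c : C, forall a x, dom At a x ->
  [/\ spairing (rho0 a x) (map_mx conjc (rho0 a x)) != 0,
      spairing (rho1 a x) (map_mx conjc (rho1 a x)) != 0
    & c * spairing (rho0 a x) (map_mx conjc (rho0 a x)) =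
      spairing (rho1 a x) (map_mx conjc (rho1 a x))].
Proof.
exists (model_norm R m true / model_norm R m false) => a x dx.
have [[r s] Qp] := SU_nonempty dx; have [Q0 _ _] := su.
have [r0 ps] := Q0 _ _ _ dx Qp; have [e e1 E] := spairing_act ps.
have E0 : rho0 a x = act (r, s) m0 := inv.1 _ _ _ dx Qp.
have E1 : rho1 a x = act (r, s) m1 := inv.2 _ _ _ dx Qp.
rewrite E0 E1 !E.
rewrite -/(model_norm R m true) -/(model_norm R m false).
have e0 : e != 0 by apply: contra_eq_neq e1 => ->; rewrite mul0r eq_sym oner_eq0.
have c0 : toC (r * r * e) != 0 :> C.
  by rewrite (fmorph_eq0 (real_complex R)) !mulf_neq0.
split; [by rewrite mulf_neq0 ?model_norm_neq0|by rewrite mulf_neq0 ?model_norm_neq0|].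
by rewrite mulrCA divfK ?model_norm_neq0.
Qed.

Theorem invariant_CY_metric : generalised_CY_metric At B rho0 rho1.
Proof.
have sf0 := invariant_spinor_field (@model0_parity R m) inv.1.
have sf1 := invariant_spinor_field (@model1_parity R m) inv.2.
have [c cE] := invariant_norm.
(* The structures are chosen point by point; smoothness and compatibility on overlaps follow
   afterwards, since each is determined by its spinor. *)
have [|J JP] := @choice (I * M)%type (T * T)%type (fun ax JJ => dom At ax.1 ax.2 ->
    adapted (rho0 ax.1 ax.2) (rho1 ax.1 ax.2) JJ.1 JJ.2).
  move=> [a x]; have [dx|ndx] := pselect (dom At a x).
    by have [JJ JJP] := invariant_adapted dx; exists JJ.
  by exists (0, 0) => /ndx.
pose J0 a x := (J (a, x)).1; pose J1 a x := (J (a, x)).2.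
have ad a x : dom At a x -> adapted (rho0 a x) (rho1 a x) (J0 a x) (J1 a x) := JP (a, x).
have [gc0 ind0 gJ0] : [/\ generalised_CY At B false rho0, induces At rho0 J0
    & generalised_complex At B J0].
  apply: spinor_structure sf0 _ => a x dx; have [cJ _] := adapted_complex (ad _ _ dx).
  have [kJ _] := adapted_kills (ad _ _ dx); have [n0 _] := adapted_neq0 (ad _ _ dx).
  by have [p0 _ _] := cE _ _ dx.
have [gc1 ind1 gJ1] : [/\ generalised_CY At B (odd m) rho1, induces At rho1 J1
    & generalised_complex At B J1].
  apply: spinor_structure sf1 _ => a x dx; have [_ cJ] := adapted_complex (ad _ _ dx).
  have [_ kJ] := adapted_kills (ad _ _ dx); have [_ n0] := adapted_neq0 (ad _ _ dx).
  by have [_ p0 _] := cE _ _ dx.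
split=> //; first by exists c => a x dx; have [] := cE _ _ dx.
exists J0, J1; split=> //; split=> // a x dx; first exact: adapted_commute (ad _ _ dx).
exact: adapted_metric (ad _ _ dx).
Qed.

End Structure.
End Reverse.

Theorem proposition3p6 (R : realType) (m : nat) (m_gt0 : (0 < m)%N)
    (M : topologicalType) (M_hausdorff : hausdorff_space M)
    (M_second_countable : @second_countable M)
    (I : Type) (At : oriented_atlas R (m + m) M I)
    (H : I -> M -> 'I_(m + m) -> 'I_(m + m) -> 'I_(m + m) -> R)
    (H_closed : closed_3form At H)
    (B : I -> M -> 'M[R]_(m + m)) (B_potential : local_potentials At H B)
    (iota : 'M[R[i]]_m -> 'M[R[i]]_m -> 'M[R]_(fdim (m + m)))
    (iota_lift : spin_lift iota) :
  (forall rho0 rho1 : I -> M -> 'cV[R[i]]_(fdim (m + m)),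
     generalised_CY_metric At B rho0 rho1 ->
     exists2 lambda : R, 0 < lambda &
       exists Q, [/\ generalised_SU_structure At B iota Q,
         invariant_pair At Q rho0 (fun a x => toC lambda *: rho1 a x)
       & forall Q', generalised_SU_structure At B iota Q' ->
           invariant_pair At Q' rho0 (fun a x => toC lambda *: rho1 a x) ->
           same_action At Q Q'])
  /\
  (forall Q, generalised_SU_structure At B iota Q ->
     (exists rho0 rho1, invariant_pair At Q rho0 rho1) /\
     (forall rho0 rho1, invariant_pair At Q rho0 rho1 ->
        generalised_CY_metric At B rho0 rho1)).
Proof.
have [_ B_skew _] := B_potential; split=> [rho0 rho1 cy|Q su].
  have [lambda l0 lQ] := CY_structure m_gt0 iota_lift B_skew cy.
  by exists lambda => //; exists (fun a x => fibre (rho0 a x) (toC lambda *: rho1 a x)).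
split; first exact (SU_invariant_pair m_gt0 iota_lift su).
move=> rho0 rho1 inv.
exact (invariant_CY_metric m_gt0 B_skew su inv).
Qed.
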